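(* Let $Q$ be a non-degenerate isotropic quadratic form over $K_\nu$ in $n\geq 3$ variables, and assume that $Q$ is not a scalar multiple of a quadratic form whose coefficients lie in $K$. Then for every $\varepsilon>0$ there exists ${\bf v}\in\mathcal{O}_\nu^n\setminus\{0\}$ such that $|Q({\bf v})|<\varepsilon$.
   Context: $K$ is a global function field of characteristic $\mathfrak{p}\neq 2$, $\nu$ is a place of $K$, $K_\nu$ is the completion of $K$ at $\nu$, so $K_\nu\cong\mathbb{F}_{\mathfrak{q}}((\theta^{-1}))$ with $\mathfrak{q}$ a power of $\mathfrak{p}$, equipped with its absolute value $|\cdot|$ (normalized so that $|\theta|=\mathfrak{q}$). $\mathcal{O}_\nu$ denotes the ring of $\nu$-integers of $K$, i.e. the elements of $K$ which are integral at every place of $K$ other than $\nu$ (it is a discrete cocompact subring of $K_\nu$). *)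

(* Defs.v *)
From HB Require Import structures.
From mathcomp Require Import all_boot all_order all_algebra.
Set Implicit Arguments. Unset Strict Implicit. Unset Printing Implicit Defensive.
Import Order.TTheory GRing.Theory Num.Theory.
Local Open Scope ring_scope.

Definition prime_coeff_poly (F : fieldType) (P : {poly F}) : Prop :=
  forall i : nat, exists m : nat, P`_i = m%:R.

(* F is a global function field of characteristic p: char p > 0 and
   F is a finite extension of F_p(t) for some t transcendental over F_p. *)
Definition global_function_field (F : fieldType) (p : nat) : Prop :=
  p \in [pchar F] /\
  exists t : F,
    (forall P : {poly F}, prime_coeff_poly P -> P.[t] = 0 -> P = 0) /\
    exists b : seq F, forall x : F,
      exists (D : {poly F}) (c : seq {poly F}),
        [/\ prime_coeff_poly D, D.[t] != 0,
            size c = size b, (forall P, P \in c -> prime_coeff_poly P) &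
            x * D.[t] = \sum_(i < size b) (nth 0 c i).[t] * nth 0 b i].

(* Normalized discrete valuation w : F^* ->> Z (values at 0 irrelevant).
   For a global function field, these are exactly the places. *)
Definition dvaluation (F : fieldType) (w : F -> int) : Prop :=
  [/\ forall x y, x != 0 -> y != 0 -> w (x * y) = w x + w y,
      forall x y, x != 0 -> y != 0 -> x + y != 0 ->
        Order.min (w x) (w y) <= w (x + y)
    & forall k : int, exists x, x != 0 /\ w x = k].

Definition nu_integer (F : fieldType) (v : F -> int) (x : F) : Prop :=
  x = 0 \/
  forall w : F -> int, dvaluation w ->
    (exists y, y != 0 /\ w y != v y) -> 0 <= w x.

Definition residue_card (F : fieldType) (v : F -> int) (q : nat) : Prop :=
  exists r : seq F,
  [/\ size r = q,
      (forall a, a \in r -> a = 0 \/ 0 <= v a),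
      (forall i j : nat, (i < q)%N -> (j < q)%N -> i <> j ->
          nth 0 r i - nth 0 r j != 0 /\ v (nth 0 r i - nth 0 r j) <= 0)
    & (forall a, (a = 0 \/ 0 <= v a) ->
          exists2 b, b \in r & a - b = 0 \/ 0 < v (a - b))].

Definition is_completion (F L : fieldType) (iota : {rmorphism F -> L})
    (v : F -> int) (vL : L -> int) : Prop :=
  [/\ dvaluation vL,
      (forall x, x != 0 -> vL (iota x) = v x),
      (forall s : nat -> L,
          (forall N : int, exists M : nat, forall m k, (M <= m)%N -> (M <= k)%N ->
              s m = s k \/ N <= vL (s m - s k)) ->
          exists l : L, forall N : int, exists M : nat, forall m, (M <= m)%N ->
              s m = l \/ N <= vL (s m - l))
    & (forall (y : L) (N : int), exists x : F, iota x = y \/ N <= vL (iota x - y))].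

Definition absv (L : fieldType) (vL : L -> int) (q : nat) (y : L) : rat :=
  if y == 0 then 0 else (q%:Q) ^ (- vL y).

Definition qform (L : fieldType) (n : nat) (A : 'M[L]_n) (x : 'rV[L]_n) : L :=
  (x *m A *m x^T) 0 0.

(* Main.v *)
(** Suppose that [|Q|] is bounded below on the nonzero integral vectors.  Approximating a
    hyperbolic pair by integral vectors and adding a third one reduces to ternary forms, and
    after a change of variables an integral ternary lattice becomes a lattice [D] in [k^3] on
    which [Q0 = 2 x1 x3 - x2^2] is bounded below ("good").

    The unipotent group [u(t)] of isometries of [Q0] acts on such lattices, and ultrafilter
    limits replace compactness of the space of lattices.  The heart is that [Q0] is isolated
    among the forms of determinant [1] which are good on [D].  Otherwise take a minimal closed
    [u]-invariant set [Z] of lattices that violate this.  Comparing nearby lattices of [Z] under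
    [u(t)], with [t] as large as the polynomial divergence allows, yields polynomials
    [Phi], [lambda] such that [Q0 + (Phi + beta lambda^2) x3^2] is good on [Z] for many [beta].
    If one of these polynomials has a nonzero derivative, Hensel's lemma gives an open set of
    [beta] with [Q0 + beta x3^2] good on [Z], which is absurd; in characteristic [3] the
    remaining case [Phi = g tau^3] is excluded by first dividing out the translations
    [x1 := x1 + s x3] that already preserve [Z].

    Isolation makes the return maps of the [u]-orbit of [D] exact isometries of [Q0].  They are
    rational over [K], and a form invariant under all of them is a multiple of [Q0]; hence [Q]
    is a multiple of a form over [K].

    That the ring of integers is cocompact, used throughout, follows from counting in the
    style of Riemann's inequality together with weak approximation. *)
Require Import Defs.
From HB Require Import structures.
From mathcomp Require Import all_boot all_order all_algebra finfield.
From mathcomp Require Import boolp classical_sets filter.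
From mathcomp Require Import ring zify.
Set Implicit Arguments. Unset Strict Implicit. Unset Printing Implicit Defensive.
Import Order.TTheory GRing.Theory Num.Theory.
Local Open Scope ring_scope.

(** * Discrete valuations and limits along ultrafilters *)

(** Goodness takes the place of Mahler's criterion: it makes lattices uniformly discrete, an index
    bound makes them uniformly cocompact, and both conditions pass to ultralimits. Thus no topology
    on a homogeneous space is set up.

    The maps that survive renormalization normalize [u]. They carry [Q0 + beta x3^2] to a form of
    the same shape, so each recurrence in a minimal set acts on the parameters [beta] that are good
    there, and minimality spreads what holds for one lattice to all.

    The obstacle is inseparability: a nonconstant polynomial may have derivative zero, and then
    Hensel's lemma gives no ball in its image. Knowing only [beta = 0] would constrain [Phi] but not
    [lambda]; a second parameter is extracted from the very forms that violate isolation. With two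
    parameters the odd characteristic removes all terms except a cubic one in characteristic three.
    A quintic term, which would be inseparable in characteristic five, arises only from the
    compensating translations, and these are used in characteristic three alone. *)

Definition vge (k : fieldType) (w : k -> int) (N : int) (x : k) : bool :=
  (x == 0) || (N <= w x).

Ltac vlia := repeat match goal with
  | H : is_true (vge _ _ _) |- _ => clear H
  | H : is_true (_ \in _) |- _ => clear H
  | H : is_true (~~ _) |- _ => clear H end; lia.

Section Valuation.
Context (k : fieldType) (w : k -> int) (hw : dvaluation w).
Local Notation vge := (vge w).

Lemma val_mul x y : x != 0 -> y != 0 -> w (x * y) = w x + w y.
Proof. by case: hw => h _ _; exact: h. Qed.

Lemma val_one : w 1 = 0.
Proof.
have : w 1 = w 1 + w 1 by rewrite -val_mul ?oner_neq0 // mulr1.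
by lia.
Qed.

Lemma val_exp x n : x != 0 -> w (x ^+ n) = w x *+ n.
Proof.
move=> x0; elim: n => [|n IH]; first by rewrite expr0 val_one.
by rewrite exprS val_mul ?expf_neq0 // IH mulrS.
Qed.

Lemma val_opp x : w (- x) = w x.
Proof.
have [->|x0] := eqVneq x 0; first by rewrite oppr0.
have hN1 : w (-1) = 0.
  have : w (-1) + w (-1) = 0 by rewrite -val_mul ?oppr_eq0 ?oner_eq0 // mulrNN mulr1 val_one.
  by lia.
by rewrite -mulN1r val_mul ?oppr_eq0 ?oner_eq0 // hN1 add0r.
Qed.

Lemma val_inv x : x != 0 -> w x^-1 = - w x.
Proof.
move=> x0; have : w x + w x^-1 = 0 by rewrite -val_mul ?invr_eq0 // mulfV // val_one.
by lia.
Qed.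

Lemma val_ex N : exists2 x, x != 0 & w x = N.
Proof. by case: hw => _ _ /(_ N) [x [x0 wx]]; exists x. Qed.

Lemma vge0 N : vge N 0.
Proof. by rewrite /vge eqxx. Qed.

Lemma vgeE N x : x != 0 -> vge N x = (N <= w x).
Proof. by rewrite /vge => /negbTE->. Qed.

Lemma vge_le M N x : M <= N -> vge N x -> vge M x.
Proof. by rewrite /vge => MN /orP[->//|Nx]; rewrite (le_trans MN Nx) orbT. Qed.

Lemma vgeN N x : vge N (- x) = vge N x.
Proof. by rewrite /vge oppr_eq0 val_opp. Qed.

Lemma vgeD N x y : vge N x -> vge N y -> vge N (x + y).
Proof.
case: hw => _ hadd _.
have [->|x0] := eqVneq x 0; first by rewrite add0r.
have [->|y0] := eqVneq y 0; first by rewrite addr0.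
have [->|xy0] := eqVneq (x + y) 0; first by move=> _ _; rewrite vge0.
rewrite !vgeE //= => Nx Ny; apply: le_trans (hadd _ _ x0 y0 xy0).
by rewrite le_min Nx.
Qed.

Lemma vgeB N x y : vge N x -> vge N y -> vge N (x - y).
Proof. by move=> hx hy; rewrite vgeD ?vgeN. Qed.

Lemma vgeBC N x y : vge N (x - y) = vge N (y - x).
Proof. by rewrite -vgeN opprB. Qed.

Lemma vge_trans N x y z : vge N (x - y) -> vge N (y - z) -> vge N (x - z).
Proof. by move=> h1 h2; rewrite -(subrK y x) -addrA vgeD. Qed.

Lemma vgeM M N x y : vge M x -> vge N y -> vge (M + N) (x * y).
Proof.
have [->|x0] := eqVneq x 0; first by move=> _ _; rewrite mul0r vge0.
have [->|y0] := eqVneq y 0; first by move=> _ _; rewrite mulr0 vge0.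
by rewrite !vgeE ?mulf_neq0 // val_mul // => h1 h2; lia.
Qed.

Lemma vge_val x : vge (w x) x.
Proof. by rewrite /vge lexx orbT. Qed.

Lemma vgeMl N x y : x != 0 -> vge N (x * y) = vge (N - w x) y.
Proof.
move=> x0; rewrite /vge mulf_eq0 (negbTE x0) /=.
by have [//|y0] := eqVneq y 0; rewrite val_mul //=; lia.
Qed.

Lemma vgeMr N x y : y != 0 -> vge N (x * y) = vge (N - w y) x.
Proof. by move=> y0; rewrite mulrC vgeMl. Qed.

Lemma vge1 : vge 0 1.
Proof. by rewrite vgeE ?oner_eq0 // val_one. Qed.

Lemma vgeX N x n : vge N x -> vge (N *+ n) (x ^+ n).
Proof.
move=> hx; elim: n => [|n IH]; first by rewrite expr0 vge1.
by rewrite exprS mulrS vgeM.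
Qed.

Lemma vge_nat n : vge 0 n%:R.
Proof. by elim: n => [|n IH]; rewrite ?vge0 // -natr1 vgeD ?vge1. Qed.

Lemma vge_eq0 x : (forall N : nat, vge N%:Z x) -> x = 0.
Proof.
move=> h; apply/eqP; apply/negPn/negP => x0.
by have := h `|w x|.+1%N; rewrite vgeE //; lia.
Qed.

Lemma val_dom x y : x != 0 -> vge (w x + 1) (y - x) -> y != 0 /\ w y = w x.
Proof.
move=> x0 h.
have y0 : y != 0.
  by apply: contraL h => /eqP->; rewrite sub0r vgeN vgeE //; lia.
split=> //; apply/eqP; rewrite eq_le; apply/andP; split; last first.
  rewrite -(vgeE _ y0) -(subrK x y) vgeD ?vge_val //.
  by apply: vge_le h; lia.
rewrite leNgt; apply/negP => lt.
have : vge (w x + 1) x.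
  rewrite -[X in vge _ X](subKr y x) vgeB //.
  by rewrite vgeE //; lia.
by rewrite vgeE //; lia.
Qed.

Lemma vge_sum (I : Type) (r : seq I) (Q : pred I) (F : I -> k) N :
  (forall i, Q i -> vge N (F i)) -> vge N (\sum_(i <- r | Q i) F i).
Proof. by move=> h; elim/big_ind: _ => // [|x y]; [rewrite vge0|exact: vgeD]. Qed.

(** Fermat's little theorem gives [n ^ p = n] in characteristic [p], so [(p - 1) w(n) = 0]. *)
Lemma val_nat p n : p \in [pchar k] -> n%:R != 0 :> k -> w n%:R = 0.
Proof.
move=> hp n0.
have e : n%:R ^+ p = n%:R :> k by rewrite -(pFrobenius_autE hp) pFrobenius_aut_nat.
have p1 := prime_gt1 (pcharf_prime hp).
have /eqP : w n%:R * (p%:Z - 1) = 0.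
  by rewrite mulrBr mulr1 -natz mulr_natr -val_exp // e subrr.
by rewrite mulf_eq0 => /orP[/eqP//|/eqP]; lia.
Qed.

End Valuation.

(** * Ultrafilters and limits along them *)

Record ultra (I : Type) (F : (I -> Prop) -> Prop) : Prop := Ultra {
  ultraT : F (fun _ => True);
  ultraS : forall A B : I -> Prop, (forall i, A i -> B i) -> F A -> F B;
  ultraI : forall A B : I -> Prop, F A -> F B -> F (fun i => A i /\ B i);
  ultraC : forall A : I -> Prop, F A \/ F (fun i => ~ A i);
  ultra0 : ~ F (fun _ => False) }.

Section UltraTheory.
Context (I : Type) (F : (I -> Prop) -> Prop) (hF : ultra F).

Lemma ultraA (A : I -> Prop) : (forall i, A i) -> F A.
Proof. by move=> h; apply: (ultraS hF) (ultraT hF). Qed.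

Lemma ultra_ex A : F A -> exists i, A i.
Proof.
move=> hA; apply: contrapT => hn; apply: (ultra0 hF).
by apply: (ultraS hF) hA => i Ai; apply: hn; exists i.
Qed.

Lemma ultraS2 (A B C : I -> Prop) :
  (forall i, A i -> B i -> C i) -> F A -> F B -> F C.
Proof.
by move=> h hA hB; apply: (ultraS hF) (ultraI hF hA hB) => i [/h]; exact.
Qed.

Lemma ultraN (A : I -> Prop) : ~ F A -> F (fun i => ~ A i).
Proof. by case: (ultraC hF A). Qed.

Lemma ultra_or (A B : I -> Prop) : F (fun i => A i \/ B i) -> F A \/ F B.
Proof.
move=> h; case: (ultraC hF A); [by left|move=> nA; right].
by apply: ultraS2 h nA => i [].
Qed.

(** An ultrafilter does not split over a finite union, so a choice among finitely many options made
    at each index can be made once. *)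
Lemma ultra_seq (T : eqType) (s : seq T) (A : T -> I -> Prop) :
  F (fun i => exists2 t, t \in s & A t i) -> exists2 t, t \in s & F (A t).
Proof.
elim: s => [|t s IH] h.
  by have [i [t]] := ultra_ex h.
have /ultra_or[ht|/IH[u us Fu]] : F (fun i => A t i \/ exists2 u, u \in s & A u i).
- by apply: (ultraS hF) h => i [u]; rewrite in_cons => /orP[/eqP->|us Au]; [left|right; exists u].
- by exists t; rewrite ?mem_head.
- by exists u; rewrite // in_cons us orbT.
Qed.

Lemma ultra_all (T : eqType) (s : seq T) (A : T -> I -> Prop) :
  (forall t, t \in s -> F (A t)) -> F (fun i => forall t, t \in s -> A t i).
Proof.
elim: s => [|t s IH] h; first exact: ultraA.
have h1 : F (A t) by apply: h; rewrite mem_head.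
have h2 := IH (fun u us => h u (@mem_behead _ (t :: s) u us)).
apply: ultraS2 h1 h2 => i Ai hi u; rewrite in_cons => /orP[/eqP->//|].
exact: hi.
Qed.

End UltraTheory.

(** The sets [D a] form a filter base. It serves both for limits along the integers and for limits
    along a chain of closed sets. *)
Lemma ultra_directed (I J : Type) (D : J -> I -> Prop) :
  J -> (forall a, exists i, D a i) ->
  (forall a b, exists c, forall i, D c i -> D a i /\ D b i) ->
  exists2 F : (I -> Prop) -> Prop, ultra F & forall a, F (D a).
Proof.
move=> a0 ne dir.
pose G : set_system I := fun A : set I => exists a, forall i, D a i -> A i.
have GP : ProperFilter G.
  apply: Build_ProperFilter.
    by move=> [a ha]; have [i /ha] := ne a.
  split.
  - by exists a0.
  - move=> A B [a ha] [b hb]; have [c hc] := dir a b; exists c => i /hc[/ha ? /hb ?].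
    by split.
  - by move=> A B AB [a ha]; exists a => i /ha/AB.
have [U [UU GU]] := ultraFilterLemma GP.
exists U; last by move=> a; apply: GU; exists a.
have UP : ProperFilter U by exact: ultra_proper.
split.
- exact: filterT.
- by move=> A B AB; apply: filterS.
- by move=> A B; apply: filterI.
- by move=> A; apply: in_ultra_setVsetC.
- exact: filter_not_empty.
Qed.

Lemma ultra_nat :
  exists2 F : (nat -> Prop) -> Prop, ultra F & forall N, F (fun n => (N <= n)%N).
Proof.
apply: (@ultra_directed nat nat (fun N n => (N <= n)%N)); first exact: 0%N.
- by move=> a; exists a.
- by move=> a b; exists (maxn a b) => i; rewrite geq_max => /andP[].
Qed.

Definition cv (k : fieldType) (w : k -> int) (I : Type) (F : (I -> Prop) -> Prop)
  (f : I -> k) (l : k) := forall N, F (fun i => vge w N (f i - l)).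

Section Limits.
Context (k : fieldType) (w : k -> int) (hw : dvaluation w).
Context (I : Type) (F : (I -> Prop) -> Prop) (hF : ultra F).
Local Notation vge := (vge w).
Local Notation cv := (cv w F).

Lemma cvC a : cv (fun _ => a) a.
Proof. by move=> N; apply: (ultraA hF) => i; rewrite subrr vge0. Qed.

Lemma cvD f g a b : cv f a -> cv g b -> cv (fun i => f i + g i) (a + b).
Proof.
move=> hf hg N; apply: (ultraS2 hF _ (hf N) (hg N)) => i h1 h2.
by rewrite opprD addrACA vgeD.
Qed.

Lemma cvN f a : cv f a -> cv (fun i => - f i) (- a).
Proof. by move=> hf N; apply: (ultraS hF) (hf N) => i; rewrite -opprD (vgeN hw). Qed.

Lemma cvM f g a b : cv f a -> cv g b -> cv (fun i => f i * g i) (a * b).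
Proof.
move=> hf hg N.
pose M : int := Num.max 0 (Num.max (N - w a) (N - w b)).
have := hf (Num.max M N); have := hg (Num.max M N).
apply: (ultraS2 hF) => i h1 h2.
have -> : f i * g i - a * b =
  (f i - a) * (g i - b) + (f i - a) * b + a * (g i - b) by ring.
apply: vgeD => //; first apply: vgeD => //.
- by apply: (vge_le _ (vgeM hw h2 h1)); lia.
- by apply: (vge_le _ (vgeM hw h2 (vge_val w b))); lia.
- by apply: (vge_le _ (vgeM hw (vge_val w a) h1)); lia.
Qed.

Lemma cvX f a n : cv f a -> cv (fun i => f i ^+ n) (a ^+ n).
Proof.
move=> hf; elim: n => [|n IH]; first by under [X in cv X]funext do rewrite expr0; apply: cvC.
by under [X in cv X]funext do rewrite exprS; rewrite exprS; apply: cvM.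
Qed.

Lemma cv_uniq f a b : cv f a -> cv f b -> a = b.
Proof.
move=> ha hb; apply/eqP; rewrite -subr_eq0; apply/eqP; apply: (vge_eq0 (w := w)) => N.
have [i [h1 h2]] := ultra_ex hF (ultraI hF (ha N) (hb N)).
by apply: (vge_trans hw) h2; rewrite (vgeBC hw).
Qed.

Lemma cv_ext f g a : F (fun i => f i = g i) -> cv f a -> cv g a.
Proof. by move=> h hf N; apply: (ultraS2 hF _ h (hf N)) => i ->. Qed.

Lemma cv_vge f a N : cv f a -> F (fun i => vge N (f i)) -> vge N a.
Proof.
move=> ha h; have [i [h1 h2]] := ultra_ex hF (ultraI hF (ha N) h).
by rewrite -(subKr (f i) a) vgeB.
Qed.

Lemma cv_vge_ev f a N : cv f a -> vge N a -> F (fun i => vge N (f i)).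
Proof.
move=> ha h; apply: (ultraS hF) (ha N) => i hi.
by rewrite -(subrK a (f i)) vgeD.
Qed.

Lemma cv_val f a : cv f a -> a != 0 -> F (fun i => f i != 0 /\ w (f i) = w a).
Proof.
by move=> ha a0; apply: (ultraS hF) (ha (w a + 1)) => i; apply: val_dom.
Qed.

Lemma cvV f a : cv f a -> a != 0 -> cv (fun i => (f i)^-1) a^-1.
Proof.
move=> ha a0 N; apply: (ultraS2 hF _ (cv_val ha a0) (ha (N + w a + w a))) => i [f0 wf] h.
have -> : (f i)^-1 - a^-1 = - (a^-1 * ((f i)^-1 * (f i - a))) by field; rewrite f0 a0.
rewrite (vgeN hw) !(vgeMl hw) ?invr_eq0 // !(val_inv hw) // wf.
by apply: vge_le h; lia.
Qed.

End Limits.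

(** * Compactness of balls *)

Definition complete_val (k : fieldType) (w : k -> int) :=
  forall s : nat -> k,
    (forall N : int, exists M : nat, forall m n, (M <= m)%N -> (M <= n)%N ->
       vge w N (s m - s n)) ->
    exists l : k, forall N : int, exists M : nat, forall m, (M <= m)%N ->
       vge w N (s m - l).

Definition residue_system (k : fieldType) (w : k -> int) (q : nat) (res : seq k) :=
  [/\ size res = q, uniq res, (forall a, a \in res -> vge w 0 a),
      (forall a b, a \in res -> b \in res -> vge w 1 (a - b) -> a = b) &
      forall a, vge w 0 a -> exists2 b, b \in res & vge w 1 (a - b)].

Section LocallyCompact.
Context (k : fieldType) (w : k -> int) (hw : dvaluation w).
Context (hcomp : complete_val w) (q : nat) (res : seq k)
  (hres : residue_system w q res).
Local Notation vge := (vge w).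

(** Digit expansion: each level adds a residue times an element of valuation [N + L]. The exact
    count [q ^ L] later replaces volume. *)
Lemma ball_reps (N : int) (L : nat) : exists T : seq k,
  [/\ size T = (q ^ L)%N, uniq T, (forall a, a \in T -> vge N a),
      (forall a b, a \in T -> b \in T -> vge (N + L%:Z) (a - b) -> a = b) &
      forall a, vge N a -> exists2 b, b \in T & vge (N + L%:Z) (a - b)].
Proof.
elim: L => [|L [T [sT uT T1 T2 T3]]].
  exists [:: 0]; split=> //.
  - by move=> a; rewrite inE => /eqP->; rewrite vge0.
  - by move=> a b; rewrite !inE => /eqP-> /eqP->.
  - by move=> a ha; exists 0; [rewrite inE|rewrite (subr0 a); apply: (vge_le _ ha); vlia].
have [sr ur r1 r2 r3] := hres.
have [c c0 wc] := val_ex hw (N + L%:Z).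
have sep t t' r r' : t \in T -> t' \in T -> r \in res -> r' \in res ->
    vge (N + L.+1%:Z) (t + c * r - (t' + c * r')) -> (t, r) = (t', r').
  move=> ht ht' hr hr' h.
  have tt : t = t'.
    apply: T2 => //.
    have -> : t - t' = (t + c * r - (t' + c * r')) - c * (r - r') by ring.
    apply: (vgeB hw); first by apply: vge_le h; vlia.
    by rewrite (vgeMl hw) // wc; apply: (@vge_le _ _ _ 0); [vlia|rewrite vgeB ?r1].
  rewrite tt in h *; congr (_, _); apply: r2 => //.
  have : vge (N + L.+1%:Z) (c * (r - r')) by rewrite mulrBr; move: h; rewrite opprD addrACA subrr add0r.
  by rewrite (vgeMl hw) // wc; apply: vge_le; vlia.
exists [seq t + c * r | t <- T, r <- res]; split.
- by rewrite size_allpairs sT sr expnSr.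
- apply: allpairs_uniq => // -[t r] [t' r'] /=.
  move=> /allpairsP[[a b] /= [h1 h2 [-> ->]]] /allpairsP[[a' b'] /= [h1' h2' [-> ->]]] e.
  by apply: sep => //; rewrite e subrr vge0.
- move=> a /allpairsP[[t r] /= [h1 h2 ->]]; apply: (vgeD hw); first exact: T1.
  by rewrite (vgeMl hw) // wc; apply: (@vge_le _ _ _ 0); [vlia|exact: r1].
- move=> a b /allpairsP[[t r] /= [h1 h2 ->]] /allpairsP[[t' r'] /= [h1' h2' ->]].
  by move=> /(sep _ _ _ _ h1 h1' h2 h2')[-> ->].
- move=> a /T3[t tT ht].
  have [r rr hr] : exists2 r, r \in res & vge 1 ((a - t) / c - r).
    by apply: r3; rewrite (vgeMr hw) ?invr_eq0 // (val_inv hw) // wc; apply: vge_le ht; vlia.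
  exists (t + c * r); first by apply/allpairsP; exists (t, r).
  have -> : a - (t + c * r) = c * ((a - t) / c - r) by field.
  by rewrite (vgeMl hw) // wc; apply: vge_le hr; vlia.
Qed.

Lemma residue_card_gt1 : (1 < q)%N.
Proof.
have [<- ur r1 r2 r3] := hres.
have [a ha h0] := r3 0 (vge0 _ _).
have [b hb h1] := r3 1 (vge1 hw).
have ab : a != b.
  apply/eqP => ab; rewrite ab in h0.
  have : vge 1 ((1 - b) - (0 - b)) by rewrite vgeB.
  have -> : (1 - b) - (0 - b) = 1 by ring.
  by rewrite vgeE ?oner_eq0 // (val_one hw).
case: res ha hb => [|c [|d r]] //=; rewrite !inE => /eqP ea /eqP eb.
by rewrite ea eb eqxx in ab.
Qed.

(** At each level the ultrafilter selects one of finitely many residue classes; the representatives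
    form a Cauchy sequence whose limit is that of [f]. *)
Lemma cv_compact (I : Type) (F : (I -> Prop) -> Prop) (hF : ultra F) f N :
  F (fun i => vge N (f i)) -> exists l, cv w F f l.
Proof.
move=> hf.
have step (L : nat) : exists x, F (fun i => vge (N + L%:Z) (f i - x)).
  have [T [_ _ _ _ T3]] := ball_reps N L.
  have [] := @ultra_seq _ _ hF _ T (fun t i => vge (N + L%:Z) (f i - t)).
    by apply: (ultraS hF) hf => i /T3.
  by move=> t _ ht; exists t.
have [x hx] := choice step.
have xC m n L : (L <= m)%N -> (L <= n)%N -> vge (N + L%:Z) (x m - x n).
  move=> Lm Ln; have [i [h1 h2]] := ultra_ex hF (ultraI hF (hx m) (hx n)).
  apply: (vge_trans hw (y := f i)); last by apply: vge_le h2; vlia.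
  by rewrite (vgeBC hw); apply: vge_le h1; vlia.
have [|l hl] := hcomp (s := x).
  move=> M; exists `|M - N|%N => m n h1 h2; apply: vge_le (xC _ _ _ h1 h2); vlia.
exists l => M; have [m0 hm0] := hl M.
pose m := maxn m0 `|M - N|%N.
apply: (ultraS hF) (hx m) => i hi.
apply: (vge_trans hw (y := x m)); last by apply: hm0; rewrite leq_maxl.
by apply: vge_le hi; rewrite /m; vlia.
Qed.

End LocallyCompact.

(** * Hensel's lemma *)

Section Hensel.
Context (k : fieldType) (w : k -> int) (hw : dvaluation w).
Context (hcomp : complete_val w) (q : nat) (res : seq k)
  (hres : residue_system w q res).
Local Notation vge := (vge w).

(** A monomial of degree [i >= 2] contributes [x - y] times products of [i - 1 >= 1] factors from
    the ball of [M]. This is the contraction behind Hensel's lemma. *)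
Lemma horner_diff_small (Q : {poly k}) : Q`_1 = 0 ->
  exists B : int, forall (M : int) x y, 0 <= M -> vge M x -> vge M y ->
    exists2 s, Q.[x] - Q.[y] = (x - y) * s & vge (B + M) s.
Proof.
move=> Q1.
have [B hB] : exists B : int, forall i, vge B Q`_i.
  elim/poly_ind: Q {Q1} => [|Q c [B hB]]; first by exists 0 => i; rewrite coef0 vge0.
  exists (Num.min B (w c)) => i; rewrite coefD coefMX coefC.
  case: i => [|i] /=; first by rewrite add0r; apply: (vge_le _ (vge_val w c)); vlia.
  by rewrite addr0; apply: (vge_le _ (hB i)); vlia.
exists B => M x y M0 hx hy.
exists (\sum_(i < size Q) Q`_i * \sum_(j < i) x ^+ (i.-1 - j) * y ^+ j).
  rewrite !horner_coef -sumrB mulr_sumr; apply: eq_bigr => i _.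
  by rewrite -mulrBr subrXX mulrCA.
apply: (vge_sum hw) => i _.
have [i0|[i1|i2]] : (i = 0 :> nat \/ i = 1 :> nat \/ 1 < i)%N by vlia.
- by rewrite i0 big_ord0 mulr0 vge0.
- by rewrite i1 Q1 mul0r vge0.
apply: (vgeM hw) => //; apply: (vge_sum hw) => j _.
have := vgeM hw (vgeX hw (i.-1 - j) hx) (vgeX hw j hy).
apply: vge_le; rewrite -mulrnDr -mulr_natr natz.
have := ltn_ord j; nia.
Qed.

(** Newton iteration with the fixed slope [P'(a)]. The conclusion is stated as openness of [P] near
    [a] rather than as lifting of a root. *)
Lemma hensel (P : {poly k}) (a : k) (N : int) : P^`().[a] != 0 ->
  exists N0 : int, forall y, vge N0 y ->
    exists2 x, vge N (x - a) & P.[x] = P.[a] + y.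
Proof.
move=> d0; set d := P^`().[a] in d0.
pose R := P \Po ('X + a%:P).
have RE h : R.[h] = P.[h + a] by rewrite horner_comp !hornerE.
pose Q := R - d *: 'X.
have [|B hB] := @horner_diff_small Q.
  rewrite coefB coefZ coefX mulr1; apply/eqP; rewrite subr_eq0; apply/eqP.
  have -> : R`_1 = R^`().[0] by rewrite horner_coef0 coef_deriv mulr1n.
  by rewrite deriv_comp derivD derivX derivC addr0 mulr1 horner_comp !hornerE.
(* The bound [0] makes powers contract, [N] keeps the solution near [a], and [w d + 1 - B] makes the
   error slope [s] smaller than [d]. *)
pose M : int := Num.max 0 (Num.max N (w d + 1 - B)).
have lip x y : vge M x -> vge M y ->
    exists2 s, R.[x] - R.[y] = (x - y) * (d + s) & vge (w d + 1) s.
  move=> hx hy; have [|s es hs] := hB M x y _ hx hy; first by rewrite /M; vlia.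
  exists s; last by apply: (vge_le _ hs); rewrite /M; vlia.
  have : R.[x] - R.[y] = (Q.[x] - Q.[y]) + d * (x - y).
    by rewrite /Q !hornerE; ring.
  by rewrite es => ->; ring.
exists (M + w d) => y hy.
have approx (n : nat) : exists h, vge M h /\ vge (M + w d + n%:Z) (P.[a] + y - R.[h]).
  elim: n => [|n [h [hh he]]].
    exists 0; split; first exact: vge0.
    have -> : P.[a] + y - R.[0] = y by rewrite RE (add0r a); ring.
    by apply: (vge_le _ hy); vlia.
  set e := P.[a] + y - R.[h] in he.
  have hu : vge (M + n%:Z) (e / d).
    by rewrite (vgeMr hw) ?invr_eq0 // (val_inv hw) //; apply: (vge_le _ he); vlia.
  have hM : vge M (h + e / d) by apply: (vgeD hw) => //; apply: (vge_le _ hu); vlia.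
  exists (h + e / d); split=> //.
  have [s es hs] := lip _ _ hM hh.
  have -> : P.[a] + y - R.[h + e / d] = - (e / d * s).
    have -> : P.[a] + y = e + R.[h] by rewrite /e subrK.
    have -> : e + R.[h] - R.[h + e / d] = e - (R.[h + e / d] - R.[h]) by ring.
    by rewrite es; field.
  rewrite (vgeN hw); apply: (vge_le _ (vgeM hw hu hs)); vlia.
(* The approximations are chosen independently and are not shown to be Cauchy; compactness gives an
   ultrafilter limit, and [lip] shows that it solves the equation. *)
have [h hh] := choice approx.
have [F hF FN] := ultra_nat.
have [l hl] := @cv_compact _ _ hw hcomp _ _ hres _ _ hF h M (ultraA hF (fun n => proj1 (hh n))).
have lM : vge M l by apply: (cv_vge hw hF hl); apply: (ultraA hF) => n; case: (hh n).
exists (l + a); first by rewrite addrK; apply: (vge_le _ lM); rewrite /M; vlia.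
apply/eqP; rewrite -subr_eq0 -RE; apply/eqP; apply: (vge_eq0 (w := w)) => n0.
have [n [h1 h2]] := ultra_ex hF (ultraI hF (hl (n0%:Z - w d)) (FN `|(n0%:Z - (M + w d))%R|%N)).
have [hM1 he] := hh n; have [s es hs] := lip _ _ hM1 lM.
have -> : R.[l] - (P.[a] + y) = - ((P.[a] + y - R.[h n]) + (R.[h n] - R.[l])) by ring.
rewrite (vgeN hw) vgeD //; first by apply: (vge_le _ he); vlia.
rewrite es; apply: (@vge_le _ _ _ ((n0%:Z - w d) + w d)); first by vlia.
apply: (vgeM hw) => //; apply: (vgeD hw); first exact: vge_val.
by apply: (vge_le _ hs); vlia.
Qed.

End Hensel.

(** * Ternary quadratic forms *)

Section TernaryAlgebra.
Context (k : fieldType).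

Definition vec := (k * k * k)%type.
Definition lin := (vec * vec * vec)%type.

(** The entries 11, 12, 13, 22, 23, 33 of a symmetric matrix; those off the diagonal count twice in
    the quadratic form. *)
Record qf := Qf { qa : k; qb : k; qc : k; qd : k; qe : k; qff : k }.

Definition scal (a : k) (x : vec) : vec := (a * x.1.1, a * x.1.2, a * x.2).

(* [g] stores the images of the three basis vectors *)
Definition app (g : lin) (x : vec) : vec :=
  (x.1.1 * g.1.1.1.1 + x.1.2 * g.1.2.1.1 + x.2 * g.2.1.1,
   x.1.1 * g.1.1.1.2 + x.1.2 * g.1.2.1.2 + x.2 * g.2.1.2,
   x.1.1 * g.1.1.2 + x.1.2 * g.1.2.2 + x.2 * g.2.2).

Definition bil (q : qf) (x y : vec) : k :=
  qa q * (x.1.1 * y.1.1) + qb q * (x.1.1 * y.1.2 + x.1.2 * y.1.1)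
  + qc q * (x.1.1 * y.2 + x.2 * y.1.1) + qd q * (x.1.2 * y.1.2)
  + qe q * (x.1.2 * y.2 + x.2 * y.1.2) + qff q * (x.2 * y.2).

Definition ev (q : qf) (x : vec) : k := bil q x x.

Definition pull (q : qf) (g : lin) : qf :=
  Qf (bil q g.1.1 g.1.1) (bil q g.1.1 g.1.2) (bil q g.1.1 g.2)
     (bil q g.1.2 g.1.2) (bil q g.1.2 g.2) (bil q g.2 g.2).

Definition det3 (x y z : vec) : k :=
  x.1.1 * (y.1.2 * z.2 - y.2 * z.1.2) - x.1.2 * (y.1.1 * z.2 - y.2 * z.1.1)
  + x.2 * (y.1.1 * z.1.2 - y.1.2 * z.1.1).

Definition ldet (g : lin) : k := det3 g.1.1 g.1.2 g.2.

Definition qdet (q : qf) : k :=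
  qa q * (qd q * qff q - qe q * qe q) - qb q * (qb q * qff q - qe q * qc q)
  + qc q * (qb q * qe q - qd q * qc q).

Definition Q0 : qf := Qf 0 0 1 (-1) 0 0.
Definition id3 : lin := ((1, 0, 0), (0, 1, 0), (0, 0, 1)).

(* [wmap t s] is [u(t) v(s)]: the unipotent one-parameter group of isometries of
   [2 x1 x3 - x2^2], times the translations [x1 := x1 + s x3] which commute with it *)
Definition wmap (t s : k) : lin :=
  ((1, 0, 0), (t, 1, 0), (t ^+ 2 / 2%:R + s, t, 1)).

Definition lcomp (g h : lin) : lin := (app g h.1.1, app g h.1.2, app g h.2).

Definition linv (g : lin) : lin :=
  let d := (ldet g)^-1 in
  ((d * (g.1.2.1.2 * g.2.2 - g.1.2.2 * g.2.1.2),
    d * (g.2.1.2 * g.1.1.2 - g.2.2 * g.1.1.1.2),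
    d * (g.1.1.1.2 * g.1.2.2 - g.1.1.2 * g.1.2.1.2)),
   (d * (g.2.1.1 * g.1.2.2 - g.2.2 * g.1.2.1.1),
    d * (g.1.1.1.1 * g.2.2 - g.1.1.2 * g.2.1.1),
    d * (g.1.2.1.1 * g.1.1.2 - g.1.2.2 * g.1.1.1.1)),
   (d * (g.1.2.1.1 * g.2.1.2 - g.1.2.1.2 * g.2.1.1),
    d * (g.2.1.1 * g.1.1.1.2 - g.2.1.2 * g.1.1.1.1),
    d * (g.1.1.1.1 * g.1.2.1.2 - g.1.1.1.2 * g.1.2.1.1))).

Ltac vd := repeat match goal with x : vec |- _ => destruct x as [[? ?] ?]
  | x : lin |- _ => destruct x as [[? ?] ?] | x : qf |- _ => destruct x end; simpl.
Ltac vr := vd; rewrite /lcomp /pull /qdet /ldet /det3 /app /scal /ev /bil /=; repeat congr (_, _); ring.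

Lemma vecP (x y : vec) : x.1.1 = y.1.1 -> x.1.2 = y.1.2 -> x.2 = y.2 -> x = y.
Proof. by case: x => [[? ?] ?]; case: y => [[? ?] ?] /= -> -> ->. Qed.

Lemma subvE (x y : vec) : x - y = (x.1.1 - y.1.1, x.1.2 - y.1.2, x.2 - y.2).
Proof. by case: x => [[? ?] ?]; case: y => [[? ?] ?]. Qed.
Lemma addvE (x y : vec) : x + y = (x.1.1 + y.1.1, x.1.2 + y.1.2, x.2 + y.2).
Proof. by case: x => [[? ?] ?]; case: y => [[? ?] ?]. Qed.

Lemma scalB a x y : scal a (x - y) = scal a x - scal a y.
Proof. by rewrite !subvE; vr. Qed.
Lemma scalA a b x : scal a (scal b x) = scal (a * b) x.
Proof. by vr. Qed.
Lemma scal1 x : scal 1 x = x. Proof. by vr. Qed.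
Lemma scal0 x : scal 0 x = 0. Proof. by apply: vecP; rewrite /= mul0r. Qed.
Lemma scalv0 a : scal a 0 = 0. Proof. by apply: vecP; rewrite /= mulr0. Qed.
Lemma scal_eq0 a x : a != 0 -> scal a x = 0 -> x = 0.
Proof. by move=> a0 h; rewrite -(scal1 x) -(mulVf a0) -scalA h scalv0. Qed.

Lemma appB g x y : app g (x - y) = app g x - app g y.
Proof. by rewrite !subvE; vr. Qed.
Lemma appD g x y : app g (x + y) = app g x + app g y.
Proof. by rewrite !addvE; vr. Qed.
Lemma app_scal g a x : app g (scal a x) = scal a (app g x).
Proof. by vr. Qed.
Lemma app0 g : app g 0 = 0.
Proof. by apply: vecP; rewrite /= !mul0r !addr0. Qed.
Lemma app_id x : app id3 x = x. Proof. by vr. Qed.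
Lemma app_comp g h x : app (lcomp g h) x = app g (app h x).
Proof. by vr. Qed.

Lemma bil_pull q g x y : bil (pull q g) x y = bil q (app g x) (app g y).
Proof. by vr. Qed.
Lemma ev_pull q g x : ev (pull q g) x = ev q (app g x).
Proof. exact: bil_pull. Qed.
Lemma pull_comp q g h : pull (pull q g) h = pull q (lcomp g h).
Proof. by rewrite /pull !bil_pull. Qed.
Lemma pull_id q : pull q id3 = q.
Proof. by case: q => *; rewrite /pull /bil /=; congr Qf; ring. Qed.

Lemma det3_app g x y z : det3 (app g x) (app g y) (app g z) = ldet g * det3 x y z.
Proof. by vr. Qed.
Lemma ldet_comp g h : ldet (lcomp g h) = ldet g * ldet h.
Proof. exact: det3_app. Qed.
Lemma qdet_pull q g : qdet (pull q g) = ldet g ^+ 2 * qdet q.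
Proof. by rewrite /qdet /pull; vr. Qed.
Lemma qdet_Q0 : qdet Q0 = 1. Proof. by rewrite /qdet /=; ring. Qed.

Lemma cramer (x y z u : vec) :
  scal (det3 x y z) u =
  scal (det3 u y z) x + scal (det3 x u z) y + scal (det3 x y u) z.
Proof. by rewrite !addvE; vr. Qed.

Lemma ev_Q0 x : ev Q0 x = 2%:R * x.1.1 * x.2 - x.1.2 ^+ 2.
Proof. by vr. Qed.

Lemma comp_linvl g : ldet g != 0 -> lcomp (linv g) g = id3.
Proof.
rewrite /ldet /det3 /lcomp /app /linv /ldet /det3.
move: g => [[[[a1 a2] a3] [[b1 b2] b3]] [[c1 c2] c3]] /= d0.
by repeat congr (_, _); field.
Qed.

Lemma comp_linv g : ldet g != 0 -> lcomp g (linv g) = id3.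
Proof.
rewrite /ldet /det3 /lcomp /app /linv /ldet /det3.
move: g => [[[[a1 a2] a3] [[b1 b2] b3]] [[c1 c2] c3]] /= d0.
by repeat congr (_, _); field.
Qed.

Lemma linvK g : ldet g != 0 -> forall x, app (linv g) (app g x) = x.
Proof. by move=> d0 x; rewrite -app_comp comp_linvl // app_id. Qed.

Lemma linvKr g : ldet g != 0 -> forall x, app g (app (linv g) x) = x.
Proof. by move=> d0 x; rewrite -app_comp comp_linv // app_id. Qed.

Lemma ldet_wmap t s : ldet (wmap t s) = 1.
Proof. by rewrite /ldet /det3 /=; ring. Qed.

Context (h2 : 2%:R != 0 :> k).

Lemma wmapD t s t' s' x :
  app (wmap t s) (app (wmap t' s') x) = app (wmap (t + t') (s + s')) x.
Proof. by move: x => [[x1 x2] x3]; apply: vecP => /=; rewrite /app /=; field. Qed.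

Lemma wmap0 x : app (wmap 0 0) x = x.
Proof. by move: x => [[x1 x2] x3]; apply: vecP => /=; rewrite /app /=; field. Qed.

Lemma wmapK t s x : app (wmap (- t) (- s)) (app (wmap t s) x) = x.
Proof. by rewrite wmapD !addNr wmap0. Qed.

Lemma wmapKr t s x : app (wmap t s) (app (wmap (- t) (- s)) x) = x.
Proof. by rewrite wmapD !subrr wmap0. Qed.

End TernaryAlgebra.

Arguments Q0 {k}.
Arguments id3 {k}.
Arguments wmap {k}.

(** * Lattices in three-space *)

Lemma pigeonhole (A B : eqType) (f : A -> B) (s : seq A) (T : seq B) :
  uniq s -> (forall x, x \in s -> f x \in T) -> (size T < size s)%N ->
  exists x y, [/\ x \in s, y \in s, x <> y & f x = f y].
Proof.
move=> us sT lt; apply: contrapT => hn.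
have inj : {in s &, injective f}.
  move=> x y hx hy e; apply: contrapT => xy; apply: hn.
  by exists x, y; split=> //; apply/eqP.
have : (size (map f s) <= size T)%N.
  apply: uniq_leq_size; first by rewrite map_inj_in_uniq.
  by move=> z /mapP[x hx ->]; apply: sT.
by rewrite size_map leqNgt lt.
Qed.

(** Without the class of one element the rest meets one class fewer; the larger of that class and
    the one found in the rest is dense enough. It converts an index bound into a density bound. *)
Lemma big_class (A : eqType) (R : A -> A -> Prop) (M : nat) (l : seq A) :
  (forall x, R x x) -> (forall x y, R x y -> R y x) ->
  (forall x y z, R x y -> R y z -> R x z) ->
  (forall f : 'I_M.+1 -> A, (forall i, f i \in l) -> exists i j, i != j /\ R (f i) (f j)) ->
  exists s, [/\ subseq s l, (forall x y, x \in s -> y \in s -> R x y) &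
    (size l <= M * size s)%N].
Proof.
move=> Rx Rs Rt; elim: M l => [|M IH] l H.
  case: l H => [|a l] H; first by exists [::].
  have [|i [j []]] := H (fun _ => a); first by move=> _; rewrite mem_head.
  by rewrite (ord1 i) (ord1 j).
case: l H => [|a l0] H; first by exists [::].
set l := a :: l0 in H *.
pose P x := `[< R a x >].
have [|s2 [sub2 R2 sz2]] := IH [seq x <- l | ~~ P x].
  move=> f hf.
  have [|i [j [ij]]] := H (fun i => if unlift ord0 i is Some j then f j else a).
    move=> i; case: unliftP => [j _|_]; last by rewrite mem_head.
    by have := hf j; rewrite mem_filter => /andP[].
  have nR i' : ~ R a (f i').
    by have := hf i'; rewrite mem_filter => /andP[/negP h _] h'; apply: h; apply/asboolP.
  case: unliftP => [i' ei|ei]; case: unliftP => [j' ej|ej] // h.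
  - by exists i', j'; split=> //; apply: contraNneq ij => e; rewrite ei ej e.
  - by case: (nR i'); apply: Rs.
  - by case: (nR j').
  - by rewrite ei ej eqxx in ij.
pose s1 := [seq x <- l | P x].
have sz : (size l = size s1 + size [seq x <- l | ~~ P x])%N.
  by rewrite !size_filter -(count_predC P).
have [le|/ltnW le] := leqP (size s2) (size s1).
  exists s1; split; [exact: filter_subseq| |nia].
  move=> x y; rewrite !mem_filter => /andP[/asboolP hx _] /andP[/asboolP hy _].
  by apply: Rt hy; apply: Rs.
by exists s2; split=> //; [apply: subseq_trans sub2 (filter_subseq _ _)|nia].
Qed.

Definition lat (k : fieldType) := vec k -> Prop.

Definition bvec (k : fieldType) (w : k -> int) (N : int) (x : vec k) : bool :=
  [&& vge w N x.1.1, vge w N x.1.2 & vge w N x.2].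

Definition cvec (k : fieldType) (w : k -> int) (I : Type) (F : (I -> Prop) -> Prop)
  (f : I -> vec k) (l : vec k) :=
  [/\ cv w F (fun i => (f i).1.1) l.1.1, cv w F (fun i => (f i).1.2) l.1.2 &
      cv w F (fun i => (f i).2) l.2].

Definition clin (k : fieldType) (w : k -> int) (I : Type) (F : (I -> Prop) -> Prop)
  (f : I -> lin k) (l : lin k) :=
  [/\ cvec w F (fun i => (f i).1.1) l.1.1, cvec w F (fun i => (f i).1.2) l.1.2 &
      cvec w F (fun i => (f i).2) l.2].

Definition cqf (k : fieldType) (w : k -> int) (I : Type) (F : (I -> Prop) -> Prop)
  (f : I -> qf k) (l : qf k) :=
  (cv w F (fun i => qa (f i)) (qa l) /\ cv w F (fun i => qb (f i)) (qb l)) /\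
  (cv w F (fun i => qc (f i)) (qc l) /\ cv w F (fun i => qd (f i)) (qd l)) /\
  (cv w F (fun i => qe (f i)) (qe l) /\ cv w F (fun i => qff (f i)) (qff l)).

(** If all coordinates have valuation at least [|E| + 1], then [Q0] has valuation at least
    [2 (|E| + 1) >= E + 1]; so a good lattice has no nonzero vector in this ball. *)
Definition disc_radius (E : int) : int := `|E| + 1.

Definition good (k : fieldType) (w : k -> int) (E : int) (Q : qf k) (D : lat k) :=
  forall x, D x -> x <> 0 -> ~~ vge w (E + 1) (ev Q x).

(* [D] plus the ball of radius [disc_radius E] has index at most [M] in [k^3] *)
Definition index_le (k : fieldType) (w : k -> int) (E : int) (M : nat) (D : lat k) :=
  forall f : 'I_M.+1 -> vec k, exists i j, i != j /\
    exists2 d, D d & bvec w (disc_radius E) (f i - f j - d).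

(** [lattice_det] puts determinants in the discrete set [kap O]: they are locally constant along
    limits, and Cramer's rule has coefficients in [O] up to the factor [kap]. The index bound [M] is
    uniform, so that limits stay cocompact. *)
Record lattice (k : fieldType) (w : k -> int) (O : k -> Prop) (kap : k) (E : int)
    (M : nat) (D : lat k) : Prop := Lattice {
  lattice0 : D 0;
  latticeB : forall x y, D x -> D y -> D (x - y);
  latticeZ : forall a x, O a -> D x -> D (scal a x);
  lattice_good : good w E Q0 D;
  lattice_det : forall x y z, D x -> D y -> D z -> exists2 a, O a & det3 x y z = kap * a;
  lattice_index : index_le w E M D }.

Definition act (k : fieldType) (t s : k) (D : lat k) : lat k :=
  fun x => D (app (wmap (- t) (- s)) x).

(** The Kuratowski limit of the sets [D i]; along an ultrafilter the lower and the upper limit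
    coincide. *)
Definition ulim (k : fieldType) (w : k -> int) (I : Type) (F : (I -> Prop) -> Prop)
  (D : I -> lat k) : lat k :=
  fun x => forall N, F (fun i => exists2 y, D i y & bvec w N (x - y)).

Ltac blia := repeat match goal with
  | H : is_true (bvec _ _ _) |- _ => clear H
  | H : is_true (uniq _) |- _ => clear H end; vlia.

Ltac cvt w hw hF := repeat first [assumption | apply: (cvC w hF) | apply: (cvD hw hF)
  | apply: (cvN hw hF) | apply: (cvM hw hF) | apply: (cvX hw hF)].

Section Lattices.
Context (k : fieldType) (w : k -> int) (hw : dvaluation w).
Context (hcomp : complete_val w) (q : nat) (res : seq k)
  (hres : residue_system w q res).
Context (h2 : 2%:R != 0 :> k) (w2 : w 2%:R = 0).
Context (O : k -> Prop) (O1 : O 1) (OB : forall a b, O a -> O b -> O (a - b))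
  (OM : forall a b, O a -> O b -> O (a * b)).
Context (rO : int) (Odisc : forall a, O a -> vge w rO a -> a = 0).
Context (th : k) (Oth : O th) (th0 : th != 0) (wth : w th < 0).
Context (kap : k) (kap0 : kap != 0) (E : int) (M : nat).
Local Notation vge := (vge w).
Local Notation bvec := (bvec w).
Local Notation lattice := (lattice w O kap E M).
Local Notation r0 := (disc_radius E).
Local Notation vec := (vec k).
Implicit Types (D : lat k) (x y z : vec).

Lemma bvec_le N N' x : N' <= N -> bvec N x -> bvec N' x.
Proof. by move=> h /and3P[h1 h3 h4]; apply/and3P; split; apply: (vge_le h). Qed.

Lemma bvecD N x y : bvec N x -> bvec N y -> bvec N (x + y).
Proof. by move=> /and3P[? ? ?] /and3P[? ? ?]; rewrite addvE; apply/and3P; split; apply: (vgeD hw). Qed.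

Lemma bvecB N x y : bvec N x -> bvec N y -> bvec N (x - y).
Proof. by move=> /and3P[? ? ?] /and3P[? ? ?]; rewrite subvE; apply/and3P; split; apply: (vgeB hw). Qed.

Lemma bvecN N x : bvec N (- x) = bvec N x.
Proof. by rewrite /bvec /= !(vgeN hw). Qed.

Lemma bvecBC N x y : bvec N (x - y) = bvec N (y - x).
Proof. by rewrite -bvecN opprB. Qed.

Lemma bvec0 N : bvec N 0.
Proof. by rewrite /bvec /= !vge0. Qed.

Lemma bvec_scal N N' a x : vge N a -> bvec N' x -> bvec (N + N') (scal a x).
Proof. by move=> ha /and3P[? ? ?]; apply/and3P; split; apply: (vgeM hw). Qed.

Lemma bvec_ex x : exists N, bvec N x.
Proof.
exists (Num.min (w x.1.1) (Num.min (w x.1.2) (w x.2))).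
by apply/and3P; split; apply: (vge_le _ (vge_val w _)); blia.
Qed.

Lemma bvec_seq (s : seq vec) : exists N, forall x, x \in s -> bvec N x.
Proof.
elim: s => [|x s [N IH]]; first by exists 0.
have [N' hx] := bvec_ex x; exists (Num.min N N') => y.
rewrite in_cons => /orP[/eqP->|/IH h]; first by apply: bvec_le hx; blia.
by apply: bvec_le h; blia.
Qed.

Lemma bvec_app (g : lin k) : exists C, forall N x, bvec N x -> bvec (N + C) (app g x).
Proof.
have [C hC] := bvec_seq [:: g.1.1; g.1.2; g.2]; exists C => N x /and3P[x1 x2 x3].
have /and3P[a1 a2 a3] := hC g.1.1 (mem_head _ _).
have /and3P[b1 b2 b3] : bvec C g.1.2 by apply: hC; rewrite !inE eqxx orbT.
have /and3P[c1 c2 c3] : bvec C g.2 by apply: hC; rewrite !inE eqxx !orbT.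
by apply/and3P; split; rewrite /app /=; apply: (vgeD hw); rewrite ?(vgeD hw) ?(vgeM hw).
Qed.

Lemma bvec_eq0 x : (forall N, bvec N x) -> x = 0.
Proof.
move=> h; apply: vecP; apply: (vge_eq0 (w := w)) => N; by case/and3P: (h N%:Z).
Qed.

(** * Ultralimits of vectors, forms and lattices *)

Section UltraVec.
Context (I : Type) (F : (I -> Prop) -> Prop) (hF : ultra F).
Local Notation cv := (cv w F).
Local Notation cvec := (cvec w F).

Lemma cvecP f l : cvec f l <-> forall N, F (fun i => bvec N (f i - l)).
Proof.
split=> [[h1 h3 h4] N|h].
  apply: (ultraS2 hF _ (h1 N) (ultraI hF (h3 N) (h4 N))) => i a [b c].
  by apply/and3P; rewrite subvE.
by split=> N; apply: (ultraS hF) (h N) => i; rewrite subvE => /and3P[].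
Qed.

Lemma cvecC l : cvec (fun=> l) l. Proof. by split; apply: (cvC w hF). Qed.

Lemma cvecB f g a b : cvec f a -> cvec g b -> cvec (fun i => f i - g i) (a - b).
Proof. by move=> [? ? ?] [? ? ?]; rewrite subvE; split=> /=; cvt w hw hF. Qed.

Lemma cvecD f g a b : cvec f a -> cvec g b -> cvec (fun i => f i + g i) (a + b).
Proof. by move=> [? ? ?] [? ? ?]; rewrite addvE; split=> /=; cvt w hw hF. Qed.

Lemma cvec_scal c f a b : cv c a -> cvec f b -> cvec (fun i => scal (c i) (f i)) (scal a b).
Proof. by move=> ? [? ? ?]; split=> /=; cvt w hw hF. Qed.

Lemma cvec_app g f a b : clin w F g a -> cvec f b -> cvec (fun i => app (g i) (f i)) (app a b).
Proof. by move=> [[? ? ?] [? ? ?] [? ? ?]] [? ? ?]; split=> /=; cvt w hw hF. Qed.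

Lemma clinC g : clin w F (fun=> g) g. Proof. by split; apply: cvecC. Qed.

Lemma cv_bil Q f g l a b : cqf w F Q l -> cvec f a -> cvec g b ->
  cv (fun i => bil (Q i) (f i) (g i)) (bil l a b).
Proof. by move=> [[? ?] [[? ?] [? ?]]] [? ? ?] [? ? ?]; rewrite /bil; cvt w hw hF. Qed.

Lemma cqfC l : cqf w F (fun=> l) l.
Proof. by split; [|split]; split; apply: (cvC w hF). Qed.

Lemma cv_ev Q f l a : cqf w F Q l -> cvec f a -> cv (fun i => ev (Q i) (f i)) (ev l a).
Proof. by move=> *; apply: cv_bil. Qed.

Lemma cqf_pull Q g l a : cqf w F Q l -> clin w F g a ->
  cqf w F (fun i => pull (Q i) (g i)) (pull l a).
Proof. by move=> hq [? ? ?]; split; [|split]; split=> /=; apply: cv_bil. Qed.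

Lemma cv_det3 f g h a b c : cvec f a -> cvec g b -> cvec h c ->
  cv (fun i => det3 (f i) (g i) (h i)) (det3 a b c).
Proof. by move=> [? ? ?] [? ? ?] [? ? ?]; rewrite /det3; cvt w hw hF. Qed.

Lemma cvec_compact f N : F (fun i => bvec N (f i)) -> exists l, cvec f l.
Proof.
move=> h.
have [l1 c1] : exists l, cv (fun i => (f i).1.1) l.
  by apply: (cv_compact hw hcomp hres hF (N := N)); apply: (ultraS hF) h => i /and3P[].
have [l3 c3] : exists l, cv (fun i => (f i).1.2) l.
  by apply: (cv_compact hw hcomp hres hF (N := N)); apply: (ultraS hF) h => i /and3P[].
have [l4 c4] : exists l, cv (fun i => (f i).2) l.
  by apply: (cv_compact hw hcomp hres hF (N := N)); apply: (ultraS hF) h => i /and3P[].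
by exists (l1, l3, l4).
Qed.

(** Two values near the limit differ by an element of [O] that is too small to be nonzero. *)
Lemma O_closed f l : F (fun i => O (f i)) -> cv f l -> F (fun i => f i = l).
Proof.
move=> hO hl.
have [j [hj1 hj2]] := ultra_ex hF (ultraI hF (hl rO) hO).
have cst : F (fun i => f i = f j).
  apply: (ultraS2 hF _ (hl rO) hO) => i h1 h3.
  apply/eqP; rewrite -subr_eq0; apply/eqP; apply: Odisc; first exact: OB.
  by apply: (vge_trans hw h1); rewrite (vgeBC hw).
have <- : f j = l; last by [].
apply: (cv_uniq hw hF _ hl); apply: (cv_ext hF _ (cvC w hF (f j))).
by apply: (ultraS hF) cst => i ->.
Qed.

End UltraVec.

Lemma good_discrete D x : good w E Q0 D -> D x -> bvec r0 x -> x = 0.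
Proof.
move=> gD Dx /and3P[x1 x2 x3]; apply: contrapT => x0.
have /negP[] := gD _ Dx x0.
apply: (@vge_le _ _ _ (r0 + r0)); first by rewrite /disc_radius; blia.
rewrite ev_Q0 (vgeB hw) //; last by rewrite expr2 (vgeM hw).
by rewrite -mulrA (vgeMl hw) // w2 subr0 (vgeM hw).
Qed.

Lemma lattice_discrete D x : lattice D -> D x -> bvec r0 x -> x = 0.
Proof. by move=> LD; apply: good_discrete; apply: lattice_good LD. Qed.

Lemma latticeN D x : lattice D -> D x -> D (- x).
Proof. by move=> LD Dx; rewrite -sub0r; apply: (latticeB LD) => //; apply: lattice0 LD. Qed.

Lemma latticeD D x y : lattice D -> D x -> D y -> D (x + y).
Proof. by move=> LD Dx Dy; rewrite -(opprK y); apply: (latticeB LD) => //; apply: latticeN. Qed.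

Section UltraLattice.
Context (I : Type) (F : (I -> Prop) -> Prop) (hF : ultra F) (D : I -> lat k).
Context (hD : F (fun i => lattice (D i))).
Local Notation cvec := (cvec w F).
Local Notation L := (ulim w F D).

(** One choice within the discreteness radius is enough: a lattice point still closer to [x] must be
    the chosen one, so the selection converges. *)
Lemma ulim_seq x : L x -> exists2 y : I -> vec, F (fun i => D i (y i)) & cvec y x.
Proof.
move=> Lx.
have step i : exists y, (exists2 z, D i z & bvec r0 (x - z)) -> D i y /\ bvec r0 (x - y).
  have [[z h1 h3]|hn] := pselect (exists2 z, D i z & bvec r0 (x - z)); first by exists z.
  by exists 0.
have [y hy] := choice step.
exists y; first by apply: (ultraS hF) (Lx r0) => i /hy[].
apply/(cvecP hF) => N.
apply: (ultraS2 hF _ hD (Lx (Num.max N r0))) => i LDi [z Dz hz].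
have hz0 : bvec r0 (x - z) by apply: bvec_le hz; blia.
have [Dy hy0] : D i (y i) /\ bvec r0 (x - y i) by apply: hy; exists z.
have -> : y i = z.
  apply/eqP; rewrite -subr_eq0; apply/eqP; apply: (lattice_discrete LDi).
    exact: (latticeB LDi).
  have -> : y i - z = (x - z) - (x - y i) by rewrite opprB [RHS]addrC addrA subrK.
  exact: bvecB.
by rewrite bvecBC; apply: bvec_le hz; blia.
Qed.

Lemma ulim_in (y : I -> vec) x : F (fun i => D i (y i)) -> cvec y x -> L x.
Proof.
move=> h1 /(cvecP hF) h3 N; apply: (ultraS2 hF _ h1 (h3 N)) => i a b.
by exists (y i); rewrite // bvecBC.
Qed.

(** Too small a value at the limit would force too small values at nearby lattice vectors, because
    balls are open. The form may vary with the index too. *)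
Lemma good_ulim Q l : F (fun i => good w E (Q i) (D i)) -> cqf w F Q l -> good w E l L.
Proof.
move=> hg hq x /ulim_seq[y Dy cy] x0; apply/negP => hv.
have h1 := cv_vge_ev hw hF (cv_ev hF hq cy) hv.
have h3 : F (fun i => y i <> 0).
  apply: contrapT => /(ultraN hF) hn; apply: x0; apply: bvec_eq0 => N.
  have [i [h /contrapT e]] := ultra_ex hF (ultraI hF ((cvecP hF _ _).1 cy N) hn).
  by move: h; rewrite e sub0r bvecN.
have [i [[a b] [c d]]] := ultra_ex hF (ultraI hF (ultraI hF hg Dy) (ultraI hF h1 h3)).
by have := a _ b d; rewrite c.
Qed.

Lemma lattice_ulim : lattice L.
Proof.
split.
- apply: (@ulim_in (fun=> 0)); last exact: cvecC.
  by apply: (ultraS hF) hD => i; apply: lattice0.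
- move=> x y /ulim_seq[f Df cf] /ulim_seq[g Dg cg].
  apply: (@ulim_in (fun i => f i - g i)); last exact: cvecB.
  by apply: (ultraS2 hF _ hD (ultraI hF Df Dg)) => i LD [? ?]; apply: (latticeB LD).
- move=> a x Oa /ulim_seq[f Df cf].
  apply: (@ulim_in (fun i => scal a (f i))).
    by apply: (ultraS2 hF _ hD Df) => i LD ?; apply: (latticeZ LD).
  by apply: cvec_scal => //; apply: (cvC w hF).
- apply: (@good_ulim (fun=> Q0)); last exact: cqfC.
  by apply: (ultraS hF) hD => i; apply: lattice_good.
- move=> x y z /ulim_seq[f Df cf] /ulim_seq[g Dg cg] /ulim_seq[h Dh ch].
  have c1 := cv_det3 hF cf cg ch.
  have c3 : cv w F (fun i => kap^-1 * det3 (f i) (g i) (h i)) (kap^-1 * det3 x y z).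
    by apply: (cvM hw hF) => //; apply: (cvC w hF).
  have hO : F (fun i => O (kap^-1 * det3 (f i) (g i) (h i))).
    apply: (ultraS2 hF _ hD (ultraI hF Df (ultraI hF Dg Dh))) => i LD [? [? ?]].
    by have [|||a Oa ->] := lattice_det LD (x := f i) (y := g i) (z := h i) => //; rewrite mulKf.
  exists (kap^-1 * det3 x y z); last by rewrite mulVKf.
  by have [i [<-]] := ultra_ex hF (ultraI hF (O_closed hF hO c3) hO).
- move=> f.
  (* The pair supplied by the index bound depends on the lattice; the ultrafilter settles on one of
     the finitely many pairs. *)
  have [] := @ultra_seq _ _ hF _ (enum {: 'I_M.+1 * 'I_M.+1}) (fun ij i => ij.1 != ij.2 /\
     exists2 d, D i d & bvec r0 (f ij.1 - f ij.2 - d)).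
    apply: (ultraS hF) hD => i LD; have [a [b [ab h]]] := lattice_index LD f.
    by exists (a, b); rewrite ?mem_enum.
  move=> [a b] _ /= h; exists a, b; split; first by have [i []] := ultra_ex hF h.
  have step i : exists d, (a != b /\ exists2 d, D i d & bvec r0 (f a - f b - d)) ->
      D i d /\ bvec r0 (f a - f b - d).
    have [[_ [z h1 h3]]|hn] := pselect (a != b /\ exists2 d, D i d & bvec r0 (f a - f b - d)).
      by exists z.
    by exists 0.
  have [d hd] := choice step.
  have hd1 : F (fun i => D i (d i)) by apply: (ultraS hF) h => i /hd[].
  have hd3 : F (fun i => bvec r0 (f a - f b - d i)) by apply: (ultraS hF) h => i /hd[].
  have [N hN] := bvec_ex (f a - f b).
  have [l cl] : exists l, cvec d l.
    apply: (cvec_compact hF (N := Num.min N r0)); apply: (ultraS hF) hd3 => i h'.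
    rewrite -(subKr (f a - f b) (d i)); apply: bvecB; first by apply: bvec_le hN; blia.
    by apply: bvec_le h'; blia.
  exists l; first exact: ulim_in cl.
  have [c1 c3 c4] := cvecB hF (cvecC hF (f a - f b)) cl.
  by apply/and3P; split; [apply: (cv_vge hw hF c1)|apply: (cv_vge hw hF c3)|apply: (cv_vge hw hF c4)];
    apply: (ultraS hF) hd3 => i /and3P[].
Qed.

End UltraLattice.

Lemma act_in t s D x : act t s D (app (wmap t s) x) = D x.
Proof. by rewrite /act wmapK. Qed.

Lemma actP t s D x : act t s D x -> exists2 y, D y & x = app (wmap t s) y.
Proof. by move=> h; exists (app (wmap (- t) (- s)) x) => //; rewrite wmapKr. Qed.

Lemma good_act Q t s D :
  good w E Q (act t s D) <-> good w E (pull Q (wmap t s)) D.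
Proof.
split=> h x Dx x0; last first.
  have [y Dy ex] := actP Dx; rewrite ex -ev_pull; apply: h => // y0.
  by apply: x0; rewrite ex y0 app0.
rewrite ev_pull; apply: h; first by rewrite act_in.
by move=> e; apply: x0; rewrite -(wmapK h2 t s x) e app0.
Qed.

Lemma ball_reps3 (N : int) (L : nat) : exists T : seq k, exists T3 : seq vec,
  [/\ size T3 = (size T * size T * size T)%N, ((0 < size T)%N /\ uniq T3),
   (forall x, x \in T3 -> bvec N x /\ [/\ x.1.1 \in T, x.1.2 \in T & x.2 \in T]),
   (forall a b, a \in T -> b \in T -> vge (N + L%:Z) (a - b) -> a = b) &
   forall x, bvec N x -> exists2 y, y \in T3 & bvec (N + L%:Z) (x - y)].
Proof.
have [T [sT uT T1 T2 T3]] := ball_reps hw hres N L.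
exists T, [seq (ab, c) | ab <- [seq (a, b) | a <- T, b <- T], c <- T]; split.
- by rewrite !size_allpairs.
- split; first by rewrite sT expn_gt0; have := residue_card_gt1 hw hres; case: (q).
  apply: allpairs_uniq => //; last by move=> [? ?] [? ?].
  by apply: allpairs_uniq => // -[? ?] [? ?].
- move=> x /allpairsP[[ab c] /= [/allpairsP[[a b] /= [ha hb ->]] hc ->]] /=.
  by split=> //; rewrite /bvec /= !T1.
- exact: T2.
- move=> [[x1 x2] x3] /and3P[/T3[a ha a1] /T3[b hb b1] /T3[c hc c1]].
  exists (a, b, c); last by rewrite subvE /=; apply/and3P.
  by apply/allpairsP; exists ((a, b), c); split=> //=; apply/allpairsP; exists (a, b).
Qed.

(* Counting replaces Haar measure: a triangular unipotent map permutes the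
   residue boxes, so it preserves the density of a lattice. *)
Lemma index_act D t s : lattice D -> good w E Q0 (act t s D) ->
  index_le w E M (act t s D).
Proof.
move=> LD gA f.
have [C hC] := bvec_app (wmap t s).
have [N hN] := bvec_seq (codom f).
pose Nb : int := Num.min N (Num.min (r0 + C) r0).
have [T [T3 [sz [T0 u3] in3 sep cov]]] := ball_reps3 Nb `|r0 - Nb|%N.
have eNb : Nb + `|r0 - Nb|%N%:Z = r0 by rewrite /Nb; blia.
rewrite eNb in sep cov.
pose wi := wmap (- t) (- s).
(* The map is triangular with unit diagonal, so coordinates are recovered from the last one
   upwards. *)
have tri x y : x \in T3 -> y \in T3 -> bvec r0 (app wi (x - y)) -> x = y.
  move=> /in3[_ [x1 x2 x3]] /in3[_ [y1 y2 y3]]; rewrite subvE /wi => /and3P[/=].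
  rewrite !(mulr0, mulr1, add0r) => a1 a2 a3.
  have e3 : x.2 = y.2 by apply: sep.
  rewrite e3 subrr !mul0r !addr0 in a1 a2.
  have e2 : x.1.2 = y.1.2 by apply: sep.
  rewrite e2 subrr !mul0r !addr0 in a1.
  by apply: vecP => //; apply: sep.
pose R x y := exists2 d, D d & bvec r0 (app wi (x - y) - d).
(* A class [l] of boxes congruent modulo [D] has at least [size T3 / M] members. Adding the
   corresponding lattice vectors to the [M + 1] test vectors yields more points than there are
   boxes. *)
have [||||l [subl Rl szl]] := @big_class _ R M T3.
- by move=> x; exists 0; [apply: lattice0 LD|rewrite subrr app0 subrr bvec0].
- move=> x y [d Dd hd]; exists (- d); first exact: (latticeN LD).
  by rewrite -bvecN opprK opprD !appB opprB -appB.
- move=> x y z [d Dd hd] [d' Dd' hd']; exists (d + d'); first exact: (latticeD LD).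
  by rewrite -(subrK y x) -addrA appD opprD addrACA bvecD.
- move=> g _; have [i [j [ij [d Dd hd]]]] := lattice_index LD (fun i => app wi (g i)).
  by exists i, j; split=> //; exists d; rewrite ?appB.
have sl : (0 < size l)%N by case: l {subl Rl} szl => //=; rewrite muln0 sz; nia.
have ul : uniq l by apply: subseq_uniq subl u3.
have l3 x : x \in l -> x \in T3 by exact: (mem_subseq subl).
pose x0 := nth 0 l 0; have x0l : x0 \in l by apply: mem_nth.
have step x : exists d, x \in l -> D d /\ bvec r0 (app wi (x - x0) - d).
  have [xl|_] := boolP (x \in l); last by exists 0.
  by have [d Dd hd] := Rl _ _ xl x0l; exists d.
have [de hde] := choice step.
have hy i x : x \in l -> bvec Nb (f i + app (wmap t s) (de x)).
  move=> xl; have [Dd hd] := hde _ xl; apply: bvecD.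
    by apply: (bvec_le (N := N)); [rewrite /Nb; blia|apply: hN; rewrite codom_f].
  have -> : app (wmap t s) (de x) = (x - x0) - app (wmap t s) (app wi (x - x0) - de x).
    by rewrite appB wmapKr // subKr.
  apply: bvecB.
    by apply: bvecB; [case: (in3 _ (l3 _ xl))|case: (in3 _ (l3 _ x0l))].
  by apply: bvec_le (hC _ _ hd); rewrite /Nb; blia.
have step3 y : exists z, bvec Nb y -> z \in T3 /\ bvec r0 (y - z).
  have [/cov[z hz hz']|_] := boolP (bvec Nb y); last by exists 0.
  by exists z.
have [rp hrp] := choice step3.
have [|||[i x] [[j y] [/allpairsP[[i' x'] /= [_ xl [ei ex]]] /allpairsP[[j' y'] /= [_ yl [ej ey]]] ne e]]] :=
   @pigeonhole _ _ (fun ix : 'I_M.+1 * vec => rp (f ix.1 + app (wmap t s) (de ix.2)))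
   [seq (i, x) | i <- enum 'I_M.+1, x <- l] T3.
- by apply: allpairs_uniq => //; [apply: enum_uniq|move=> [? ?] [? ?]].
- by move=> _ /allpairsP[[i x] /= [_ xl ->]]; case: (hrp _ (hy i x xl)).
- by rewrite size_allpairs size_enum_ord mulSn (leq_ltn_trans szl) // -[X in (X < _)%N]add0n ltn_add2r.
subst i' x' j' y'; rewrite /= in e.
have [_ h1] := hrp _ (hy i x xl); have [_ h3] := hrp _ (hy j y yl); rewrite e in h1.
have [Dx hdx] := hde _ xl; have [Dy hdy] := hde _ yl.
have h4 : bvec r0 (f i - f j - app (wmap t s) (de y - de x)).
  have -> : f i - f j - app (wmap t s) (de y - de x) =
    (f i + app (wmap t s) (de x) - rp (f j + app (wmap t s) (de y)))
    - (f j + app (wmap t s) (de y) - rp (f j + app (wmap t s) (de y))).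
    rewrite appB; move: (f i) (f j) (app _ (de x)) (app _ (de y)) (rp _) => a b c d e'.
    by rewrite !subvE !addvE; apply: vecP => /=; ring.
  exact: bvecB.
have Dyx : D (de y - de x) by apply: (latticeB LD).
exists i, j; split; last by exists (app (wmap t s) (de y - de x)); rewrite ?act_in.
apply/eqP => ij; apply: ne; congr (_, _) => //.
rewrite ij subrr sub0r bvecN in h4.
have e0 : app (wmap t s) (de y - de x) = 0 by apply: (good_discrete gA) h4; rewrite act_in.
have e1 : de y = de x.
  by apply/eqP; rewrite -subr_eq0 -(wmapK h2 t s (_ - _)) e0 app0.
apply: tri; [exact: l3|exact: l3|].
have -> : app wi (x - y) = (app wi (x - x0) - de x) - (app wi (y - x0) - de y).
  by rewrite e1 opprB addrA subrK -appB opprB addrA subrK.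
exact: bvecB.
Qed.

Lemma lattice_act D t s : lattice D -> good w E Q0 (act t s D) -> lattice (act t s D).
Proof.
move=> LD gA; split=> //.
- by rewrite /act app0; apply: lattice0 LD.
- by move=> x y; rewrite /act appB; apply: (latticeB LD).
- by move=> a x Oa; rewrite /act app_scal; apply: (latticeZ LD).
- move=> x y z Dx Dy Dz; have [a Oa e] := lattice_det LD Dx Dy Dz.
  by exists a; rewrite // -e det3_app ldet_wmap mul1r.
- exact: index_act.
Qed.

Lemma pull_Q0_u t : pull Q0 (wmap t 0) = Q0 :> qf k.
Proof. by rewrite /pull /bil /=; congr Qf; field. Qed.

Lemma lattice_u D t : lattice D -> lattice (act t 0 D).
Proof.
move=> LD; apply: lattice_act => //; apply/good_act; rewrite pull_Q0_u.
exact: lattice_good LD.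
Qed.

(** Otherwise vectors can be chosen one after another, each incongruent to all earlier ones, against
    the index bound. *)
Lemma lattice_cover D : lattice D -> exists R, forall x, exists2 d, D d & bvec R (x - d).
Proof.
move=> LD; apply: contrapT => hn.
pose R x y := exists2 d, D d & bvec r0 (x - y - d).
have ext (n : nat) : exists s : seq vec, size s = n /\
    forall i j, (i < j < n)%N -> ~ R (nth 0 s i) (nth 0 s j).
  elim: n => [|n [s [ss hs]]]; first by exists [::]; split=> // i j; rewrite ltn0 andbF.
  have [x hx] : exists x, forall y, y \in s -> ~ R y x.
    apply: contrapT => hx; apply: hn; have [N hN] := bvec_seq s.
    exists (Num.min N r0) => x.
    have [y ys [d Dd hd]] : exists2 y, y \in s & R y x.
      apply: contrapT => h; apply: hx; exists x => y ys Ryx; apply: h; exists y => //.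
    exists (- d); first exact: (latticeN LD).
    have -> : x - (- d) = y - (y - x - d) by rewrite opprK -addrA -opprD subKr.
    apply: bvecB; first by apply: bvec_le (hN _ ys); blia.
    by apply: bvec_le hd; blia.
  exists (rcons s x); split; first by rewrite size_rcons ss.
  move=> i j /andP[ij jn]; rewrite !nth_rcons ss.
  have -> : (i < n)%N by apply: (leq_trans ij); rewrite -ltnS.
  have [jlt|jge] := ltnP j n; first by apply: hs; rewrite ij.
  have -> : j = n by apply/eqP; rewrite eqn_leq jge -ltnS jn.
  by rewrite eqxx; apply: hx; apply: mem_nth; rewrite ss; blia.
have [s [ss hs]] := ext M.+1.
have [i [j [ij h]]] := lattice_index LD (fun i : 'I_M.+1 => nth 0 s i).
have [lt|gt|e] := ltngtP i j.
- by apply: (hs i j); rewrite ?lt ?ltn_ord.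
- apply: (hs j i); rewrite ?gt ?ltn_ord //.
  case: h => d Dd hd; exists (- d); first exact: (latticeN LD).
  by rewrite -bvecN opprK opprD opprB.
- by move: ij; rewrite -val_eqE /= e eqxx.
Qed.

Lemma lattice_finite D N : lattice D -> exists s : seq vec, forall x, D x -> bvec N x -> x \in s.
Proof.
move=> LD; pose Nb : int := Num.min N r0.
have [T [T3 [_ _ _ _ cov]]] := ball_reps3 Nb `|r0 - Nb|%N.
have eNb : Nb + `|r0 - Nb|%N%:Z = r0 by rewrite /Nb; blia.
rewrite eNb in cov.
have step z : exists d, (exists2 d, D d & bvec r0 (d - z)) -> D d /\ bvec r0 (d - z).
  have [[d h1 h3]|h] := pselect (exists2 d, D d & bvec r0 (d - z)); first by exists d.
  by exists 0.
have [c hc] := choice step.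
exists [seq c z | z <- T3] => x Dx hx.
have [z zT hz] : exists2 z, z \in T3 & bvec r0 (x - z).
  by apply: cov; apply: bvec_le hx; rewrite /Nb; blia.
apply/mapP; exists z => //.
have [Dc hcz] : D (c z) /\ bvec r0 (c z - z) by apply: hc; exists x.
apply/eqP; rewrite -subr_eq0; apply/eqP; apply: (lattice_discrete LD).
  exact: (latticeB LD).
have -> : x - c z = (x - z) - (c z - z) by rewrite opprB addrA subrK.
exact: bvecB.
Qed.

(** Division by [th] with remainder: the lattice vector nearest to [th^-1 x] lies in a smaller ball
    than [x] since [w th < 0]. So short vectors generate under addition and multiplication by
    [th]. *)
Lemma lattice_gen D : lattice D -> exists N, forall P : vec -> Prop,
  (forall x y, P x -> P y -> P (x + y)) -> (forall x, P x -> P (scal th x)) ->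
  (forall x, D x -> bvec N x -> P x) -> forall x, D x -> P x.
Proof.
move=> LD; have [R hR] := lattice_cover LD.
exists (R + w th) => P PD PZ Pb.
have main (n : nat) : forall x, D x -> bvec (R + w th - n%:Z) x -> P x.
  elim: n => [|n IH] x Dx hx; first by apply: Pb => //; rewrite subr0 in hx.
  have [d Dd hb] := hR (scal th^-1 x).
  set b := scal th^-1 x - d in hb.
  have ex : x = scal th d + scal th b.
    by rewrite /b scalB scalA mulfV // scal1 addrC subrK.
  have hd : bvec (R + w th - n%:Z) d.
    have -> : d = scal th^-1 x - b by rewrite /b subKr.
    apply: bvecB; last by apply: bvec_le hb; blia.
    have := bvec_scal (vge_val w th^-1) hx; rewrite (val_inv hw) //.
    by apply: bvec_le; blia.
  rewrite ex; apply: PD; first by apply: PZ; apply: IH.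
  apply: Pb; last first.
    by rewrite addrC; apply: bvec_scal => //; apply: vge_val.
  have -> : scal th b = x - scal th d by rewrite {1}ex addrC addKr.
  by apply: (latticeB LD) => //; apply: (latticeZ LD).
move=> x Dx; have [N hN] := bvec_ex x.
by apply: (main `|(N - (R + w th))%R|%N x Dx); apply: bvec_le hN; blia.
Qed.

Lemma det3_near (m : k) (R : int) x y z : m != 0 -> w m < R ->
  vge R (x.1.1 - m) -> vge R x.1.2 -> vge R x.2 ->
  vge R y.1.1 -> vge R (y.1.2 - m) -> vge R y.2 ->
  vge R z.1.1 -> vge R z.1.2 -> vge R (z.2 - m) -> det3 x y z != 0.
Proof.
move: x y z => [[x1 x2] x3] [[y1 y2] y3] [[z1 z2] z3] /= m0 lt.
have [-> ->] : x1 = x1 - m + m /\ y2 = y2 - m + m by rewrite !subrK.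
have -> : z3 = z3 - m + m by rewrite subrK.
move: (x1 - m) (y2 - m) (z3 - m) => {x1 y2 z3} x1 y2 z3.
rewrite !addrK => a1 a2 a3 b1 b2 b3 c1 c2 c3.
have hm := vge_val w m.
have [] // := @val_dom _ _ hw (m ^+ 3) (det3 (x1 + m, x2, x3) (y1, y2 + m, y3) (z1, z2, z3 + m)).
  by rewrite expf_neq0.
rewrite (val_exp hw) // -mulr_natr natz.
have -> : det3 (x1 + m, x2, x3) (y1, y2 + m, y3) (z1, z2, z3 + m) - m ^+ 3 =
  m * m * (x1 + y2 + z3)
  + m * ((x1 * y2 - x2 * y1) + (x1 * z3 - x3 * z1) + (y2 * z3 - y3 * z2))
  + (x1 * (y2 * z3 - y3 * z2) - x2 * (y1 * z3 - y3 * z1) + x3 * (y1 * z2 - y2 * z1))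
  by rewrite /det3 /=; ring.
have h (u u' v v' : k) : vge R u -> vge R u' -> vge R v -> vge R v' ->
    vge (R + R) (u * u' - v * v').
  by move=> *; apply: (vgeB hw); apply: (vgeM hw).
apply: (vgeD hw); first apply: (vgeD hw).
- apply: (@vge_le _ _ _ (w m + w m + R)); first by move: lt; clear; blia.
  by apply: (vgeM hw); [exact: (vgeM hw)|apply: (vgeD hw) => //; apply: (vgeD hw)].
- apply: (@vge_le _ _ _ (w m + (R + R))); first by move: lt; clear; blia.
  by apply: (vgeM hw) => //; apply: (vgeD hw); [apply: (vgeD hw)|]; apply: h.
- apply: (@vge_le _ _ _ (R + (R + R))); first by move: lt; clear; blia.
  by apply: (vgeD hw); [apply: (vgeB hw)|]; apply: (vgeM hw) => //; apply: h.
Qed.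

(** Lattice vectors close to a large multiple of each coordinate vector are independent. *)
Lemma lattice_basis D : lattice D ->
  exists x y z, [/\ D x, D y, D z & det3 x y z != 0].
Proof.
move=> LD; have [R hR] := lattice_cover LD.
have [m m0 wm] := val_ex hw (R - 1).
have [x Dx hx] := hR (m, 0, 0); have [y Dy hy] := hR (0, m, 0); have [z Dz hz] := hR (0, 0, m).
exists x, y, z; split=> //.
move: hx hy hz; rewrite !subvE => /and3P[/= a1 a2 a3] /and3P[/= b1 b2 b3] /and3P[/= c1 c2 c3].
rewrite !sub0r !(vgeN hw) in a2 a3 b1 b3 c1 c2.
rewrite (vgeBC hw) in a1; rewrite (vgeBC hw) in b2; rewrite (vgeBC hw) in c3.
by apply: (det3_near m0 _ a1 a2 a3 b1 b2 b3 c1 c2 c3); rewrite wm; clear; blia.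
Qed.

(** The linear map taking [x, y, z] to [x', y', z'], written by Cramer's rule. *)
Definition frame (x y z x' y' z' : vec) : lin k :=
  let c u := scal (det3 u y z / det3 x y z) x' + scal (det3 x u z / det3 x y z) y'
             + scal (det3 x y u / det3 x y z) z' in
  (c (1, 0, 0), c (0, 1, 0), c (0, 0, 1)).

Lemma app_frame x y z x' y' z' u :
  app (frame x y z x' y' z') u =
  scal (det3 u y z / det3 x y z) x' + scal (det3 x u z / det3 x y z) y'
   + scal (det3 x y u / det3 x y z) z'.
Proof.
rewrite /frame; move: (det3 x y z)^-1 => d; rewrite /app /scal /det3 /=.
by rewrite !addvE; apply: vecP => /=; ring.
Qed.

Lemma app_frame1 x y z x' y' z' : det3 x y z != 0 -> app (frame x y z x' y' z') x = x'.
Proof.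
move=> d0; rewrite app_frame mulfV //.
have -> : det3 x x z = 0 by rewrite /det3; ring.
have -> : det3 x y x = 0 by rewrite /det3; ring.
by rewrite !mul0r !scal0 scal1 !addr0.
Qed.

Lemma app_frame2 x y z x' y' z' : det3 x y z != 0 -> app (frame x y z x' y' z') y = y'.
Proof.
move=> d0; rewrite app_frame mulfV //.
have -> : det3 y y z = 0 by rewrite /det3; ring.
have -> : det3 x y y = 0 by rewrite /det3; ring.
by rewrite !mul0r !scal0 scal1 addr0 add0r.
Qed.

Lemma app_frame3 x y z x' y' z' : det3 x y z != 0 -> app (frame x y z x' y' z') z = z'.
Proof.
move=> d0; rewrite app_frame mulfV //.
have -> : det3 z y z = 0 by rewrite /det3; ring.
have -> : det3 x z z = 0 by rewrite /det3; ring.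
by rewrite !mul0r !scal0 scal1 !add0r.
Qed.

Lemma ldet_frame x y z x' y' z' : det3 x y z != 0 ->
  ldet (frame x y z x' y' z') = det3 x' y' z' / det3 x y z.
Proof.
move=> d0; apply: (mulIf d0); rewrite divfK // -det3_app.
by rewrite app_frame1 // app_frame2 // app_frame3.
Qed.

(* Lattices close to [ulim D] are images of it under maps close to the identity:
   the [O]-linear relations in [ulim D] persist nearby by discreteness. *)
Lemma ulim_conv (I : Type) (F : (I -> Prop) -> Prop) (hF : ultra F) (D : I -> lat k) :
  F (fun i => lattice (D i)) ->
  exists2 g : I -> lin k, clin w F g id3 &
    F (fun i => ldet (g i) = 1 /\ forall x, ulim w F D x -> D i (app (g i) x)).
Proof.
move=> hD; have LL := lattice_ulim hF hD; set L := ulim w F D in LL *.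
have [x [y [z [Lx Ly Lz d0]]]] := lattice_basis LL.
have [xi Dx cx] := ulim_seq hF hD Lx; have [yi Dy cy] := ulim_seq hF hD Ly.
have [zi Dz cz] := ulim_seq hF hD Lz.
exists (fun i => frame x y z (xi i) (yi i) (zi i)).
  have cu u : cvec w F (fun i => scal (det3 u y z / det3 x y z) (xi i)
      + scal (det3 x u z / det3 x y z) (yi i) + scal (det3 x y u / det3 x y z) (zi i)) u.
    have e : u = scal (det3 u y z / det3 x y z) x + scal (det3 x u z / det3 x y z) y
      + scal (det3 x y u / det3 x y z) z.
      rewrite ![_ / det3 x y z]mulrC -!scalA.
      have {1}-> : u = scal (det3 x y z)^-1 (scal (det3 x y z) u).
        by rewrite scalA mulVf // scal1.
      by rewrite cramer; move: (det3 x y z)^-1 => d; rewrite !addvE; apply: vecP => /=; ring.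
    rewrite [X in cvec _ _ _ X]e.
    by apply: (cvecD hF); [apply: (cvecD hF)|]; apply: (cvec_scal hF) => //; apply: (cvC w hF).
  by split; [exact: (cu (1, 0, 0))|exact: (cu (0, 1, 0))|exact: (cu (0, 0, 1))].
have hdet : F (fun i => det3 (xi i) (yi i) (zi i) = det3 x y z).
  have hO : F (fun i => O (kap^-1 * det3 (xi i) (yi i) (zi i))).
    apply: (ultraS2 hF _ hD (ultraI hF Dx (ultraI hF Dy Dz))) => i LD [? [? ?]].
    by have [|||a Oa ->] := lattice_det LD (x := xi i) (y := yi i) (z := zi i) => //; rewrite mulKf.
  have cd : cv w F (fun i => kap^-1 * det3 (xi i) (yi i) (zi i)) (kap^-1 * det3 x y z).
    by apply: (cvM hw hF); [apply: (cvC w hF)|apply: (cv_det3 hF)].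
  apply: (ultraS hF) (O_closed hF hO cd) => i /(mulfI _); apply.
  by rewrite invr_eq0.
(* Finitely many vectors generate the limit lattice, so inclusion has to be checked on these only,
   which an ultrafilter allows simultaneously. *)
have [N hgen] := lattice_gen LL.
have [s hs] := lattice_finite N LL.
have hrel u : u \in s -> F (fun i => L u -> D i (app (frame x y z (xi i) (yi i) (zi i)) u)).
  move=> _; have [Lu|nL] := pselect (L u); last by apply: (ultraA hF).
  have [ui Du cu] := ulim_seq hF hD Lu.
  have [a Oa ea] := lattice_det LL Lx Ly Lz.
  have [a1 Oa1 ea1] := lattice_det LL Lu Ly Lz.
  have [a2 Oa2 ea2] := lattice_det LL Lx Lu Lz.
  have [a3 Oa3 ea3] := lattice_det LL Lx Ly Lu.
  have a0 : a != 0 by apply: contraNneq d0 => a0; rewrite ea a0 mulr0.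
  pose v i := scal a (ui i) - (scal a1 (xi i) + scal a2 (yi i) + scal a3 (zi i)).
  have cv0 : cvec w F v 0.
    have -> : 0 = scal a u - (scal a1 x + scal a2 y + scal a3 z).
      apply: esym; apply: (@scal_eq0 _ kap) => //.
      have -> : scal kap (scal a u - (scal a1 x + scal a2 y + scal a3 z)) =
        scal (det3 x y z) u - (scal (det3 u y z) x + scal (det3 x u z) y + scal (det3 x y u) z).
        by rewrite ea ea1 ea2 ea3 scalB !scalA !addvE; apply: vecP => /=; ring.
      by rewrite cramer subrr.
    have cc b f l : cvec w F f l -> cvec w F (fun i => scal b (f i)) (scal b l).
      by move=> h; apply: (cvec_scal hF) => //; apply: (cvC w hF).
    by apply: (cvecB hF); [|apply: (cvecD hF); [apply: (cvecD hF)|]]; apply: cc.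
  have hv : F (fun i => v i = 0).
    have := (cvecP hF _ _).1 cv0 r0.
    apply: (ultraS2 hF _ (ultraI hF hD (ultraI hF Du (ultraI hF Dx (ultraI hF Dy Dz))))).
    move=> i [LD [? [? [? ?]]]]; rewrite subr0; apply: (lattice_discrete LD).
    apply: (latticeB LD); first exact: (latticeZ LD).
    by apply: (latticeD LD); [apply: (latticeD LD)|]; apply: (latticeZ LD).
  apply: (ultraS2 hF _ hv Du) => i; rewrite /v => /eqP; rewrite subr_eq0 => /eqP e Dui _.
  suff -> : app (frame x y z (xi i) (yi i) (zi i)) u = ui i by [].
  rewrite app_frame ea ea1 ea2 ea3 !(mulrC kap) -!mulf_div !mulfV // !mulr1.
  rewrite !(mulrC _ a^-1) -!scalA -(scal1 (ui i)) -(mulVf a0) -scalA e.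
  by move: a^-1 => c; rewrite !addvE; apply: vecP => /=; ring.
have := ultra_all hF hrel.
apply: (ultraS2 hF _ (ultraI hF hD hdet)) => i [LD ed] hi.
split; first by rewrite ldet_frame // ed mulfV.
apply: hgen.
- by move=> u v hu hv; rewrite appD; apply: (latticeD LD).
- by move=> u hu; rewrite app_scal; apply: (latticeZ LD).
- by move=> u Lu hu; apply: hi => //; apply: hs.
Qed.

(** * Polynomial divergence *)

(** The row vector [h] times the matrix of [g], that is, the pullback of a linear form. The form
    [x3] is followed besides [Q0] because it detects the scaling [lambda]. *)
Definition hpull (h : vec) (g : lin k) : vec :=
  let dot (x : vec) := h.1.1 * x.1.1 + h.1.2 * x.1.2 + h.2 * x.2 in
  (dot g.1.1, dot g.1.2, dot g.2).

Lemma pull_wmap (Q : qf k) t s : pull Q (wmap (- t) (- s)) =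
  Qf (qa Q) (qb Q - qa Q * t) (qc Q - qb Q * t + qa Q * (t ^+ 2 / 2%:R - s))
     (qd Q - 2%:R * qb Q * t + qa Q * t ^+ 2)
     (qe Q - (qc Q + qd Q) * t + 3%:R / 2%:R * qb Q * t ^+ 2 - qa Q * t ^+ 3 / 2%:R
      - s * (qb Q - qa Q * t))
     (qa Q * (t ^+ 2 / 2%:R - s) ^+ 2 - 2%:R * qb Q * t * (t ^+ 2 / 2%:R - s)
      + 2%:R * qc Q * (t ^+ 2 / 2%:R - s) + qd Q * t ^+ 2 - 2%:R * qe Q * t + qff Q).
Proof. by case: Q => *; rewrite /pull /bil /=; congr Qf; field. Qed.

Lemma hpull_wmap h t s : hpull h (wmap (- t) (- s)) =
  (h.1.1, h.1.2 - h.1.1 * t, h.2 - h.1.2 * t + h.1.1 * (t ^+ 2 / 2%:R - s)).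
Proof. by rewrite /hpull /=; repeat congr (_, _); field. Qed.

Definition ultra_closed (A : k -> Prop) := forall (I : Type) (F : (I -> Prop) -> Prop),
  ultra F -> forall f l, F (fun i => A (f i)) -> cv w F f l -> A l.

Lemma int_max (P : int -> Prop) (lo hi : int) : P lo -> (forall N, P N -> N < hi) ->
  exists2 N, P N & ~ P (N + 1).
Proof.
move=> Plo bd; apply: contrapT => hn.
have up (n : nat) : P (lo + n%:Z).
  elim: n => [|n IH]; first by rewrite addr0.
  apply: contrapT => h; apply: hn; exists (lo + n%:Z) => //.
  by move: h; rewrite -addn1 PoszD addrA.
have := bd _ (up `|hi - lo|%N); clear; lia.
Qed.

(** Either the distance to [y] stays bounded below and its optimum is attained, or points of [A]
    converge to [y], which then lies in [A]. *)
Lemma nearest (A : k -> Prop) (y : k) : A 0 -> ultra_closed A ->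
  exists2 s, A s & forall s' N, A s' -> vge N (y - s') -> vge N (y - s).
Proof.
move=> A0 cA; pose P N := exists2 s, A s & vge N (y - s).
have [h|/existsNP[n hn]] := pselect (forall n : nat, P n%:Z).
  have step (n : nat) : exists s, A s /\ vge n%:Z (y - s).
    by have [s As hs] := h n; exists s.
  have [f hf] := choice step; have [F hF FN] := ultra_nat.
  exists y; last by move=> *; rewrite subrr vge0.
  apply: (cA _ _ hF f); first by apply: (ultraA hF) => n; case: (hf n).
  move=> N; apply: (ultraS hF) (FN `|N|%N) => n Nn; have [_ hn] := hf n.
  by rewrite (vgeBC hw); apply: vge_le hn; move: Nn; clear; lia.
have [||N [s As hs] hN] := @int_max P (w y) n%:Z.
- by exists 0; rewrite ?subr0 ?vge_val.
- move=> N [s As hs]; rewrite ltNge; apply/negP => nN; apply: hn.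
  by exists s => //; apply: vge_le hs.
exists s => // s' N' As' hs'.
have [le|lt] := leP N' N; first exact: vge_le hs.
by case: hN; exists s' => //; apply: vge_le hs'; rewrite lezD1.
Qed.

(** The outcome [|s|^3 <= |r|^-5] will force [s r] to zero. Either [|a| <= |r|^-4], and the quartic
    bound gives the same for [b s]; or [a / 4] and [2 b s] nearly cancel, so [|a| = |b s|] and the
    quintic bound applies. In both cases [|s| <= |b|] concludes. *)
Lemma drift_estimate (a b s r : k) : r != 0 -> s != 0 -> b != 0 -> w b <= w s -> w r <= 0 ->
  vge 0 ((a / (2%:R * 2%:R) + 2%:R * b * s) * r ^+ 4) -> vge 0 (- (a * s) * r ^+ 5) ->
  - (5%:Z * w r) <= 3%:Z * w s.
Proof.
move=> r0' s0 b0 bs rle.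
rewrite !(vgeMr hw) ?expf_neq0 // !(val_exp hw) // !(mulrS (w r)) !mulr0n (vgeN hw).
pose x := a / (2%:R * 2%:R); rewrite -/x; have wbs : w (2%:R * b * s) = w b + w s.
  by rewrite !(val_mul hw) ?mulf_neq0 // w2 add0r.
have wx : a != 0 -> w x = w a.
  have w4 : w (2%:R * 2%:R)^-1 = 0 by rewrite (val_inv hw) ?mulf_neq0 // (val_mul hw) // w2.
  by move=> a0; rewrite /x (val_mul hw) ?invr_eq0 ?mulf_neq0 // w4 addr0.
have [a0|a0] := eqVneq a 0.
  have -> : x = 0 by rewrite /x a0 mul0r.
  rewrite (add0r (2%:R * b * s)) => + _.
  by rewrite vgeE ?mulf_neq0 // wbs; clear -bs rle; lia.
have x0 : x != 0 by rewrite /x !mulf_neq0 // invr_eq0 mulf_neq0.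
move=> h4; rewrite (vgeE w _ (mulf_neq0 a0 s0)) (val_mul hw) // => h5.
have [le|lt] := leP (- (4%:Z * w r)) (w a).
  have : vge (- (4%:Z * w r)) (2%:R * b * s).
    rewrite -[_ * s](addKr x) addrC; apply: (vgeB hw); last by rewrite vgeE // wx.
    by apply: vge_le h4; clear; lia.
  by rewrite vgeE ?mulf_neq0 // wbs; clear -bs rle; lia.
have [] := @val_dom _ _ hw (- x) (2%:R * b * s); first by rewrite oppr_eq0.
  rewrite opprK [_ * s + x]addrC; apply: vge_le h4; rewrite (val_opp hw) wx //; clear -lt; lia.
by rewrite wbs (val_opp hw) wx // => _; clear -bs h5; lia.
Qed.

(** * Rescaled limits of drifting forms *)

Section Drift.
Context (I : Type) (F : (I -> Prop) -> Prop) (hF : ultra F).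
Context (Q : I -> qf k) (h : I -> vec) (cQ : cqf w F Q Q0) (ch : cvec w F h (0, 0, 1)).
Context (A0 : k -> Prop) (A00 : A0 0) (A0D : forall a b, A0 a -> A0 b -> A0 (a + b))
  (A0c : ultra_closed A0) (A03 : forall s, A0 s -> 3%:R * s = 0).
Context (nondeg : F (fun i => ~ (qa (Q i) = 0 /\ qb (Q i) = 0 /\ qc (Q i) + qd (Q i) = 0 /\
  qe (Q i) = 0 /\ (h i).1.1 = 0 /\ (h i).1.2 = 0))).
Local Notation cv := (cv w F).

(** Coefficients of [t ^ m] in the [x3^2] entry of [Q] pulled back by [wmap (- t) (- (s * t ^+ 3))];
    that of [t ^ 6], namely [qa Q * s ^+ 2], is omitted as its term tends to zero. The translation
    [s t^3] offsets the cubic term, with [s] restricted to the admissible set [A0]. *)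
Definition drift_coef (Q : qf k) (s : k) (m : nat) : k :=
  match m with
  | 1 => - (2%:R * qe Q)
  | 2 => qc Q + qd Q
  | 3 => - (qb Q + 2%:R * qc Q * s)
  | 4 => qa Q / (2%:R * 2%:R) + 2%:R * qb Q * s
  | 5 => - (qa Q * s)
  | _ => 0 end.

(** [r] is the largest scale at which all terms stay bounded: if every term had valuation at least
    [5], the highest power of [r] that occurs, [r] could be enlarged by one step. *)
Let ok i (s r : k) := [/\ A0 s, r != 0 &
  (qc (Q i) != 0 /\ w (qc (Q i)) = 0) ->
  ~ (qa (Q i) = 0 /\ qb (Q i) = 0 /\ qc (Q i) + qd (Q i) = 0 /\
  qe (Q i) = 0 /\ (h i).1.1 = 0 /\ (h i).1.2 = 0) ->
  let km := drift_coef (Q i) s in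
  [/\ (forall s' N, A0 s' -> vge N (qb (Q i) + 2%:R * qc (Q i) * s') ->
         vge N (qb (Q i) + 2%:R * qc (Q i) * s)),
      (forall m, vge 0 (km m * r ^+ m)) /\ vge 0 ((h i).1.2 * r) /\ vge 0 ((h i).1.1 * r ^+ 2),
      (exists m, ~~ vge 5 (km m * r ^+ m)) \/ ~~ vge 5 ((h i).1.2 * r)
       \/ ~~ vge 5 ((h i).1.1 * r ^+ 2) &
      forall N, (forall m, vge (N *+ m) (km m)) -> vge N (h i).1.2 -> vge (N + N) (h i).1.1 ->
        w r <= - N]].

Lemma drift_ok i : exists s r, ok i s r.
Proof.
have [[[c0 wc] nd]|hn] := pselect ((qc (Q i) != 0 /\ w (qc (Q i)) = 0) /\
  ~ (qa (Q i) = 0 /\ qb (Q i) = 0 /\ qc (Q i) + qd (Q i) = 0 /\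
  qe (Q i) = 0 /\ (h i).1.1 = 0 /\ (h i).1.2 = 0)); last first.
  (* A dummy pair for the indices at which the hypotheses fail. *)
  by exists 0, 1; split=> //; [exact: oner_neq0|move=> h1 h3; case: hn].
have [s As hs] := nearest (- qb (Q i) / (2%:R * qc (Q i))) A00 A0c.
have c20 : 2%:R * qc (Q i) != 0 by rewrite mulf_neq0.
have wc2 : w (2%:R * qc (Q i)) = 0 by rewrite (val_mul hw) // w2 wc.
have near s' N : vge N (qb (Q i) + 2%:R * qc (Q i) * s') =
    vge N (- qb (Q i) / (2%:R * qc (Q i)) - s').
  have -> : qb (Q i) + 2%:R * qc (Q i) * s' =
    - ((2%:R * qc (Q i)) * (- qb (Q i) / (2%:R * qc (Q i)) - s')) by field; rewrite c0.
  by rewrite (vgeN hw) (vgeMl hw) // wc2 subr0.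
set km := drift_coef (Q i) s.
(* If all coefficients vanish then [s = 0]: otherwise coefficient [5] gives [qa = 0], then [4] gives
   [qb = 0], and [3] contradicts [qc != 0]. *)
have km0 : ~ ((forall m, km m = 0) /\ (h i).1.2 = 0 /\ (h i).1.1 = 0).
  move=> [k0 [h20 h10]]; apply: nd; rewrite h20 h10.
  have e1 := k0 1%N; have e2 := k0 2%N; have e3 := k0 3%N; have e4 := k0 4%N; have e5 := k0 5%N.
  move: e1 e2 e3 e4 e5; rewrite /km /drift_coef => /eqP; rewrite oppr_eq0 mulf_eq0 (negbTE h2) /=.
  move=> /eqP e1 e2 e3 e4 /eqP; rewrite oppr_eq0 mulf_eq0.
  have [s0|s0] := eqVneq s 0.
    move=> _; move: e3 e4; rewrite s0 !mulr0 !addr0 => /eqP; rewrite oppr_eq0 => /eqP b0.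
    by move=> /eqP; rewrite mulf_eq0 invr_eq0 mulf_eq0 (negbTE h2) /= orbF => /eqP.
  rewrite orbF => /eqP a0; move: e4; rewrite a0 mul0r add0r => /eqP.
  rewrite !mulf_eq0 (negbTE h2) (negbTE s0) /= orbF => /eqP b0.
  move: e3; rewrite b0 add0r => /eqP; rewrite oppr_eq0 !mulf_eq0 (negbTE h2) (negbTE c0).
  by rewrite (negbTE s0).
pose P N := (forall m, vge (N *+ m) (km m)) /\ vge N (h i).1.2 /\ vge (N + N) (h i).1.1.
have Ple N N' : N' <= N -> P N -> P N'.
  move=> le [p1 [p2 p3]]; split; last split.
  - by move=> m; apply: vge_le (p1 m); rewrite lerMn2r le orbT.
  - exact: vge_le p2.
  - by apply: vge_le p3; apply: lerD.
have [N [p1 [p2 p3]] pN] : exists2 N, P N & ~ P (N + 1).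
  pose lo : int := - (`|w (km 1%N)| + `|w (km 2%N)| + `|w (km 3%N)| + `|w (km 4%N)| + `|w (km 5%N)|
    + `|w (h i).1.2| + `|w (h i).1.1|).
  pose hi : int := - lo + 1.
  apply: (@int_max P lo hi).
    split; last by split; apply: (vge_le _ (vge_val w _)); rewrite /lo; clear; lia.
    case=> [|[|[|[|[|[|m]]]]]];
      first [exact: vge0|by apply: (vge_le _ (vge_val w _)); rewrite !mulrS !mulr0n /lo; clear; lia].
  move=> N [p1 [p2 p3]]; rewrite ltNge; apply/negP => hiN; apply: km0.
  have z N' (x : k) : `|w x| < N' -> vge N' x -> x = 0.
    move=> lt; rewrite /vge; case: eqP => //= _; move: lt; clear; lia.
  split; last split.
  - case=> [|[|[|[|[|[|m]]]]]] //; apply: (z _ _ _ (p1 _)); move: hiN; rewrite !mulrS !mulr0n /hi /lo; clear; lia.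
  - by apply: (z _ _ _ p2); move: hiN; rewrite /hi /lo; clear; lia.
  - by apply: (z _ _ _ p3); move: hiN; rewrite /hi /lo; clear; lia.
have [r r0' wr] := val_ex hw (- N).
have vr (x : k) m N' : vge N' (x * r ^+ m) = vge (N' + N *+ m) x.
  by rewrite (vgeMr hw) ?expf_neq0 // (val_exp hw) // wr mulNrn opprK.
have vr1 (x : k) N' : vge N' (x * r) = vge (N' + N) x by rewrite -(expr1 r) vr.
have vr2 (x : k) N' : vge N' (x * r ^+ 2) = vge (N' + (N + N)) x by rewrite vr.
exists s, r; split=> // _ _ /=; split.
- by move=> s' N'; rewrite !near; apply: hs.
- by split; [move=> m; rewrite vr add0r|rewrite vr1 vr2 !add0r].
- apply: contrapT => hn; apply: pN; split; last split.
  + move=> m; have : vge 5 (km m * r ^+ m).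
      by apply: contrapT => /negP h'; apply: hn; left; exists m.
    rewrite vr; case: m => [|[|[|[|[|[|m]]]]]];
      first [by move=> _; exact: vge0|by apply: vge_le; rewrite !mulrS !mulr0n; clear; lia].
  + have : vge 5 ((h i).1.2 * r) by apply: contrapT => /negP h'; apply: hn; right; left.
    by rewrite vr1; apply: vge_le; clear; lia.
  + have : vge 5 ((h i).1.1 * r ^+ 2) by apply: contrapT => /negP h'; apply: hn; right; right.
    by rewrite vr2; apply: vge_le; clear; lia.
- move=> N' q1 q2 q3; rewrite wr lerN2 leNgt; apply/negP => lt; apply: pN.
  by apply: (Ple N') => //; move: lt; clear; lia.
Qed.

(** With time measured in units of [r] the drift terms have limits polynomial in [ta]. In the form
    they show only in the [x3^2] entry; every other drifting entry carries an additional factor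
    tending to zero. The last two clauses express that [s] is the best choice in [A0]. *)
Lemma drift : exists (s r : I -> k) (g1 g2 g3 g4 g5 l1 l2 : k),
 [/\ (forall i, A0 (s i)),
   (forall ta, let t i := r i * ta in let S i := s i * t i ^+ 3 in
      cqf w F (fun i => pull (Q i) (wmap (- t i) (- S i)))
        (Qf 0 0 1 (-1) 0 (g1 * ta + g2 * ta ^+ 2 + g3 * ta ^+ 3 + g4 * ta ^+ 4 + g5 * ta ^+ 5)) /\
      cvec w F (fun i => hpull (h i) (wmap (- t i) (- S i))) (0, 0, 1 + l1 * ta + l2 * ta ^+ 2)),
   ~ (g1 = 0 /\ g2 = 0 /\ g3 = 0 /\ g4 = 0 /\ g5 = 0 /\ l1 = 0 /\ l2 = 0),
   (forall s, A0 s -> s = 0) -> g5 = 0 &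
   g3 != 0 -> ~ (forall x : k, A0 (x ^+ 3 * (g3 / 2%:R)))].
Proof.
have [s hs] := choice drift_ok; have [r hsr] := choice hs.
have n4 : 4%:R != 0 :> k by rewrite (natrM _ 2 2) mulf_neq0.
pose a i := qa (Q i); pose b i := qb (Q i); pose c i := qc (Q i); pose d i := qd (Q i).
pose e i := qe (Q i); pose f i := qff (Q i).
have [[ca cb] [[cc cd] [ce cf]]] := cQ; have [ch1 ch2 ch3] := ch.
rewrite /= -/a in ca; rewrite /= -/b in cb; rewrite /= -/c in cc; rewrite /= -/d in cd.
rewrite /= -/e in ce; rewrite /= -/f in cf; rewrite /= in ch1 ch2 ch3.
have As i : A0 (s i) by case: (hsr i).
have s3 i : 3%:R * s i = 0 by apply: A03.
have r0' i : r i != 0 by case: (hsr i).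
have cw : F (fun i => c i != 0 /\ w (c i) = 0).
  by apply: (ultraS hF) (cv_val hw hF cc (oner_neq0 _)) => i []; rewrite (val_one hw).
pose km i := drift_coef (Q i) (s i).
have props : F (fun i => (c i != 0 /\ w (c i) = 0) /\
  [/\ (forall s' N, A0 s' -> vge N (b i + 2%:R * c i * s') -> vge N (b i + 2%:R * c i * s i)),
      (forall m, vge 0 (km i m * r i ^+ m)) /\ vge 0 ((h i).1.2 * r i) /\ vge 0 ((h i).1.1 * r i ^+ 2),
      (exists m, ~~ vge 5 (km i m * r i ^+ m)) \/ ~~ vge 5 ((h i).1.2 * r i)
       \/ ~~ vge 5 ((h i).1.1 * r i ^+ 2) &
      forall N, (forall m, vge (N *+ m) (km i m)) -> vge N (h i).1.2 -> vge (N + N) (h i).1.1 ->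
        w (r i) <= - N]).
  apply: (ultraS2 hF _ cw nondeg) => i hc hnd; split=> //.
  by case: (hsr i) => _ _ /(_ hc hnd).
have sb : F (fun i => forall N, vge N (b i) -> vge N (s i)).
  apply: (ultraS hF) props => i [[c0 wc] [near _ _ _]] N hb.
  have : vge N (2%:R * c i * s i).
    rewrite -[_ * s i](addKr (b i)) addrC; apply: (vgeB hw) => //.
    by apply: (near 0) => //; rewrite mulr0 addr0.
  by rewrite (vgeMl hw) ?mulf_neq0 // (val_mul hw) // w2 wc add0r subr0.
have cs : cv s 0.
  by move=> N; have := cb N; apply: (ultraS2 hF _ sb) => i h1; rewrite !subr0; apply: h1.
have ckm m : cv (fun i => km i m) 0.
  have z (x : k) (g : I -> k) : cv g x -> x = 0 -> cv g 0 by move=> ? <-.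
  case: m => [|[|[|[|[|[|m]]]]]]; try exact: (cvC w hF).
  - by apply: (z (- (2%:R * 0))); [cvt w hw hF|rewrite mulr0 oppr0].
  - by apply: (z (1 + -1)); [cvt w hw hF|rewrite subrr].
  - by apply: (z (- (0 + 2%:R * 1 * 0))); [cvt w hw hF|rewrite mulr0 add0r oppr0].
  - by apply: (z (0 / (2%:R * 2%:R) + 2%:R * 0 * 0)); [cvt w hw hF|rewrite mulr0 mul0r addr0].
  - by apply: (z (- (0 * 0))); [cvt w hw hF|rewrite mulr0 oppr0].
have wr N : F (fun i => w (r i) <= - N).
  have hm m : F (fun i => vge (N *+ m) (km i m)).
    by apply: (ultraS hF) (ckm m (N *+ m)) => i; rewrite subr0.
  have hall : F (fun i => forall m, m \in [:: 1; 2; 3; 4; 5]%N -> vge (N *+ m) (km i m)).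
    by apply: (ultra_all hF) => m _.
  have hh : F (fun i => vge N (h i).1.2 /\ vge (N + N) (h i).1.1).
    by apply: (ultraS2 hF _ (ch2 N) (ch1 (N + N))) => i; rewrite !subr0.
  apply: (ultraS2 hF _ props (ultraI hF hall hh)) => i [_ [_ _ _ p4]] [p1 [p2 p3]].
  apply: p4 => // m; have [/p1//|hm'] := boolP (m \in [:: 1; 2; 3; 4; 5]%N).
  by case: m hm' => [|[|[|[|[|[|m]]]]]] // _; exact: vge0.
have ci : cv (fun i => (r i)^-1) 0.
  move=> N; apply: (ultraS hF) (wr N) => i h1.
  by rewrite subr0 vgeE ?invr_eq0 // (val_inv hw) //; move: h1; clear; lia.
have cK m : exists l, cv (fun i => km i m * r i ^+ m) l.
  apply: (cv_compact hw hcomp hres hF (N := 0)).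
  by apply: (ultraS hF) props => i [_ [_ [p _] _ _]].
have [g1 G1] := cK 1%N; have [g2 G2] := cK 2%N; have [g3 G3] := cK 3%N.
have [g4 G4] := cK 4%N; have [g5 G5] := cK 5%N.
have [L1 CL1] : exists l, cv (fun i => (h i).1.2 * r i) l.
  apply: (cv_compact hw hcomp hres hF (N := 0)).
  by apply: (ultraS hF) props => i [_ [_ [_ [p _]] _ _]].
have [L2 CL2] : exists l, cv (fun i => (h i).1.1 * r i ^+ 2) l.
  apply: (cv_compact hw hcomp hres hF (N := 0)).
  by apply: (ultraS hF) props => i [_ [_ [_ [_ p]] _ _]].
(* This removes the [t ^ 6] term and the influence of the translation on the remaining entries. *)
have cS : cv (fun i => s i * r i) 0.
  move=> N; apply: (ultraS2 hF _ (ultraI hF sb props) (wr (2%:Z * `|N|))) => i [h1 [_ [_ [p _] _ _]]] h3.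
  rewrite subr0; have [->|s0] := eqVneq (s i) 0; first by rewrite mul0r vge0.
  have b0 : b i != 0.
    apply: contraNneq s0 => b0; apply/eqP; apply: (vge_eq0 (w := w)) => N'.
    by apply: h1; rewrite b0 vge0.
  have wbs : w (b i) <= w (s i) by have := h1 _ (vge_val w (b i)); rewrite vgeE.
  have := drift_estimate (r0' i) s0 b0 wbs _ (p 4%N) (p 5%N).
  have -> : w (r i) <= 0 by move: h3; clear; lia.
  move=> /(_ isT) h4; rewrite vgeE ?mulf_neq0 // (val_mul hw) //.
  by move: h3 h4; clear; lia.
have ceq (u v : I -> k) (x y : k) : (forall i, v i = u i) -> cv u x -> x = y -> cv v y.
  by move=> /funext -> ? <-.
have cB : cv (fun i => b i * r i) 0.
  apply: (@ceq (fun i => - (km i 3%N * r i ^+ 3) * (r i)^-1 ^+ 2 - 2%:R * c i * (s i * r i))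
    _ (- g3 * 0 ^+ 2 - 2%:R * 1 * 0)); [|by cvt w hw hF|by ring].
  by move=> i; rewrite /km /drift_coef -/(b i) -/(c i); field; rewrite ?r0' ?n4 ?h2.
have cA : cv (fun i => a i * r i ^+ 2) 0.
  apply: (@ceq (fun i => 2%:R * 2%:R * ((km i 4%N * r i ^+ 4) * (r i)^-1 ^+ 2
      - 2%:R * (b i * r i) * (s i * r i)))
    _ (2%:R * 2%:R * (g4 * 0 ^+ 2 - 2%:R * 0 * 0))); [|by cvt w hw hF|by ring].
  by move=> i; rewrite /km /drift_coef -/(b i) -/(a i); field; rewrite ?r0' ?n4 ?h2.
exists s, r, g1, g2, g3, g4, g5, (- L1), (L2 / 2%:R); split=> //.
- move=> ta t S; split; [split; [|split]; split|split].
  + by apply: (@ceq a _ 0) => // i; rewrite pull_wmap.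
  + apply: (@ceq (fun i => b i - a i * r i ^+ 2 * (r i)^-1 * ta) _ (0 - 0 * 0 * ta));
      [|by cvt w hw hF|by rewrite /=; ring].
    by move=> i; rewrite pull_wmap /S /t /= -/(a i) -/(b i); field; rewrite ?r0' ?n4 ?h2.
  + apply: (@ceq (fun i => c i - b i * r i * ta + a i * r i ^+ 2 * (ta ^+ 2 / 2%:R)
        - a i * r i ^+ 2 * (s i * r i) * ta ^+ 3)
      _ (1 - 0 * ta + 0 * (ta ^+ 2 / 2%:R) - 0 * 0 * ta ^+ 3)); [|by cvt w hw hF|by rewrite /=; ring].
    by move=> i; rewrite pull_wmap /S /t /= -/(a i) -/(b i) -/(c i); field.
  + apply: (@ceq (fun i => d i - 2%:R * (b i * r i) * ta + a i * r i ^+ 2 * ta ^+ 2)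
      _ (-1 - 2%:R * 0 * ta + 0 * ta ^+ 2)); [|by cvt w hw hF|by rewrite /=; ring].
    by move=> i; rewrite pull_wmap /S /t /= -/(a i) -/(b i) -/(d i); ring.
  + apply: (@ceq (fun i => e i - km i 2%N * r i ^+ 2 * (r i)^-1 * ta
        - 3%:R / 2%:R * (km i 3%N * r i ^+ 3 * (r i)^-1) * ta ^+ 2
        - 2%:R * (km i 4%N * r i ^+ 4 * (r i)^-1) * ta ^+ 3
        - km i 5%N * r i ^+ 5 * (r i)^-1 * ta ^+ 4)
      _ (0 - g2 * 0 * ta - 3%:R / 2%:R * (g3 * 0) * ta ^+ 2 - 2%:R * (g4 * 0) * ta ^+ 3
         - g5 * 0 * ta ^+ 4)); [|by cvt w hw hF|by rewrite /=; ring].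
    move=> i; rewrite pull_wmap /S /t /= /km /drift_coef -/(a i) -/(b i) -/(c i) -/(d i) -/(e i).
    apply/eqP; rewrite -subr_eq0; apply/eqP.
    (* The discrepancy is a multiple of [3 s]: a cubic compensation is harmless exactly because
       [3 s = 0]. *)
    transitivity (3%:R * s i * (b i * r i ^+ 3 * ta ^+ 3 - c i * r i ^+ 2 * ta ^+ 2)).
      by field; rewrite ?r0' ?n4 ?h2.
    by rewrite s3 mul0r.
  + apply: (@ceq (fun i => km i 1%N * r i ^+ 1 * ta + km i 2%N * r i ^+ 2 * ta ^+ 2
        + km i 3%N * r i ^+ 3 * ta ^+ 3 + km i 4%N * r i ^+ 4 * ta ^+ 4
        + km i 5%N * r i ^+ 5 * ta ^+ 5 - km i 5%N * r i ^+ 5 * (s i * r i) * ta ^+ 6 + f i)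
      _ (g1 * ta + g2 * ta ^+ 2 + g3 * ta ^+ 3 + g4 * ta ^+ 4 + g5 * ta ^+ 5
         - g5 * 0 * ta ^+ 6 + 0)); [|by cvt w hw hF|by rewrite /=; ring].
    move=> i; rewrite pull_wmap /S /t /= /km /drift_coef -/(a i) -/(b i) -/(c i) -/(d i) -/(e i) -/(f i).
    by field; rewrite ?n4 ?h2.
  + by apply: (@ceq (fun i => (h i).1.1) _ 0) => // i; rewrite hpull_wmap.
  + apply: (@ceq (fun i => (h i).1.2 - (h i).1.1 * r i ^+ 2 * (r i)^-1 * ta) _ (0 - L2 * 0 * ta));
      [|by cvt w hw hF|by rewrite /=; ring].
    by move=> i; rewrite hpull_wmap /S /t /=; field; rewrite ?r0' ?n4 ?h2.
  + apply: (@ceq (fun i => (h i).2 - (h i).1.2 * r i * ta + (h i).1.1 * r i ^+ 2 * (ta ^+ 2 / 2%:R)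
        - (h i).1.1 * r i ^+ 2 * (s i * r i) * ta ^+ 3)
      _ (1 - L1 * ta + L2 * (ta ^+ 2 / 2%:R) - L2 * 0 * ta ^+ 3)); [|by cvt w hw hF|by rewrite /=; ring].
    by move=> i; rewrite hpull_wmap /S /t /=; field.
- move=> [e1 [e2 [e3 [e4 [e5 [e6 e7]]]]]].
  have v5 u (x : k) : cv u x -> x = 0 -> F (fun i => vge 5 (u i)).
    by move=> cu ex; apply: (cv_vge_ev hw hF cu); rewrite ex vge0.
  have L10 : L1 = 0 by rewrite -(opprK L1) e6 oppr0.
  have L20 : L2 = 0 by apply/eqP; move/eqP: e7; rewrite mulf_eq0 invr_eq0 (negbTE h2) orbF.
  have hall : F (fun i => forall m, m \in [:: 1; 2; 3; 4; 5]%N -> vge 5 (km i m * r i ^+ m)).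
    apply: (ultra_all hF) => m; rewrite !inE.
    by move=> /or4P[/eqP->|/eqP->|/eqP->|/orP[/eqP->|/eqP->]]; [apply: v5 G1 _|apply: v5 G2 _|apply: v5 G3 _|apply: v5 G4 _|apply: v5 G5 _].
  have [i [[_ [_ _ p _]] [p1 [p2 p3]]]] := ultra_ex hF (ultraI hF props
     (ultraI hF hall (ultraI hF (v5 _ _ CL1 L10) (v5 _ _ CL2 L20)))).
  case: p => [[m]|[]]; rewrite ?p2 ?p3 //.
  have [/p1->//|] := boolP (m \in [:: 1; 2; 3; 4; 5]%N).
  by case: m => [|[|[|[|[|[|m]]]]]] // _; rewrite /km /= mul0r vge0.
- move=> A0z; apply: (cv_uniq hw hF G5).
  apply: (@ceq (fun=> 0) _ 0) => //; last exact: (cvC w hF).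
  by move=> i; rewrite /km /= (A0z _ (As i)) mulr0 oppr0 mul0r.
(* Otherwise [s + r^-3 g3 / 2] would cancel the cubic term better than the nearest point [s]
   does. *)
- move=> g30 hA.
  have [i [[[_ wc] [near _ _ _]] [[k0 wk] [h1 h3]]]] := ultra_ex hF (ultraI hF props
     (ultraI hF (cv_val hw hF G3 g30) (ultraI hF (G3 (w g3 + 1)) (cc 1)))).
  have r30 : r i ^+ 3 != 0 by rewrite expf_neq0.
  have : vge (w g3 + 1) ((b i + 2%:R * c i * s i) * r i ^+ 3).
    rewrite (vgeMr hw) // (val_exp hw) //.
    apply: (near (s i + (r i)^-1 ^+ 3 * (g3 / 2%:R))); first exact: A0D.
    have -> : b i + 2%:R * c i * (s i + (r i)^-1 ^+ 3 * (g3 / 2%:R)) =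
      (- (km i 3%N * r i ^+ 3 - g3) + g3 * (c i - 1)) / r i ^+ 3.
      by rewrite /km /drift_coef -/(b i) -/(c i); field; rewrite ?r0' ?n4 ?h2.
    rewrite (vgeMr hw) ?invr_eq0 // (val_inv hw) // (val_exp hw) //.
    apply: (@vge_le _ _ _ (w g3 + 1)); first by clear; lia.
    by apply: (vgeD hw); [rewrite (vgeN hw)|apply: (vgeM hw) => //; apply: vge_val].
  have -> : (b i + 2%:R * c i * s i) * r i ^+ 3 = - (km i 3%N * r i ^+ 3).
    by rewrite /km /drift_coef -/(b i) -/(c i); ring.
  by rewrite (vgeN hw) vgeE // wk; clear; lia.
Qed.

End Drift.

(** * Minimal invariant sets of lattices *)

Definition ulim_closed (Z : lat k -> Prop) := forall (I : Type) (F : (I -> Prop) -> Prop),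
  ultra F -> forall D : I -> lat k, F (fun i => Z (D i)) -> Z (ulim w F D).

Record invariant_set (Z : lat k -> Prop) : Prop := InvariantSet {
  inv_nonempty : exists D, Z D;
  inv_closed : ulim_closed Z;
  inv_act : forall t D, Z D -> Z (act t 0 D);
  inv_lattice : forall D, Z D -> lattice D }.

Definition minimal_set (Z : lat k -> Prop) := invariant_set Z /\
  forall Z', invariant_set Z' -> (forall D, Z' D -> Z D) -> forall D, Z D -> Z' D.

(** Zorn's lemma for reverse inclusion. Choosing a lattice in each member of a chain and taking the
    ultralimit along an ultrafilter containing all tails gives a lattice in every member. *)
Lemma minimal_set_ex Z : invariant_set Z ->
  exists2 Z', minimal_set Z' & forall D, Z' D -> Z D.
Proof.
move=> iZ.
pose T := {Z' : lat k -> Prop | invariant_set Z' /\ forall D, Z' D -> Z D}.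
pose R (a b : T) := `[< forall D, sval b D -> sval a D >].
have [||||[Z' [iZ' ZZ']] hmax] := @Zorn T R.
- by move=> a; apply/asboolP.
- by move=> a b c /asboolP h1 /asboolP h3; apply/asboolP => D /h3/h1.
- move=> [a ha] [b hb] /asboolP /= h1 /asboolP /= h3.
  have e : a = b by apply: funext => D; apply: propext; split; [exact: h3|exact: h1].
  by subst b; congr exist; apply: Prop_irrelevance.
- move=> A tot; have [[a0 Aa0]|A0] := pselect (exists a, A a); last first.
    exists (exist _ Z (conj iZ (fun D h => h))) => a Aa; case: A0; by exists a.
  pose J := {a : T | A a}.
  have [|||F hF FD] := @ultra_directed J J (fun a i => forall D, sval (sval i) D -> sval (sval a) D).
  + by exists a0.
  + by move=> a; exists a.
  + move=> [a Aa] [b Ab].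
    have [/asboolP h|/asboolP h] := tot a b Aa Ab.
      by exists (exist _ b Ab) => i hi; split=> // D /hi /h.
    by exists (exist _ a Aa) => i hi; split=> // D /hi /h.
  have step (i : J) : exists D, sval (sval i) D.
    by case: i => [[a [ia ha]] Aa] /=; apply: inv_nonempty ia.
  have [z hz] := choice step.
  pose W D := forall a, A a -> sval a D.
  have iW : invariant_set W.
    split.
    - exists (ulim w F z) => a Aa.
      have ia : invariant_set (sval a) by case: (a) => [? []].
      apply: (inv_closed ia hF); apply: (ultraS hF) (FD (exist _ a Aa)) => i; apply.
      exact: hz.
    - move=> I' F' hF' D hD a Aa.
      have ia : invariant_set (sval a) by case: (a) => [? []].
      by apply: (inv_closed ia hF'); apply: (ultraS hF') hD => i; apply.
    - move=> t D hD a Aa.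
      have ia : invariant_set (sval a) by case: (a) => [? []].
      by apply: (inv_act ia); apply: hD.
    - move=> D /(_ _ Aa0); have ia : invariant_set (sval a0) by case: (a0) => [? []].
      exact: inv_lattice.
  have WZ D : W D -> Z D by move=> /(_ _ Aa0); case: (a0) => [? [? h]]; apply: h.
  by exists (exist _ W (conj iW WZ)) => a Aa; apply/asboolP => D /=; apply.
exists Z' => //; split=> // Y iY YZ' D ZD.
have hY : forall D, Y D -> Z D by move=> D' /YZ'/ZZ'.
have := hmax (exist _ Y (conj iY hY)); rewrite /R /=.
have -> : `[< forall D, Y D -> Z' D >] by apply/asboolP.
by move=> /(_ isT) [->].
Qed.

Definition qball (N : int) (Q Q' : qf k) : bool :=
  [&& vge N (qa Q - qa Q'), vge N (qb Q - qb Q'), vge N (qc Q - qc Q'),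
      vge N (qd Q - qd Q'), vge N (qe Q - qe Q') & vge N (qff Q - qff Q')].

Lemma cqf_ball (I : Type) (F : (I -> Prop) -> Prop) (hF : ultra F) Q l :
  cqf w F Q l <-> forall N, F (fun i => qball N (Q i) l).
Proof.
split=> [[[c1 c3] [[c4 c5] [c6 c7]]] N|h].
  apply: (ultraS2 hF _ (ultraI hF (c1 N) (c3 N)) (ultraI hF (ultraI hF (c4 N) (c5 N)) (ultraI hF (c6 N) (c7 N)))).
  by move=> i [h1 h3] [[h4 h5] [h6 h7]]; rewrite /qball h1 h3 h4 h5 h6 h7.
by split; [|split]; split=> N; apply: (ultraS hF) (h N) => i /and5P[? ? ? ? /andP[]].
Qed.

Lemma qball_pull (g : lin k) : exists C, forall N Q Q',
  qball N Q Q' -> qball (N + C) (pull Q g) (pull Q' g).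
Proof.
have [C hC] := bvec_seq [:: g.1.1; g.1.2; g.2]; exists (C + C) => N Q Q' hQ.
have hb x y : bvec C x -> bvec C y -> vge (N + (C + C)) (bil Q x y - bil Q' x y).
  move=> /and3P[x1 x2 x3] /and3P[y1 y2 y3].
  move: hQ => /and5P[q1 q2 q3 q4 /andP[q5 q6]].
  have -> : bil Q x y - bil Q' x y =
    (qa Q - qa Q') * (x.1.1 * y.1.1) + (qb Q - qb Q') * (x.1.1 * y.1.2 + x.1.2 * y.1.1)
    + (qc Q - qc Q') * (x.1.1 * y.2 + x.2 * y.1.1) + (qd Q - qd Q') * (x.1.2 * y.1.2)
    + (qe Q - qe Q') * (x.1.2 * y.2 + x.2 * y.1.2) + (qff Q - qff Q') * (x.2 * y.2).
    by rewrite /bil; ring.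
  have hm u v : vge N u -> vge (C + C) v -> vge (N + (C + C)) (u * v) := @vgeM _ _ hw _ _ _ _.
  have h3 u v : vge C u -> vge C v -> vge (C + C) (u * v) := @vgeM _ _ hw _ _ _ _.
  have h4 u v : vge (C + C) u -> vge (C + C) v -> vge (C + C) (u + v) := @vgeD _ _ hw _ _ _.
  have h5 u v : vge (N + (C + C)) u -> vge (N + (C + C)) v -> vge (N + (C + C)) (u + v) := @vgeD _ _ hw _ _ _.
  by repeat first [assumption|apply h5|apply hm|apply h4|apply h3].
have g1 := hC g.1.1 (mem_head _ _).
have g2 : bvec C g.1.2 by apply: hC; rewrite !inE eqxx orbT.
have g3 : bvec C g.2 by apply: hC; rewrite !inE eqxx !orbT.
by apply/and5P; split=> /=; rewrite ?hb //=; apply/andP; rewrite !hb.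
Qed.

Lemma good_sub Q (g : lin k) D D' : good w E Q D' -> ldet g != 0 ->
  (forall x, D x -> D' (app g x)) -> good w E (pull Q g) D.
Proof.
move=> gD d0 sub x Dx x0; rewrite ev_pull; apply: gD; first exact: sub.
by move=> e; apply: x0; rewrite -(linvK d0 x) e app0.
Qed.

Lemma comp_wmapK t s : lcomp (wmap (- t) (- s)) (wmap t s) = id3 :> lin k.
Proof. by rewrite /lcomp /wmap /app /id3 /=; repeat congr (_, _); field. Qed.

Definition unisolated (D : lat k) := lattice D /\
  forall N, exists Q, [/\ good w E Q D, qdet Q = 1, qball N Q Q0 & Q <> Q0].

(** For closedness, [ulim_conv] maps the limit into [D i] by some [g i] near the identity. Either
    [pull Q0 (g i)] is itself a new good form near [Q0], or [g i] is an isometry and the exceptional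
    forms of [D i] are pulled back along it. *)
Lemma unisolated_inv D0 : unisolated D0 -> invariant_set unisolated.
Proof.
move=> hD0; split; first by exists D0.
- move=> I F hF D hD.
  have hL : F (fun i => lattice (D i)) by apply: (ultraS hF) hD => i [].
  split; first exact: lattice_ulim.
  move=> N; have [g cg hg] := ulim_conv hF hL.
  have cQ : cqf w F (fun i => pull Q0 (g i)) (pull Q0 id3) by apply: (cqf_pull hF) => //; apply: cqfC.
  rewrite pull_id in cQ; have cN := (cqf_ball hF _ _).1 cQ N.
  have [eq|neq] := ultraC hF (fun i => pull Q0 (g i) = Q0).
    have [i [[LD hi] [[d1 sub] e]]] := ultra_ex hF (ultraI hF hD (ultraI hF hg eq)).
    have d0 : ldet (g i) != 0 by rewrite d1 oner_neq0.
    have [C hC] := qball_pull (g i).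
    have [Q [gQ dQ bQ nQ]] := hi (N - C).
    exists (pull Q (g i)); split.
    + exact: good_sub gQ d0 sub.
    + by rewrite qdet_pull d1 dQ expr1n mulr1.
    + by have := hC _ _ _ bQ; rewrite subrK e.
    + move=> e'; apply: nQ; rewrite -(pull_id Q) -(pull_id Q0) -(comp_linv d0).
      by rewrite -!pull_comp e' e.
  have [i [[LD hi] [[d1 sub] [e bN]]]] := ultra_ex hF (ultraI hF hD (ultraI hF hg (ultraI hF neq cN))).
  have d0 : ldet (g i) != 0 by rewrite d1 oner_neq0.
  exists (pull Q0 (g i)); split=> //.
  + exact: good_sub (lattice_good LD) d0 sub.
  + by rewrite qdet_pull d1 qdet_Q0 expr1n mulr1.
- move=> t D [LD hD]; split; first exact: lattice_u.
  move=> N; have [C hC] := qball_pull (wmap (- t) (- 0)).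
  have [Q [gQ dQ bQ nQ]] := hD (N - C).
  exists (pull Q (wmap (- t) (- 0))); split.
  + by apply/good_act; rewrite pull_comp comp_wmapK pull_id.
  + by rewrite qdet_pull ldet_wmap dQ expr1n mulr1.
  + by have := hC _ _ _ bQ; rewrite subrK oppr0 pull_Q0_u.
  + move=> e; apply: nQ; rewrite -(pull_id Q) -(comp_wmapK t 0) -pull_comp.
    by rewrite e pull_Q0_u.
- by move=> D [].
Qed.

Definition QV (be : k) : qf k := Qf 0 0 1 (-1) 0 be.

Lemma pull_QV_u be t : pull (QV be) (wmap t 0) = QV be.
Proof. by rewrite /pull /bil /=; congr Qf; field. Qed.

Lemma ev_QV be x : ev (QV be) x = ev Q0 x + be * x.2 ^+ 2.
Proof. by rewrite /ev /bil /=; ring. Qed.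

(** A lattice vector [d] near [(- be m / 2, 0, m)] with [m] large has [- Q0(d) / d3^2] close to
    [be], so some form of the family vanishes at [d]. *)
Lemma lattice_interior D be N : lattice D ->
  (forall y : k, vge N y -> good w E (QV (be + y)) D) -> False.
Proof.
move=> LD hg; have [R hR] := lattice_cover LD.
pose K : int := Num.min R (R + w be).
have [m m0 wm] := val_ex hw (Num.min (R - 1) (Num.min (K - N) (R - `|N|)) - `|N|).
have [d Dd hb] := hR (- (be * m / 2%:R), 0, m).
have [b1 [b2 [b3 [hb1 hb2 hb3 ed]]]] : exists b1 b2 b3, [/\ vge R b1, vge R b2, vge R b3 &
    d = (- (be * m / 2%:R) + b1, b2, m + b3)].
  move: hb; rewrite subvE => /and3P[/= h1 h3 h4].
  exists (d.1.1 - - (be * m / 2%:R)), d.1.2, (d.2 - m).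
  rewrite (vgeBC hw) h1 (vgeBC hw) h4 -(vgeN hw) -sub0r h3; split=> //.
  by apply: vecP => /=; ring.
have [m30 wm3] : m + b3 != 0 /\ w (m + b3) = w m.
  apply: (val_dom hw m0); have -> : m + b3 - m = b3 by ring.
  by apply: vge_le hb3; rewrite wm; clear; lia.
pose y := - (ev Q0 d / (m + b3) ^+ 2) - be.
have hy : vge N y.
  have -> : y = - ((2%:R * b1 + be * b3) / (m + b3)) + (b2 / (m + b3)) ^+ 2.
    by rewrite /y ed ev_Q0 /=; field; rewrite m30.
  apply: (vgeD hw).
    rewrite (vgeN hw) (vgeMr hw) ?invr_eq0 // (val_inv hw) // wm3.
    apply: (@vge_le _ _ _ K); first by rewrite wm; clear; lia.
    apply: (vgeD hw); first by rewrite (vgeMl hw) // w2 subr0; apply: vge_le hb1; rewrite /K; clear; lia.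
    by rewrite mulrC; apply: vge_le (vgeM hw hb3 (vge_val w be)); rewrite /K; clear; lia.
  have hq : vge `|N| (b2 / (m + b3)).
    by rewrite (vgeMr hw) ?invr_eq0 // (val_inv hw) // wm3; apply: vge_le hb2; rewrite wm; clear; lia.
  by apply: vge_le (vgeX hw 2 hq); rewrite mulr2n; clear; lia.
have ed2 : d.2 = m + b3 by rewrite ed.
have dn0 : d <> 0 by move=> d0; move: m30; rewrite -ed2 d0 eqxx.
have /negP[] := hg _ hy d Dd dn0.
have -> : ev (QV (be + y)) d = 0; last exact: vge0.
by rewrite ev_QV ed2 /y; field; rewrite m30.
Qed.

(** * The normalizer of the unipotent group and degenerate drift *)

Context (p : nat) (hp : p \in [pchar k]).

(** Elements normalizing the group [u], with time rescaled by [la^-1]. They are the possible limits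
    of renormalized returns. *)
Definition nmap (la ph : k) : lin k :=
  ((la^-1, 0, 0), (0, 1, 0), (la^-1 * (ph / 2%:R), 0, la)).

Lemma ldet_nmap la ph : la != 0 -> ldet (nmap la ph) = 1.
Proof. by move=> l0; rewrite /ldet /det3 /=; field; rewrite ?l0 ?h2. Qed.

Lemma pull_QV_nmap be la ph : la != 0 -> pull (QV be) (nmap la ph) = QV (ph + be * la ^+ 2).
Proof. by move=> l0; rewrite /pull /bil /=; congr Qf; field; rewrite ?l0 ?h2. Qed.

Lemma nmap_u la ph t x : la != 0 ->
  app (nmap la ph) (app (wmap t 0) x) = app (wmap (t / la) 0) (app (nmap la ph) x).
Proof. by move=> l0; rewrite /app /=; apply: vecP => /=; field; rewrite ?l0 ?h2. Qed.

Lemma nmap1 ph x : app (nmap 1 ph) x = app (wmap 0 (ph / 2%:R)) x.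
Proof. by rewrite /app /= invr1; apply: vecP => /=; ring. Qed.

(* Left translation by [U] brings a map whose form and last row converge to
   [(QV ph, la x3)] back to a bounded region. *)
Lemma nmap_limit (I : Type) (F : (I -> Prop) -> Prop) (hF : ultra F) (g : I -> lin k) la ph :
  la != 0 -> F (fun i => ldet (g i) = 1) ->
  cqf w F (fun i => pull Q0 (g i)) (QV ph) ->
  cvec w F (fun i => hpull (0, 0, 1) (g i)) (0, 0, la) ->
  exists t : I -> k, clin w F (fun i => lcomp (wmap (t i) 0) (g i)) (nmap la ph).
Proof.
move=> l0 dg cQ ch.
have qaE (G : lin k) : qa (pull Q0 G) = 2%:R * G.1.1.1.1 * G.1.1.2 - G.1.1.1.2 ^+ 2.
  by rewrite /= /bil /=; ring.
have qcE (G : lin k) : qc (pull Q0 G) = G.1.1.1.1 * G.2.2 + G.2.1.1 * G.1.1.2 - G.1.1.1.2 * G.2.1.2.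
  by rewrite /= /bil /=; ring.
have qeE (G : lin k) : qe (pull Q0 G) = G.1.2.1.1 * G.2.2 + G.2.1.1 * G.1.2.2 - G.1.2.1.2 * G.2.1.2.
  by rewrite /= /bil /=; ring.
have qfE (G : lin k) : qff (pull Q0 G) = 2%:R * G.2.1.1 * G.2.2 - G.2.1.2 ^+ 2.
  by rewrite /= /bil /=; ring.
(* This makes the middle coordinate of the image of the third basis vector vanish; then the entries
   of the form determine the remaining coordinates in turn. *)
pose t i := - ((g i).2.1.2 / (g i).2.2); exists t.
pose G i := lcomp (wmap (t i) 0) (g i).
have cQ' : cqf w F (fun i => pull Q0 (G i)) (QV ph).
  by move: cQ; congr (cqf _ _ _ _); apply: funext => i; rewrite -pull_comp pull_Q0_u.
have dG : F (fun i => ldet (G i) = 1).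
  by apply: (ultraS hF) dg => i e; rewrite ldet_comp ldet_wmap e mulr1.
pose x1 i := (G i).1.1.1.1; pose x2 i := (G i).1.2.1.1; pose x3 i := (G i).2.1.1.
pose y1 i := (G i).1.1.1.2; pose y2 i := (G i).1.2.1.2; pose y3 i := (G i).2.1.2.
pose z1 i := (G i).1.1.2; pose z2 i := (G i).1.2.2; pose z3 i := (G i).2.2.
have [c1 c2 c3] : [/\ cv w F z1 0, cv w F z2 0 & cv w F z3 la].
  case: ch => /= h1 h3 h4; split; [move: h1|move: h3|move: h4]; congr (cv _ _ _ _);
    by apply: funext => i; rewrite /z1 /z2 /z3 /G /lcomp /app /=; ring.
have z30 : F (fun i => z3 i != 0) by apply: (ultraS hF) (cv_val hw hF c3 l0) => i [].
have y30 : F (fun i => y3 i = 0).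
  apply: (ultraS hF) z30 => i; rewrite /z3 /y3 /G /t /lcomp /app /=.
  rewrite !mulr0 !add0r !mulr1 => h; field; exact: h.
have [[ca cb] [[cc cd] [ce cf]]] := cQ'.
have ea i : qa (pull Q0 (G i)) = 2%:R * x1 i * z1 i - y1 i ^+ 2 := qaE (G i).
have ec i : qc (pull Q0 (G i)) = x1 i * z3 i + x3 i * z1 i - y1 i * y3 i := qcE (G i).
have ee i : qe (pull Q0 (G i)) = x2 i * z3 i + x3 i * z2 i - y2 i * y3 i := qeE (G i).
have ef i : qff (pull Q0 (G i)) = 2%:R * x3 i * z3 i - y3 i ^+ 2 := qfE (G i).
have cext (u v : I -> k) (x y : k) : F (fun i => u i = v i) -> cv w F u x -> x = y -> cv w F v y.
  by move=> h cu <-; apply: (cv_ext hF h cu).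
have ci : cv w F (fun i => (z3 i)^-1) la^-1 by apply: (cvV hw hF).
have cx3 : cv w F x3 (la^-1 * (ph / 2%:R)).
  apply: (@cext (fun i => qff (pull Q0 (G i)) * (z3 i)^-1 * 2%:R^-1) _ (ph * la^-1 * 2%:R^-1)).
  - by apply: (ultraS2 hF _ z30 y30) => i h1 h3; rewrite ef h3; field; rewrite h1 h2.
  - by cvt w hw hF.
  - by field; rewrite l0 h2.
have cx2 : cv w F x2 0.
  apply: (@cext (fun i => (qe (pull Q0 (G i)) - x3 i * z2 i) * (z3 i)^-1) _
    ((0 - la^-1 * (ph / 2%:R) * 0) * la^-1)).
  - by apply: (ultraS2 hF _ z30 y30) => i h1 h3; rewrite ee h3; field.
  - by cvt w hw hF.
  - by ring.
have cx1 : cv w F x1 la^-1.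
  apply: (@cext (fun i => (qc (pull Q0 (G i)) - x3 i * z1 i) * (z3 i)^-1) _
    ((1 - la^-1 * (ph / 2%:R) * 0) * la^-1)).
  - by apply: (ultraS2 hF _ z30 y30) => i h1 h3; rewrite ec h3; field.
  - by cvt w hw hF.
  - by ring.
have cy1 : cv w F y1 0.
  have cq : cv w F (fun i => y1 i ^+ 2) 0.
    apply: (@cext (fun i => 2%:R * x1 i * z1 i - qa (pull Q0 (G i))) _ (2%:R * la^-1 * 0 - 0)).
    - by apply: (ultraA hF) => i; rewrite ea; ring.
    - by cvt w hw hF.
    - by ring.
  move=> N; apply: (ultraS hF) (cq (N + N)) => i; rewrite !subr0 expr2.
  have [->|y0] := eqVneq (y1 i) 0; first by rewrite !vge0.
  by rewrite !vgeE ?mulf_neq0 // (val_mul hw) //; clear; lia.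
(* The [x2^2] entry would give this coordinate only up to sign, hence the determinant. *)
have cy2 : cv w F y2 1.
  have cdn : cv w F (fun i => x1 i * z3 i - x3 i * z1 i) 1.
    apply: (@cext (fun i => x1 i * z3 i - x3 i * z1 i) _ (la^-1 * la - la^-1 * (ph / 2%:R) * 0)).
    - by apply: (ultraA hF).
    - by cvt w hw hF.
    - by field; rewrite ?l0 ?h2.
  have cdi := cvV hw hF cdn (oner_neq0 k).
  apply: (@cext (fun i => (1 + y1 i * (x2 i * z3 i - x3 i * z2 i)) * (x1 i * z3 i - x3 i * z1 i)^-1) _
    ((1 + 0 * (0 * la - la^-1 * (ph / 2%:R) * 0)) * 1^-1)).
  - apply: (ultraS2 hF _ (cv_val hw hF cdn (oner_neq0 k)) (ultraI hF y30 dG)) => i [h1 _] [h3 h4].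
    have e : y2 i * (x1 i * z3 i - x3 i * z1 i) = 1 + y1 i * (x2 i * z3 i - x3 i * z2 i).
      rewrite -h4 /ldet /det3 -/(x1 i) -/(x2 i) -/(x3 i) -/(y1 i) -/(y2 i) -/(y3 i) -/(z1 i) -/(z2 i) -/(z3 i) h3.
      by ring.
    by rewrite -e mulfK.
  - by cvt w hw hF.
  - by rewrite invr1; ring.
have cy3 : cv w F y3 0.
  by apply: (@cext (fun=> 0) _ 0); [apply: (ultraS hF) y30 => i ->|exact: (cvC w hF)|].
by split; split.
Qed.

Lemma hpull_comp h g g' : hpull (hpull h g) g' = hpull h (lcomp g g').
Proof. by rewrite /hpull /lcomp /app /=; apply: vecP => /=; ring. Qed.

Lemma hpull001 (g : lin k) : hpull (0, 0, 1) g = (g.1.1.2, g.1.2.2, g.2.2).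
Proof. by rewrite /hpull /=; apply: vecP => /=; ring. Qed.

Lemma scalD (a : k) x y : scal a (x + y) = scal a x + scal a y.
Proof. by rewrite !addvE /scal /=; apply: vecP => /=; ring. Qed.

(** Equivalently, [Q] and [h] are fixed by every [u(t)], so nothing drifts. *)
Definition drift_degenerate (Q : qf k) (h : vec) :=
  qa Q = 0 /\ qb Q = 0 /\ qc Q + qd Q = 0 /\ qe Q = 0 /\ h.1.1 = 0 /\ h.1.2 = 0.

(** If [c] differed from [1], the factor [c^2 + c + 1] would vanish while tending to [3]; and when
    [3 = 0] cubing is injective. *)
Lemma cube_root_one (I : Type) (F : (I -> Prop) -> Prop) (hF : ultra F) (c : I -> k) :
  F (fun i => c i ^+ 3 = 1) -> cv w F c 1 -> F (fun i => c i = 1).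
Proof.
move=> h cc; have [//|hn] := ultraC hF (fun i => c i = 1).
have e3 : 3%:R = 0 :> k.
  have -> : 3%:R = 1 ^+ 2 + 1 + 1 :> k by ring.
  apply: (cv_uniq hw hF (f := fun i => c i ^+ 2 + c i + 1)); first by cvt w hw hF.
  apply: (cv_ext hF _ (cvC w hF 0)); apply: (ultraS2 hF _ h hn) => i e /eqP ne.
  apply/esym/eqP; have : (c i - 1) * (c i ^+ 2 + c i + 1) == 0.
    have -> : (c i - 1) * (c i ^+ 2 + c i + 1) = c i ^+ 3 - 1 by ring.
    by rewrite e subrr.
  by rewrite mulf_eq0 subr_eq0 (negbTE ne).
apply: (ultraS hF) h => i e; have : (c i - 1) ^+ 3 == 0.
  have -> : (c i - 1) ^+ 3 = c i ^+ 3 - 1 - 3%:R * (c i ^+ 2 - c i) by ring.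
  by rewrite e e3 mul0r subrr subr0.
by rewrite expf_eq0 subr_eq0 => /andP[_ /eqP].
Qed.

(** The degenerate maps with middle entry [1]: a scaling, an element of [u] and a translation
    combined. Modulo [m] they multiply like the affine group. *)
Definition Bm (ch n m : k) : lin k := ((ch^-1, 0, 0), (n / ch, 1, 0), (m, n, ch)).

Lemma Bm_comp ch n m ch' n' m' : ch != 0 -> ch' != 0 ->
  lcomp (Bm ch n m) (Bm ch' n' m') =
  Bm (ch * ch') (n' + n * ch') (m' / ch + n * n' / ch + m * ch').
Proof.
by move=> c0 c0'; rewrite /lcomp /app /Bm /=; congr (_, _, _); apply: vecP => /=; field;
  rewrite ?c0 ?c0'.
Qed.

Lemma BmK ch n m x : ch != 0 ->
  app (Bm ch^-1 (- n / ch) (n ^+ 2 / ch - m)) (app (Bm ch n m) x) = x.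
Proof.
by move=> c0; rewrite /app /Bm /= !invrK; apply: vecP => /=; field; rewrite ?c0.
Qed.

Lemma wmap_Bm t ch n m : ch != 0 -> lcomp (wmap (- t) (- 0)) (Bm ch n m) =
  Bm ch (n - t * ch) (m - t * n + t ^+ 2 / 2%:R * ch).
Proof.
by move=> c0; rewrite /lcomp /app /Bm /=; congr (_, _, _); apply: vecP => /=; field;
  rewrite ?c0 ?h2.
Qed.

Lemma ldet_Bm ch n m : ch != 0 -> ldet (Bm ch n m) = 1.
Proof. by move=> c0; rewrite /ldet /det3 /=; field. Qed.

Lemma degenerate_Bm (g : lin k) : ldet g = 1 ->
  drift_degenerate (pull Q0 g) (hpull (0, 0, 1) g) ->
  g.1.2.1.2 ^+ 3 = 1 /\ (g.1.2.1.2 = 1 -> g.2.2 != 0 /\ g = Bm g.2.2 g.2.1.2 g.2.1.1).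
Proof.
case: g => [[[[x1 y1] z1] [[x2 y2] z2]] [[x3 y3] z3]].
rewrite /drift_degenerate hpull001 /ldet /det3 /= /bil /= => d [ea [_ [ec [ee [e1 e2]]]]].
subst z1 z2.
have y10 : y1 = 0.
  apply/eqP; suff : y1 ^+ 2 == 0 by rewrite expf_eq0 => /andP[].
  by apply/eqP; apply: (etrans _ (etrans (congr1 (-%R) ea) (oppr0 _))); ring.
subst y1.
have e3 : y2 * (x1 * z3) = 1 by rewrite -d; ring.
have e4 : x1 * z3 = y2 ^+ 2.
  by apply/eqP; rewrite -subr_eq0; apply/eqP; rewrite -[RHS]ec; ring.
have e5 : x2 * z3 = y2 * y3.
  by apply/eqP; rewrite -subr_eq0; apply/eqP; rewrite -[RHS]ee; ring.
split; first by rewrite exprS -e4.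
move=> y21; rewrite y21 expr1n in e4; rewrite y21 mul1r in e5.
have z30 : z3 != 0 by apply: contra_eq_neq e4 => ->; rewrite mulr0 eq_sym oner_neq0.
split=> //; rewrite /Bm y21; congr (_, _, _); congr (_, _, _).
  by apply: (mulIf z30); rewrite e4 mulVf.
by rewrite -e5 mulfK.
Qed.

(** In other words, [g] preserves the span of [D] over the fraction field of [O]. *)
Definition rational D (g : lin k) :=
  forall x, D x -> exists2 a, O a /\ a != 0 & D (scal a (app g x)).

Lemma rational_comp D g g' : rational D g -> rational D g' -> rational D (lcomp g g').
Proof.
move=> h h' x /h'[a' [Oa' a0'] /h[a [Oa a0] Dx]]; exists (a * a').
  by split; [apply: OM|apply: mulf_neq0].
by rewrite app_comp -scalA -app_scal.
Qed.

(** Cramer's rule for the images of three independent vectors, with coefficients in [O] by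
    [lattice_det]. It makes quotients of two maps from [L] to [D] rational. *)
Lemma lattice_quot L D (f : lin k) x : lattice L -> lattice D ->
  (forall y, L y -> D (app f y)) -> ldet f != 0 -> D x ->
  exists a y, [/\ O a, a != 0, L y & app f y = scal a x].
Proof.
move=> hL hD sub f0 Dx.
have [a [b [c [La Lb Lc d0]]]] := lattice_basis hL.
have [d Od ed] := lattice_det hD (sub _ La) (sub _ Lb) (sub _ Lc).
have [d1 Od1 e1] := lattice_det hD Dx (sub _ Lb) (sub _ Lc).
have [d2 Od2 e2] := lattice_det hD (sub _ La) Dx (sub _ Lc).
have [d3 Od3 e3] := lattice_det hD (sub _ La) (sub _ Lb) Dx.
have cr := cramer (app f a) (app f b) (app f c) x.
exists d, (scal d1 a + scal d2 b + scal d3 c); split=> //.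
- have : kap * d != 0 by rewrite -ed det3_app mulf_neq0.
  by rewrite mulf_eq0 negb_or => /andP[].
- by repeat first [assumption | apply: (latticeD hL) | apply: (latticeZ hL)].
rewrite !appD !app_scal; apply/subr0_eq/(scal_eq0 kap0).
by rewrite scalB !scalD !scalA -e1 -e2 -e3 -cr ed subrr.
Qed.

Lemma lattice_x3 D : lattice D -> exists2 x, D x & x.2 != 0.
Proof.
move=> hD; have [a [b [c [Da Db Dc d0]]]] := lattice_basis hD.
have [a0|a0] := eqVneq a.2 0; last by exists a.
have [b0|b0] := eqVneq b.2 0; last by exists b.
have [c0|c0] := eqVneq c.2 0; last by exists c.
case/eqP: d0; rewrite /det3 a0 b0 c0; ring.
Qed.

(* [(g - 1)^2] maps into the isotropic line [e1]. *)
Lemma rational_Bm1 D n m : lattice D -> rational D (Bm 1 n m) -> n = 0.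
Proof.
move=> hD rat; have [x Dx x0] := lattice_x3 hD.
have [a [Oa a0] D1] := rat _ Dx; have [b [Ob b0] D2] := rat _ D1.
pose u := scal b (app (Bm 1 n m) (scal a (app (Bm 1 n m) x)))
  - scal b (scal a (app (Bm 1 n m) x)) - (scal b (scal a (app (Bm 1 n m) x)) - scal b (scal a x)).
have Du : D u.
  by repeat first [assumption | apply: (latticeB hD) | apply: (latticeZ hD)].
have eu : u = (a * b * (n ^+ 2 * x.2), 0, 0).
  by rewrite /u !subvE /app /scal /Bm /= invr1; apply: vecP => /=; ring.
apply/eqP/negPn/negP => n0; have u0 : u <> 0.
  rewrite eu => -[] /eqP; rewrite !mulf_eq0 (negbTE a0) (negbTE b0) (negbTE x0) /= orbF.
  by rewrite (negbTE n0).
have := lattice_good hD Du u0; rewrite eu ev_Q0 /=.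
have -> : 2%:R * (a * b * (n ^+ 2 * x.2)) * 0 - 0 ^+ 2 = 0 :> k by ring.
by rewrite vge0.
Qed.

Lemma escaping_seq : exists t : nat -> k, forall j, t j != 0 /\ w (t j) = - j%:Z.
Proof.
have step (j : nat) : exists x : k, x != 0 /\ w x = - j%:Z.
  by have [x] := val_ex hw (- j%:Z); exists x.
by have [t ht] := choice step; exists t.
Qed.

Lemma escaping_diverges (F : (nat -> Prop) -> Prop) (t : nat -> k) l : ultra F ->
  (forall N, F (fun n => (N <= n)%N)) -> (forall j, t j != 0 /\ w (t j) = - j%:Z) ->
  ~ cv w F t l.
Proof.
move=> hF Finf ht ct; have h := cv_vge_ev hw hF ct (vge_val w l).
have [j [h1 h3]] := ultra_ex hF (ultraI hF h (Finf `|w l|%N.+1)).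
have [t0 wt] := ht j; move: h1; rewrite vgeE // wt; move: h3; clear; lia.
Qed.

Lemma poly_nonroot (P : {poly k}) : P != 0 -> exists i : nat, P.[th ^+ i] != 0.
Proof.
move=> P0; apply: contrapT => hn.
have : (size [seq th ^+ i | i <- iota 0 (size P)] < size P)%N.
  apply: (max_poly_roots P0).
    apply/allP => _ /mapP[i _ ->]; apply/negPn/negP => h; apply: hn; exists i; exact: h.
  rewrite map_inj_uniq ?iota_uniq // => i j /(congr1 w); rewrite !(val_exp hw) //.
  by apply: mulrIn; rewrite lt_eqF.
by rewrite size_map size_iota ltnn.
Qed.

Lemma horner_neq0_near (P : {poly k}) a : P.[a] != 0 ->
  exists N, forall x : k, vge N (x - a) -> P.[x] != 0.
Proof.
move=> Pa; apply: contrapT => hn.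
have step (N : nat) : exists x : k, vge N%:Z (x - a) /\ P.[x] = 0.
  apply: contrapT => h; apply: hn; exists N%:Z => x hx; apply/negP => /eqP e.
  by apply: h; exists x.
have [x hx] := choice step; have [F hF Finf] := ultra_nat.
have cx : cv w F x a.
  move=> N; apply: (ultraS hF) (Finf `|N|%N) => n le.
  by apply: (vge_le _ (proj1 (hx n))); move: le; clear; lia.
have cP (R : {poly k}) : cv w F (fun i => R.[x i]) R.[a].
  elim/poly_ind: R => [|R c IH].
    by rewrite horner0; apply: (cv_ext hF _ (cvC w hF 0)); apply: (ultraA hF) => i; rewrite horner0.
  rewrite hornerMXaddC; apply: (cv_ext hF (f := fun i => R.[x i] * x i + c)).
    by apply: (ultraA hF) => i; rewrite hornerMXaddC.
  by cvt w hw hF.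
case/eqP: Pa; apply: (cv_uniq hw hF (cP P)); apply: (cv_ext hF _ (cvC w hF 0)).
by apply: (ultraA hF) => i; rewrite (proj2 (hx i)).
Qed.

(** * Recurrence in a minimal set *)

Section Minimal.
Context (Z : lat k -> Prop) (mZ : minimal_set Z).

Let iZ : invariant_set Z := proj1 mZ.

Definition inS be := forall D, Z D -> good w E (QV be) D.

(** The lattices of [Z] on which the form is good make up a closed [u]-invariant subset, hence all
    of [Z]. *)
Lemma inS_ex be D : Z D -> good w E (QV be) D -> inS be.
Proof.
move=> ZD gD D' ZD'.
have iW : invariant_set (fun D => Z D /\ good w E (QV be) D).
  split.
  - by exists D.
  - move=> I F hF D1 hD; split.
      by apply: (inv_closed iZ hF); apply: (ultraS hF) hD => i [].
    apply: (good_ulim hF _ _ (cqfC hF (QV be))); apply: (ultraS hF) hD => i [h1 h3] //.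
    exact: inv_lattice h1.
  - move=> t D1 [h1 h3]; split; first exact: (inv_act iZ).
    by apply/good_act; rewrite pull_QV_u.
  - by move=> D1 [h1 _]; apply: (inv_lattice iZ).
by have [] := proj2 mZ _ iW (fun D h => proj1 h) D' ZD'.
Qed.

Definition inT la ph := exists D D', [/\ Z D, Z D' & forall x, D x -> D' (app (nmap la ph) x)].

(** Minimality again: the sources of such maps form a closed invariant set, the target being moved
    at the speed given by [nmap_u]. *)
Lemma inT_all la ph : la != 0 -> inT la ph -> forall D, Z D ->
  exists2 D', Z D' & forall x, D x -> D' (app (nmap la ph) x).
Proof.
move=> l0 [D0 [D0' [ZD0 ZD0' sub0]]] D ZD.
have iW : invariant_set (fun D => Z D /\
    exists2 D', Z D' & forall x, D x -> D' (app (nmap la ph) x)).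
  split.
  - by exists D0; split=> //; exists D0'.
  - move=> I F hF D1 hD; have hZ : F (fun i => Z (D1 i)) by apply: (ultraS hF) hD => i [].
    split; first exact: (inv_closed iZ hF).
    have step i : exists D', (exists2 D', Z D' & forall x, D1 i x -> D' (app (nmap la ph) x)) ->
        Z D' /\ forall x, D1 i x -> D' (app (nmap la ph) x).
      have [[D' h1 h3]|hn] := pselect (exists2 D', Z D' & forall x, D1 i x -> D' (app (nmap la ph) x)).
        by exists D'.
      by exists D0.
    have [D' hD'] := choice step.
    have h' : F (fun i => Z (D' i) /\ forall x, D1 i x -> D' i (app (nmap la ph) x)).
      by apply: (ultraS hF) hD => i [_ /hD'].
    exists (ulim w F D'); first by apply: (inv_closed iZ hF); apply: (ultraS hF) h' => i [].
    move=> x Lx.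
    have hL : F (fun i => lattice (D1 i)) by apply: (ultraS hF) hZ => i; apply: (inv_lattice iZ).
    have [y Dy cy] := ulim_seq hF hL Lx.
    have cy' : cvec w F (fun i => app (nmap la ph) (y i)) (app (nmap la ph) x).
      by apply: (cvec_app hF) => //; apply: clinC.
    apply: ulim_in cy' => //.
    by apply: (ultraS2 hF _ h' Dy) => i [_]; apply.
  - move=> t D1 [ZD1 [D' ZD' sub]]; split; first exact: (inv_act iZ).
    exists (act (t / la) 0 D'); first exact: (inv_act iZ).
    by move=> x /actP[y Dy ->]; rewrite nmap_u // act_in; apply: sub.
  - by move=> D1 [h1 _]; apply: (inv_lattice iZ).
by have [] := proj2 mZ _ iW (fun D h => proj1 h) D ZD.
Qed.

Lemma inT_all' la ph : la != 0 -> inT la ph -> forall D', Z D' ->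
  exists2 D, Z D & forall x, D x -> D' (app (nmap la ph) x).
Proof.
move=> l0 [D0 [D0' [ZD0 ZD0' sub0]]] D' ZD'.
have iW : invariant_set (fun D' => Z D' /\
    exists2 D, Z D & forall x, D x -> D' (app (nmap la ph) x)).
  split.
  - by exists D0'; split=> //; exists D0.
  - move=> I F hF D1 hD; have hZ : F (fun i => Z (D1 i)) by apply: (ultraS hF) hD => i [].
    split; first exact: (inv_closed iZ hF).
    have step i : exists D, (exists2 D, Z D & forall x, D x -> D1 i (app (nmap la ph) x)) ->
        Z D /\ forall x, D x -> D1 i (app (nmap la ph) x).
      have [[D h1 h3]|hn] := pselect (exists2 D, Z D & forall x, D x -> D1 i (app (nmap la ph) x)).
        by exists D.
      by exists D0.
    have [D hD1] := choice step.
    have h' : F (fun i => Z (D i) /\ forall x, D i x -> D1 i (app (nmap la ph) x)).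
      by apply: (ultraS hF) hD => i [_ /hD1].
    have hZ' : F (fun i => Z (D i)) by apply: (ultraS hF) h' => i [].
    exists (ulim w F D); first exact: (inv_closed iZ hF).
    move=> x Lx.
    have hL : F (fun i => lattice (D i)) by apply: (ultraS hF) hZ' => i; apply: (inv_lattice iZ).
    have [y Dy cy] := ulim_seq hF hL Lx.
    have cy' : cvec w F (fun i => app (nmap la ph) (y i)) (app (nmap la ph) x).
      by apply: (cvec_app hF) => //; apply: clinC.
    apply: ulim_in cy' => //.
    by apply: (ultraS2 hF _ h' Dy) => i [_]; apply.
  - move=> t D1 [ZD1 [D ZD sub]]; split; first exact: (inv_act iZ).
    exists (act (t * la) 0 D); first exact: (inv_act iZ).
    by move=> x /actP[y Dy ->]; rewrite nmap_u // mulfK // act_in; apply: sub.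
  - by move=> D1 [h1 _]; apply: (inv_lattice iZ).
by have [] := proj2 mZ _ iW (fun D h => proj1 h) D' ZD'.
Qed.

Lemma inS_T be la ph : la != 0 -> inS be -> inT la ph -> inS (ph + be * la ^+ 2).
Proof.
move=> l0 Sbe [D [D' [ZD ZD' sub]]]; apply: (inS_ex ZD).
rewrite -pull_QV_nmap //; apply: (good_sub (Sbe _ ZD') _ sub).
by rewrite ldet_nmap ?oner_neq0.
Qed.

Lemma inS0 : inS 0.
Proof. by move=> D ZD; apply: lattice_good; apply: (inv_lattice iZ). Qed.

(** For [la = 1] the map is the translation [x1 := x1 + s x3]. *)
Definition inA s := inT 1 (2%:R * s).

Lemma inA_D a b : inA a -> inA b -> inA (a + b).
Proof.
move=> Aa Ab; have [D ZD] := inv_nonempty iZ.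
have [D1 ZD1 s1] := inT_all (oner_neq0 k) Ab ZD.
have [D2 ZD2 s2] := inT_all (oner_neq0 k) Aa ZD1.
exists D, D2; split=> // x Dx; have := s2 _ (s1 _ Dx).
by rewrite !nmap1 !(mulrC 2%:R) !mulfK // wmapD // addr0.
Qed.

Lemma inA_0 : inA 0.
Proof.
have [D ZD] := inv_nonempty iZ; exists D, D; split=> // x.
by rewrite nmap1 mulr0 mul0r wmap0.
Qed.

(** In characteristic [p] the opposite of [a] is its multiple by [p - 1], so closure under addition
    suffices. *)
Lemma inA_N a : inA a -> inA (- a).
Proof.
move=> Aa; have An (n : nat) : inA (n%:R * a).
  elim: n => [|n IH]; first by rewrite mul0r; apply: inA_0.
  by rewrite -natr1 mulrDl mul1r; apply: inA_D.
have := An p.-1; suff -> : p.-1%:R * a = - a by [].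
apply/eqP; rewrite -subr_eq0 opprK -{2}(mul1r a) -mulrDl natr1 prednK.
  by rewrite (pcharf0 hp) mul0r.
exact: prime_gt0 (pcharf_prime hp).
Qed.

Lemma inA_closed : ultra_closed inA.
Proof.
move=> I F hF f l hA cf; have [D ZD] := inv_nonempty iZ.
have step i : exists D', inA (f i) -> Z D' /\ forall x, D x -> D' (app (nmap 1 (2%:R * f i)) x).
  have [h|hn] := pselect (inA (f i)); last by exists D.
  by have [D' h1 h3] := inT_all (oner_neq0 k) h ZD; exists D'.
have [D' hD'] := choice step.
exists D, (ulim w F D'); split=> //.
  by apply: (inv_closed iZ hF); apply: (ultraS hF) hA => i /hD'[].
move=> x Dx.
have cx : cvec w F (fun i => app (nmap 1 (2%:R * f i)) x) (app (nmap 1 (2%:R * l)) x).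
  apply: (cvec_app hF); last exact: cvecC.
  by split; split=> /=; cvt w hw hF.
apply: ulim_in cx => //.
by apply: (ultraS hF) hA => i /hD'[_]; apply.
Qed.

(** The compensation [s t^3] has to preserve [Z] at every time [t], whence all multiples of [s] by
    cubes; the drift moreover demands [3 s = 0]. *)
Definition inA0 s := s = 0 \/ (3%:R = 0 :> k /\ forall x : k, inA (x ^+ 3 * s)).

Lemma inA0_D a b : inA0 a -> inA0 b -> inA0 (a + b).
Proof.
move=> [->|[e ha]]; first by rewrite add0r.
move=> [->|[_ hb]]; first by rewrite addr0; right.
by right; split=> // x; rewrite mulrDr; apply: inA_D.
Qed.

Lemma inA0_closed : ultra_closed inA0.
Proof.
move=> I F hF f l hA cf; have [e|e] := eqVneq (3%:R : k) 0; last first.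
  left; apply: (cv_uniq hw hF cf); apply: (cv_ext hF _ (cvC w hF 0)).
  by apply: (ultraS hF) hA => i [->|[e']]; rewrite ?e' ?eqxx // in e *.
right; split=> // x; apply: (inA_closed hF (f := fun i => x ^+ 3 * f i)).
  apply: (ultraS hF) hA => i [->|[_]]; [rewrite mulr0; exact: inA_0|exact].
by cvt w hw hF.
Qed.

Lemma inA0_cube s (x : k) : inA0 s -> inA (s * x ^+ 3).
Proof. by rewrite mulrC => -[->|[_]]; [rewrite mulr0; exact: inA_0|apply]. Qed.

(** The source is [L] moved by [u(t)] and a translation from [inA], the target is moved by the [t']
    of [nmap_limit]. Both stay in [Z], and the maps between them converge to [nmap la ph]. *)
Lemma inT_return (I : Type) (F : (I -> Prop) -> Prop) (hF : ultra F) (L : lat k)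
    (g : I -> lin k) (Dp : I -> lat k) (t S : I -> k) la ph :
  Z L -> la != 0 -> F (fun i => Z (Dp i)) ->
  F (fun i => ldet (g i) = 1 /\ forall x, L x -> Dp i (app (g i) x)) ->
  (forall i, inA (- S i)) ->
  cqf w F (fun i => pull (pull Q0 (g i)) (wmap (- t i) (- S i))) (QV ph) ->
  cvec w F (fun i => hpull (hpull (0, 0, 1) (g i)) (wmap (- t i) (- S i))) (0, 0, la) ->
  inT la ph.
Proof.
move=> ZL l0 ZDp hg hS cQ ch.
have step i : exists z : lat k, Z z /\ forall x, z x -> L (app (wmap (- t i) (- S i)) x).
  have [z Zz sub] := inT_all' (oner_neq0 k) (hS i) (inv_act iZ (t i) ZL).
  exists z; split=> // x /sub; rewrite nmap1 mulrC mulKf // /act wmapD // oppr0 addr0 add0r.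
  by [].
have [z hz] := choice step.
pose G i := lcomp (g i) (wmap (- t i) (- S i)).
have [t' ct] : exists t', clin w F (fun i => lcomp (wmap (t' i) 0) (G i)) (nmap la ph).
  apply: (nmap_limit hF l0).
  - by apply: (ultraS hF) hg => i [e _]; rewrite ldet_comp ldet_wmap e mulr1.
  - by move: cQ; congr (cqf _ _ _ _); apply: funext => i; rewrite pull_comp.
  - by move: ch; congr (cvec _ _ _ _); apply: funext => i; rewrite hpull_comp.
have Zz : F (fun i => Z (z i)) by apply: (ultraA hF) => i; case: (hz i).
have ZD : F (fun i => Z (act (t' i) 0 (Dp i))).
  by apply: (ultraS hF) ZDp => i; apply: (inv_act iZ).
exists (ulim w F z), (ulim w F (fun i => act (t' i) 0 (Dp i))).
split; [exact: (inv_closed iZ hF)|exact: (inv_closed iZ hF)|].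
move=> x Lx.
have hL : F (fun i => lattice (z i)) by apply: (ultraS hF) Zz => i; apply: (inv_lattice iZ).
have [y zy cy] := ulim_seq hF hL Lx.
apply: ulim_in (cvec_app hF ct cy) => //.
apply: (ultraS2 hF _ hg zy) => i [_ sub] zi.
by rewrite app_comp act_in app_comp; apply: sub; apply: (proj2 (hz i)).
Qed.

Definition in_drift (g1 g2 g3 g4 g5 l1 l2 : k) :=
 [/\ (forall ta, 1 + l1 * ta + l2 * ta ^+ 2 != 0 ->
       inT (1 + l1 * ta + l2 * ta ^+ 2)
         (g1 * ta + g2 * ta ^+ 2 + g3 * ta ^+ 3 + g4 * ta ^+ 4 + g5 * ta ^+ 5)),
   ~ (g1 = 0 /\ g2 = 0 /\ g3 = 0 /\ g4 = 0 /\ g5 = 0 /\ l1 = 0 /\ l2 = 0),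
   3%:R != 0 :> k -> g5 = 0 &
   g3 != 0 -> ~ (forall x : k, inA0 (x ^+ 3 * (g3 / 2%:R)))].

Lemma inT_drift (I : Type) (F : (I -> Prop) -> Prop) (hF : ultra F) (L : lat k)
    (g : I -> lin k) (Dp : I -> lat k) :
  Z L -> F (fun i => Z (Dp i)) -> clin w F g id3 ->
  F (fun i => ldet (g i) = 1 /\ forall x, L x -> Dp i (app (g i) x)) ->
  F (fun i => ~ drift_degenerate (pull Q0 (g i)) (hpull (0, 0, 1) (g i))) ->
  exists g1 g2 g3 g4 g5 l1 l2, in_drift g1 g2 g3 g4 g5 l1 l2.
Proof.
move=> ZL ZDp cg hg nd.
have cQ : cqf w F (fun i => pull Q0 (g i)) Q0.
  by have := cqf_pull hF (cqfC hF Q0) cg; rewrite pull_id.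
have ch : cvec w F (fun i => hpull (0, 0, 1) (g i)) (0, 0, 1).
  have -> : (fun i => hpull (0, 0, 1) (g i)) = (fun i => ((g i).1.1.2, (g i).1.2.2, (g i).2.2)).
    by apply: funext => i; rewrite hpull001.
  by have [[_ _ a1] [_ _ a2] [_ _ a3]] := cg; split.
have A03 s : inA0 s -> 3%:R * s = 0 by move=> [->|[-> _]]; rewrite ?mulr0 ?mul0r.
have [s [r [g1 [g2 [g3 [g4 [g5 [l1 [l2 [hs lim nz g50 g3n]]]]]]]]]] :=
  drift hF cQ ch (or_introl erefl : inA0 0) inA0_D inA0_closed A03 nd.
exists g1, g2, g3, g4, g5, l1, l2; split=> //.
  move=> ta l0; have [cq ch'] := lim ta.
  apply: (inT_return hF ZL l0 ZDp hg _ cq ch') => i.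
  by apply: inA_N; apply: inA0_cube.
by move=> h3; apply: g50 => s' [//|[e]]; rewrite e eqxx in h3.
Qed.

(** The maps [g j] from the limit of [u(t j) z0] back to the orbit give a drift unless almost all
    are degenerate. Then the quotients [R j i] are rational and triangular, and their commutators
    make [nu] an affine function of [ch]. So [nu] converges, although [t j] escapes. *)
Lemma minimal_drift : exists g1 g2 g3 g4 g5 l1 l2, in_drift g1 g2 g3 g4 g5 l1 l2.
Proof.
have [z0 Zz0] := inv_nonempty iZ; have hz0 := inv_lattice iZ Zz0.
have [F hF Finf] := ultra_nat; have [t ht] := escaping_seq.
pose z j := act (t j) 0 z0.
have Zz j : Z (z j) by apply: (inv_act iZ).
have Lz : F (fun j => lattice (z j)) by apply: (ultraA hF) => j; apply: (inv_lattice iZ).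
have [g cg hg] := ulim_conv hF Lz.
have ZL : Z (ulim w F z) by apply: (inv_closed iZ hF); apply: (ultraA hF).
have [nd|deg] := ultraC hF (fun i => ~ drift_degenerate (pull Q0 (g i)) (hpull (0, 0, 1) (g i))).
  by apply: (inT_drift hF ZL (ultraA hF Zz) cg hg nd).
exfalso; have hL := inv_lattice iZ ZL.
have [[_ _ _] [_ cy _] [cm cn cch]] := cg.
have gB : F (fun j => (g j).2.2 != 0 /\ g j = Bm (g j).2.2 (g j).2.1.2 (g j).2.1.1).
  have y3 : F (fun j => (g j).1.2.1.2 ^+ 3 = 1).
    by apply: (ultraS2 hF _ hg deg) => j [d _] /contrapT h; case: (degenerate_Bm d h).
  have y1 := cube_root_one hF y3 cy.
  apply: (ultraS2 hF _ (ultraI hF hg deg) y1) => j [[d _] /contrapT h] e.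
  by case: (degenerate_Bm d h) => _; apply.
pose ch j := (g j).2.2; pose nu j := (g j).2.1.2 - t j * ch j.
pose mu j := (g j).2.1.1 - t j * (g j).2.1.2 + t j ^+ 2 / 2%:R * ch j.
pose phi j := Bm (ch j) (nu j) (mu j).
pose G j := ch j != 0 /\ forall x, ulim w F z x -> z0 (app (phi j) x).
have FG : F G.
  apply: (ultraS2 hF _ hg gB) => j [_ sub] [c0 e]; split=> // x Lx.
  have : z0 (app (wmap (- t j) (- 0)) (app (g j) x)) := sub x Lx.
  by rewrite e -app_comp wmap_Bm.
pose R j i := lcomp (phi j) (Bm (ch i)^-1 (- nu i / ch i) (nu i ^+ 2 / ch i - mu i)).
have ratR i j : G i -> G j -> rational z0 (R j i).
  move=> [ci si] [cj sj] x zx.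
  have [|a [y [Oa a0 Ly e]]] := lattice_quot hL hz0 si _ zx.
    by rewrite ldet_Bm ?oner_neq0.
  by exists a => //; rewrite -app_scal -e app_comp BmK //; apply: sj.
have RE i j : G i -> G j -> exists m, R j i = Bm (ch j / ch i) ((nu j - nu i) / ch i) m.
  move=> [ci _] [cj _]; rewrite /R /phi Bm_comp ?invr_eq0 //; eexists; congr Bm.
  by field.
have [i Gi] := ultra_ex hF FG; have [ci _] := Gi.
(* The commutator of two quotients has [ch = 1], so its [n] vanishes by [rational_Bm1]; this is the
   stated identity. *)
have comm j l : G j -> G l ->
    (nu j - nu i) * (ch l - ch i) = (nu l - nu i) * (ch j - ch i).
  move=> Gj Gl; have [cj _] := Gj; have [cl _] := Gl.
  have rat := rational_comp (rational_comp (ratR _ _ Gi Gj) (ratR _ _ Gi Gl))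
    (rational_comp (ratR _ _ Gj Gi) (ratR _ _ Gl Gi)).
  have [m1 e1] := RE _ _ Gi Gj; have [m2 e2] := RE _ _ Gi Gl.
  have [m3 e3] := RE _ _ Gj Gi; have [m4 e4] := RE _ _ Gl Gi.
  move: rat; rewrite e1 e2 e3 e4 !Bm_comp ?mulf_neq0 ?invr_eq0 //.
  set c := (X in Bm X _ _); set n := (X in Bm _ X _); set m := (X in Bm _ _ X) => rat.
  have c1 : c = 1 by rewrite /c; field; rewrite ci cj cl.
  rewrite c1 in rat; have n0 := rational_Bm1 hz0 rat.
  apply/eqP; rewrite -subr_eq0; apply/eqP; transitivity (n * (ch j * ch l)).
    by rewrite /n; field; rewrite ci cj cl.
  by rewrite n0 mul0r.
have [l cnu] : exists l, cv w F nu l.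
  have [eqc|neqc] := ultraC hF (fun l => ch l = ch i).
    exists (nu i); apply: (cv_ext hF _ (cvC w hF (nu i))).
    apply: (ultraS2 hF _ FG eqc) => l Gl e.
    have [m em] := RE _ _ Gi Gl; have := ratR _ _ Gi Gl; rewrite em e mulfV // => /(rational_Bm1 hz0).
    move/eqP; rewrite mulf_eq0 invr_eq0 (negbTE ci) orbF subr_eq0 => /eqP ->.
    by [].
  have [l [Gl /eqP cl]] := ultra_ex hF (ultraI hF FG neqc).
  have dl : ch l - ch i != 0 by rewrite subr_eq0.
  exists ((nu l - nu i) * (1 - ch i) * (ch l - ch i)^-1 + nu i).
  apply: (cv_ext hF (f := fun j => (nu l - nu i) * (ch j - ch i) * (ch l - ch i)^-1 + nu i)).
    by apply: (ultraS hF) FG => j Gj; rewrite -(comm _ _ Gj Gl) mulfK // subrK.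
  by cvt w hw hF.
apply: (escaping_diverges (l := (0 - l) * 1^-1) hF Finf ht).
apply: (cv_ext hF (f := fun j => ((g j).2.1.2 - nu j) * (ch j)^-1)).
  by apply: (ultraS hF) FG => j [cj _]; rewrite /nu opprB addrC subrK mulfK.
have cV := cvV hw hF cch (oner_neq0 k).
by cvt w hw hF.
Qed.

(** The forms violating isolation either have the shape [QV be] already, or they drift; the limits
    are then [QV] of a nonzero polynomial in the time, good on a limit of the orbit. *)
Lemma inS_nonzero : (forall D, Z D -> unisolated D) -> exists2 be, be != 0 & inS be.
Proof.
move=> hZ; have [z Zz] := inv_nonempty iZ; have [hz hu] := hZ z Zz.
have [Q hQ] := choice (fun n : nat => hu n%:Z).
have [F hF Finf] := ultra_nat.
have cQ : cqf w F Q Q0.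
  apply/(cqf_ball hF) => N; apply: (ultraS hF) (Finf `|N|%N) => n hn.
  have [_ _ /andP[b1 /andP[b2 /andP[b3 /andP[b4 /andP[b5 b6]]]]] _] := hQ n.
  have le : N <= n%:Z by move: hn; clear; lia.
  by apply/andP; split; [|apply/andP; split; [|apply/andP; split;
    [|apply/andP; split; [|apply/andP; split]]]]; apply: (vge_le le).
pose h0 (n : nat) : vec := (0, 0, 1).
have [nd|deg] := ultraC hF (fun n => ~ drift_degenerate (Q n) (h0 n)); last first.
  have [[_ _] [[cc _] _]] := cQ.
  have d3 : F (fun n => qc (Q n) ^+ 3 = 1).
    apply: (ultraS hF) deg => n /contrapT[ea [eb [ecd [ee _]]]].
    have [_ <- _ _] := hQ n; rewrite /qdet ea eb ee.
    have -> : qd (Q n) = - qc (Q n) by apply/eqP; rewrite -addr_eq0 addrC ecd.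
    by ring.
  have [n [e1 /contrapT[ea [eb [ecd [ee _]]]]]] :=
    ultra_ex hF (ultraI hF (cube_root_one hF d3 cc) deg).
  have [gQ _ _ nQ] := hQ n.
  have eQ : Q n = QV (qff (Q n)).
    move: ea eb ecd ee e1; case: (Q n) => a b c d e f /= -> -> ecd -> e1; rewrite /QV e1.
    by congr Qf; apply/eqP; rewrite -addr_eq0 addrC -e1 ecd.
  exists (qff (Q n)); last by apply: (inS_ex Zz); rewrite -eQ.
  by apply/eqP => f0; apply: nQ; rewrite eQ f0.
have A0c : ultra_closed (fun s => s = 0).
  move=> I F' hF' f l hf cf; apply: (cv_uniq hw hF' cf).
  by apply: (cv_ext hF' _ (cvC w hF' 0)); apply: (ultraS hF') hf => i ->.
have A0D (a b : k) : a = 0 -> b = 0 -> a + b = 0 by move=> -> ->; rewrite addr0.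
have A03 (a : k) : a = 0 -> 3%:R * a = 0 by move=> ->; rewrite mulr0.
have [s [r [g1 [g2 [g3 [g4 [g5 [l1 [l2 [hs lim nz g50 _]]]]]]]]]] :=
  drift hF cQ (cvecC hF (0, 0, 1)) (erefl (0 : k)) A0D A0c A03 nd.
(* The functional [x3] is fixed by [u], so [lambda] is trivial and the nonzero coefficient belongs
   to the form. *)
have l12 ta : l1 * ta + l2 * ta ^+ 2 = 0.
  have [_ [_ _ /= cl]] := lim ta.
  have := cv_uniq hw hF cl (cv_ext hF _ (cvC w hF 1)).
  have e' : F (fun i => 1 = (hpull (0, 0, 1) (wmap (- (r i * ta)) (- (s i * (r i * ta) ^+ 3)))).2).
    by apply: (ultraA hF) => i; rewrite hpull_wmap /=; ring.
  by move=> /(_ e') h; apply: (addrI 1); rewrite addrA h addr0.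
have th1 : th - 1 != 0.
  by rewrite subr_eq0; apply: contraTneq wth => ->; rewrite (val_one hw).
have l20 : l2 = 0.
  have h : l2 * (th * (th - 1)) = (l1 * th + l2 * th ^+ 2) - th * (l1 * 1 + l2 * 1 ^+ 2) by ring.
  by apply: (mulIf (mulf_neq0 th0 th1)); rewrite h !l12 mulr0 mul0r subrr.
have l10 : l1 = 0 by have := l12 1; rewrite l20 mul0r addr0 mulr1.
have g5z : g5 = 0 by apply: g50.
have SPhi ta : inS (g1 * ta + g2 * ta ^+ 2 + g3 * ta ^+ 3 + g4 * ta ^+ 4 + g5 * ta ^+ 5).
  have [cq _] := lim ta.
  have Za : F (fun i => Z (act (r i * ta) 0 z)) by apply: (ultraA hF) => i; apply: (inv_act iZ).
  apply: (inS_ex (inv_closed iZ hF Za)).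
  apply: (good_ulim hF _ _ cq); first by apply: (ultraS hF) Za => i; apply: (inv_lattice iZ).
  apply: (ultraA hF) => i; rewrite hs mul0r; apply/good_act; have [gQ _ _ _] := hQ i.
  by rewrite pull_comp comp_wmapK pull_id.
pose P : {poly k} := Poly [:: 0; g1; g2; g3; g4; g5].
have PE (x : k) : P.[x] = g1 * x + g2 * x ^+ 2 + g3 * x ^+ 3 + g4 * x ^+ 4 + g5 * x ^+ 5.
  by rewrite horner_Poly /=; ring.
have P0 : P != 0.
  apply/eqP => e; have ci i : [:: 0; g1; g2; g3; g4; g5]`_i = 0 by rewrite -coef_Poly -/P e coef0.
  by apply: nz; split; [exact: (ci 1%N)|split; [exact: (ci 2%N)|split; [exact: (ci 3%N)|split;
    [exact: (ci 4%N)|]]]].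
by have [i hi] := poly_nonroot P0; exists (P.[th ^+ i]) => //; rewrite PE.
Qed.

Lemma minimal_isolated : (forall D, Z D -> unisolated D) -> False.
Proof.
move=> hZ; have [be be0 Sbe] := inS_nonzero hZ.
have [g1 [g2 [g3 [g4 [g5 [l1 [l2 [hT nz g50 g3n]]]]]]]] := minimal_drift.
have [z Zz] := inv_nonempty iZ; have hz := inv_lattice iZ Zz.
pose P : {poly k} := Poly [:: 0; g1; g2; g3; g4; g5]; pose L : {poly k} := Poly [:: 1; l1; l2].
have PE (x : k) : P.[x] = g1 * x + g2 * x ^+ 2 + g3 * x ^+ 3 + g4 * x ^+ 4 + g5 * x ^+ 5.
  by rewrite horner_Poly /=; ring.
have LE (x : k) : L.[x] = 1 + l1 * x + l2 * x ^+ 2 by rewrite horner_Poly /=; ring.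
have L0 : L != 0.
  by apply/eqP => /(congr1 (fun R : {poly k} => R`_0)); rewrite coef_Poly coef0 /= => /eqP;
    rewrite oner_eq0.
have der0 b : inS b -> (P + b *: L ^+ 2)^`() = 0.
  move=> Sb; set R := P + _; apply/eqP/negPn/negP => R0.
  have [i] := poly_nonroot (mulf_neq0 L0 R0); set a := th ^+ i; rewrite hornerM mulf_eq0 negb_or => /andP[La Ra].
  have [N hN] := horner_neq0_near La.
  have [N0 hN0] := hensel hw hcomp hres N Ra.
  apply: (lattice_interior (be := R.[a]) (N := N0) hz) => y hy.
  have [x xa <-] := hN0 y hy.
  suff : inS R.[x] by move=> S; apply: S.
  have := inS_T (hN x xa) Sb; rewrite !LE => h.
  rewrite /R hornerD hornerZ horner_exp PE LE; apply: h; apply: hT.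
  by rewrite -LE hN.
have dP : P^`() = 0 by have := der0 0 inS0; rewrite scale0r addr0.
(* With [P' = 0] there remains [be (L^2)' = 0], which says something because [be] is nonzero. *)
have dL : L^`() = 0.
  have /eqP := der0 be Sbe; rewrite derivD dP add0r derivZ scaler_eq0 (negbTE be0) /=.
  rewrite expr2 derivM (mulrC L^`()) -mulr2n -scaler_nat scaler_eq0 (negbTE h2) /=.
  by rewrite mulf_eq0 (negbTE L0) => /eqP.
have dPi i : [:: 0; g1; g2; g3; g4; g5]`_i.+1 *+ i.+1 = 0.
  by have := congr1 (fun R : {poly k} => R`_i) dP; rewrite coef_deriv coef_Poly coef0.
have dLi i : [:: 1; l1; l2]`_i.+1 *+ i.+1 = 0.
  by have := congr1 (fun R : {poly k} => R`_i) dL; rewrite coef_deriv coef_Poly coef0.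
have l10 : l1 = 0 := dLi 0%N.
have nat0 (a : k) (n : nat) : n%:R != 0 :> k -> a *+ n = 0 -> a = 0.
  by move=> n0 /eqP; rewrite -mulr_natr mulf_eq0 (negbTE n0) orbF => /eqP.
have l20 : l2 = 0 := nat0 _ _ h2 (dLi 1%N).
have g10 : g1 = 0 := dPi 0%N.
have g20 : g2 = 0 := nat0 _ _ h2 (dPi 1%N).
have g40 : g4 = 0.
  by apply: (nat0 _ 4%N) (dPi 3%N); rewrite (natrM _ 2 2) mulf_neq0.
(* In characteristic five the derivative does not see the quintic coefficient; outside
   characteristic three it vanishes because there [inA0] is trivial. *)
have [e3|e3] := eqVneq (3%:R : k) 0; last first.
  have g30 : g3 = 0 := nat0 _ _ e3 (dPi 2%N).
  by apply: nz; rewrite g10 g20 g30 g40 l10 l20 (g50 e3).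
have g5z : g5 = 0.
  by apply: (nat0 _ 5%N) (dPi 4%N); rewrite (natrD _ 3 2) e3 add0r.
have g30 : g3 != 0.
  by apply/eqP => g30; apply: nz; rewrite g10 g20 g30 g40 g5z l10 l20.
apply: (g3n g30) => x; right; split=> // y.
have := hT (y * x); rewrite l10 l20 g10 g20 g40 g5z !mul0r !addr0 !add0r => /(_ (oner_neq0 k)).
rewrite /inA; congr inT; rewrite exprMn.
by field.
Qed.

End Minimal.

Lemma lattice_isolated D : lattice D -> exists N, forall Q, good w E Q D -> qdet Q = 1 ->
  qball N Q Q0 -> Q = Q0.
Proof.
move=> hD; apply: contrapT => hn; have uD : unisolated D.
  split=> // N; apply: contrapT => h; apply: hn; exists N => Q gQ dQ bQ.
  by apply: contrapT => nQ; apply: h; exists Q.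
have [Z mZ sub] := minimal_set_ex (unisolated_inv uD).
exact: (minimal_isolated mZ).
Qed.

(** * Forms invariant under rational isometries *)

Lemma clin_linv (I : Type) (F : (I -> Prop) -> Prop) (hF : ultra F) (g : I -> lin k) l :
  clin w F g l -> ldet l != 0 -> clin w F (fun i => linv (g i)) (linv l).
Proof.
move=> cg l0; have [[a1 a2 a3] [b1 b2 b3] [c1 c2 c3]] := cg.
have cd : cv w F (fun i => (ldet (g i))^-1) (ldet l)^-1.
  by apply: (cvV hw hF) => //; have [ca cb cc] := cg; apply: (cv_det3 hF).
by split; split=> /=; cvt w hw hF.
Qed.

Lemma lcompA (a b c : lin k) : lcomp (lcomp a b) c = lcomp a (lcomp b c).
Proof. by rewrite /lcomp !app_comp. Qed.

Lemma lcomp1 (g : lin k) : lcomp g id3 = g.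
Proof.
by case: g => [[a b] c]; rewrite /lcomp /app /=; congr (_, _, _); apply: vecP => /=; ring.
Qed.

Lemma ldet_id3 : ldet id3 = 1 :> k.
Proof. by rewrite /ldet /det3 /=; ring. Qed.

Section EscapingForms.
Context (F : (nat -> Prop) -> Prop) (hF : ultra F) (Finf : forall N, F (fun n => (N <= n)%N)).
Context (t : nat -> k) (ht : forall j, t j != 0 /\ w (t j) = - j%:Z).

Lemma escaping_linear (a b l : k) : cv w F (fun j => a - b * t j) l -> b = 0.
Proof.
move=> cl; apply/eqP/negPn/negP => b0.
apply: (escaping_diverges (l := (a - l) * b^-1) hF Finf ht).
apply: (cv_ext hF (f := fun j => (a - (a - b * t j)) * b^-1)); last by cvt w hw hF.
by apply: (ultraA hF) => j; rewrite opprB addrC subrK mulrC mulKf.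
Qed.

(** Read in the order [qb, qc, qe, qff], each entry of the moved form is linear in [t] once the
    previous slopes vanish, so convergence kills its slope too. *)
Lemma escaping_form (q' l : qf k) : cqf w F (fun j => pull q' (wmap (- t j) (- 0))) l ->
  exists c f, q' = Qf 0 0 c (- c) 0 f.
Proof.
move=> [[_ cb] [[cc _] [ce cf]]].
have ext (u v : nat -> k) (x : k) : (forall j, u j = v j) -> cv w F u x -> cv w F v x.
  by move=> h; apply: (cv_ext hF); apply: (ultraA hF).
have a0 : qa q' = 0.
  by apply: (escaping_linear (a := qb q') (ext _ _ _ _ cb)) => j; rewrite pull_wmap /=.
have b0 : qb q' = 0.
  by apply: (escaping_linear (a := qc q') (ext _ _ _ _ cc)) => j; rewrite pull_wmap /= a0; ring.
have cd0 : qc q' + qd q' = 0.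
  by apply: (escaping_linear (a := qe q') (ext _ _ _ _ ce)) => j; rewrite pull_wmap /= a0 b0; ring.
have ed : qd q' = - qc q' by apply/eqP; rewrite -addr_eq0 addrC cd0.
have e0 : 2%:R * qe q' = 0.
  apply: (escaping_linear (a := qff q') (ext _ _ _ _ cf)) => j.
  by rewrite pull_wmap /= a0 b0 ed; field; rewrite ?h2.
exists (qc q'), (qff q'); move: a0 b0 ed e0; case: q' {cb cc ce cf cd0} => a b c d e f /= -> -> -> /eqP.
by rewrite mulf_eq0 (negbTE h2) => /eqP ->.
Qed.

End EscapingForms.

(** By isolation the maps [g j] from the limit of [u(t j) L] are isometries for most [j]. Quotients
    of the [phi j] are rational, so [pull q' (phi j)] is one fixed form; undoing [g j], which tends
    to the identity, shows that [q'] moved by [u(- t j)] converges. *)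
Lemma rational_form_QV L (q' : qf k) : lattice L ->
  (forall g, ldet g = 1 -> pull Q0 g = Q0 -> rational L g -> pull q' g = q') ->
  exists c f, q' = Qf 0 0 c (- c) 0 f.
Proof.
move=> hL hq; have [F hF Finf] := ultra_nat; have [t ht] := escaping_seq.
pose z j := act (t j) 0 L.
have Lz : F (fun j => lattice (z j)) by apply: (ultraA hF) => j; apply: lattice_u.
have [g cg hg] := ulim_conv hF Lz; have hy := lattice_ulim hF Lz.
have [N hN] := lattice_isolated hy.
have cQ : cqf w F (fun i => pull Q0 (g i)) Q0.
  by have := cqf_pull hF (cqfC hF Q0) cg; rewrite pull_id.
have iso : F (fun j => pull Q0 (g j) = Q0).
  apply: (ultraS2 hF _ hg (proj1 (cqf_ball hF _ _) cQ N)) => j [d sub] b; apply: hN => //.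
    apply: (good_sub (lattice_good (lattice_u (t j) hL)) _ sub).
    by rewrite d oner_neq0.
  by rewrite qdet_pull d qdet_Q0 expr1n mulr1.
pose phi j := lcomp (wmap (- t j) (- 0)) (g j).
pose G j := [/\ ldet (phi j) = 1, pull Q0 (phi j) = Q0 & forall x, ulim w F z x -> L (app (phi j) x)].
have FG : F G.
  apply: (ultraS2 hF _ hg iso) => j [d sub] e; split.
  - by rewrite ldet_comp ldet_wmap d mulr1.
  - by rewrite -pull_comp oppr0 pull_Q0_u.
  - by move=> x /sub; rewrite app_comp.
have [i [di ei si]] := ultra_ex hF FG.
have i0 : ldet (phi i) != 0 by rewrite di oner_neq0.
have same j : G j -> pull q' (phi j) = pull q' (phi i).
  move=> [dj ej sj]; pose ga := lcomp (phi j) (linv (phi i)).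
  have dl : ldet (linv (phi i)) = 1.
    by have := congr1 (@ldet _) (comp_linv i0); rewrite ldet_comp di mul1r ldet_id3.
  have el : pull Q0 (linv (phi i)) = Q0 by rewrite -{1}ei pull_comp comp_linv // pull_id.
  have e : pull q' ga = q'.
    apply: hq.
    - by rewrite ldet_comp dj dl mulr1.
    - by rewrite -pull_comp ej el.
    - move=> x Lx; have [a [y [Oa a0 Ly e]]] := lattice_quot hy hL si i0 Lx.
      by exists a => //; rewrite -app_scal -e app_comp linvK //; apply: sj.
  by rewrite -{2}e pull_comp lcompA comp_linvl // lcomp1.
have gne j : ldet (g j) = 1 -> ldet (g j) != 0 by move=> ->; apply: oner_neq0.
have id0 : ldet id3 != 0 :> k by rewrite ldet_id3 oner_neq0.
have cC := cqf_pull hF (cqfC hF (pull q' (phi i))) (clin_linv hF cg id0).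
apply: (escaping_form hF Finf ht (l := pull (pull q' (phi i)) (linv id3))).
apply/(cqf_ball hF) => N'.
apply: (ultraS2 hF _ (ultraI hF FG hg) (proj1 (cqf_ball hF _ _) cC N')) => j [Gj [d _]].
by rewrite -(same _ Gj) -pull_comp pull_comp comp_linv ?gne // pull_id.
Qed.

Definition swap3 : lin k := ((0, 0, 1), (0, 1, 0), (1, 0, 0)).

Lemma app_swap3 x : app swap3 x = (x.2, x.1.2, x.1.1).
Proof. by rewrite /app /=; apply: vecP => /=; ring. Qed.

Lemma swap3K x : app swap3 (app swap3 x) = x.
Proof. by rewrite !app_swap3 /=; case: x => [[]]. Qed.

Lemma swap3_comp : lcomp swap3 swap3 = id3.
Proof. by rewrite /lcomp !app_swap3. Qed.

Lemma pull_Q0_swap3 : pull Q0 swap3 = Q0 :> qf k.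
Proof. by rewrite /pull /bil /=; congr Qf; ring. Qed.

Lemma ldet_swap3 : ldet swap3 = -1.
Proof. by rewrite /ldet /det3 /=; ring. Qed.

Lemma lattice_swap3 D : lattice D -> lattice (fun x => D (app swap3 x)).
Proof.
move=> hD; have bs N x : bvec N (app swap3 x) = bvec N x.
  by rewrite app_swap3 /bvec /= andbA andbC andbA andbAC; case: (vge N x.2); case: (vge N x.1.2);
    case: (vge N x.1.1).
split.
- by rewrite app0; apply: lattice0 hD.
- by move=> x y Dx Dy; rewrite appB; apply: (latticeB hD).
- by move=> a x Oa Dx; rewrite app_scal; apply: (latticeZ hD).
- move=> x Dx x0; have := lattice_good hD Dx; rewrite -ev_pull pull_Q0_swap3; apply.
  by move=> e; apply: x0; rewrite -(swap3K x) e app0.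
- move=> x y z Dx Dy Dz; have [a Oa] := lattice_det hD Dx Dy Dz.
  rewrite det3_app ldet_swap3 mulN1r => e; exists (0 - a); last by rewrite sub0r mulrN -e opprK.
  by apply: OB => //; rewrite -(subrr 1); apply: OB.
- move=> f; have [i [j [ij [d Dd h]]]] := lattice_index hD (fun i => app swap3 (f i)).
  exists i, j; split=> //; exists (app swap3 d); first by rewrite swap3K.
  by rewrite -bs !appB swap3K.
Qed.

(** Exchanging [x1] and [x3] preserves [Q0] and turns the remaining [x3^2] term into an [x1^2] term,
    which the previous lemma excludes. *)
Lemma rational_form L (q' : qf k) : lattice L ->
  (forall g, ldet g = 1 -> pull Q0 g = Q0 -> rational L g -> pull q' g = q') ->
  exists c, q' = Qf 0 0 c (- c) 0 0.
Proof.
move=> hL hq; have [c [f e]] := rational_form_QV hL hq.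
have [|c' [f' e']] := @rational_form_QV _ (pull q' swap3) (lattice_swap3 hL).
  move=> g dg eg rg.
  have h : pull q' (lcomp (lcomp swap3 g) swap3) = q'.
    apply: hq.
    - by rewrite !ldet_comp ldet_swap3 dg mulr1 mulrNN mulr1.
    - by rewrite -!pull_comp pull_Q0_swap3 eg pull_Q0_swap3.
    - move=> x Lx; have [|a Oa Da] := rg (app swap3 x); first by rewrite swap3K.
      by exists a => //; rewrite !app_comp -app_scal.
  by rewrite -{2}h !pull_comp !lcompA swap3_comp lcomp1.
exists c; rewrite e; congr Qf.
have := congr1 (@qa _) e'; rewrite e /pull /bil /= => <-.
by ring.
Qed.

End Lattices.

(* A [K]-linear functional on the [K]-span of the [g j] which is nonzero at [g m]. *)
Lemma relation_dual (K k : fieldType) (iota : {rmorphism K -> k}) n (g : 'I_n -> k) (m : 'I_n) :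
  g m != 0 -> exists2 b : 'I_n -> K, b m != 0 &
    forall c : 'I_n -> K, \sum_j iota (c j) * g j = 0 -> \sum_j c j * b j = 0.
Proof.
move=> gm0; pose rel (u : 'rV[K]_n) := \sum_j iota (u 0 j) * g j = 0.
have relD u v : rel u -> rel v -> rel (u + v).
  move=> hu hv; rewrite /rel (eq_bigr (fun j => iota (u 0 j) * g j + iota (v 0 j) * g j)).
    by rewrite big_split /= hu hv addr0.
  by move=> j _; rewrite mxE rmorphD mulrDl.
have relZ a u : rel u -> rel (a *: u).
  move=> hu; rewrite /rel (eq_bigr (fun j => iota a * (iota (u 0 j) * g j))).
    by rewrite -mulr_sumr hu mulr0.
  by move=> j _; rewrite mxE rmorphM mulrA.
pose P r := `[< exists2 A : 'M[K]_n, forall u : 'rV_n, (u <= A)%MS -> rel u & \rank A = r >].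
have exP : exists r, P r.
  exists 0%N; apply/asboolP; exists 0; last exact: mxrank0.
  by move=> u; rewrite submx0 => /eqP ->; rewrite /rel big1 // => j _; rewrite mxE rmorph0 mul0r.
have ubP r : P r -> (r <= n)%N by move=> /asboolP[A _ <-]; apply: rank_leq_col.
case: (ex_maxnP exP ubP) => r /asboolP[A hA rA] rmax.
have maxA c : rel c -> (c <= A)%MS.
  move=> hc; have le : (\rank (A + c)%MS <= r)%N.
    apply: rmax; apply/asboolP; exists (A + c)%MS => // u /sub_addsmxP[[u1 u2] /= ->].
    apply: relD; first by apply: hA; apply: submxMl.
    by rewrite [u2]mx11_scalar mul_scalar_mx; apply: relZ.
  have := mxrank_leqif_sup (addsmxSl A c); move=> [_ e].
  have : \rank A == \rank (A + c)%MS.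
    by rewrite eqn_leq mxrankS ?addsmxSl //= rA.
  by rewrite e; apply: submx_trans; apply: addsmxSr.
(* The columns of a cokernel matrix are functionals annihilating exactly the relations; one of them
   is nonzero at [m]. *)
have [C subE] : exists C : 'M[K]_n, forall u : 'rV_n, (u <= A)%MS = (u *m C == 0).
  by exists (cokermx A) => u; rewrite submxE.
have : ~~ ((delta_mx 0 m : 'rV[K]_n) <= A)%MS.
  apply/negP => /hA; rewrite /rel (bigD1 m) //= big1 => [|j jm]; last first.
    by rewrite mxE eqxx (negbTE jm) rmorph0 mul0r.
  by rewrite mxE !eqxx rmorph1 mul1r addr0 => /eqP; rewrite (negbTE gm0).
rewrite subE -rowE => /rV0Pn[j]; rewrite mxE => hj.
exists (fun i => C i j) => // c hc.
have /maxA : rel (\row_i c i) by rewrite /rel -[RHS]hc; apply: eq_bigr => i _; rewrite mxE.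
rewrite subE => /eqP/matrixP/(_ 0 j); rewrite !mxE => e.
by apply: etrans e; apply: eq_bigr => i _; rewrite mxE.
Qed.

(** * Normal form and scalars of ternary forms *)

Section FormScaling.
Context (k : fieldType).

Definition qscal (c : k) (Q : qf k) : qf k :=
  Qf (c * qa Q) (c * qb Q) (c * qc Q) (c * qd Q) (c * qe Q) (c * qff Q).

Lemma bil_qscal c Q x y : bil (qscal c Q) x y = c * bil Q x y.
Proof. by rewrite /bil /=; ring. Qed.

Lemma pull_qscal c Q g : pull (qscal c Q) g = qscal c (pull Q g).
Proof. by rewrite /pull /= !bil_qscal. Qed.

Lemma qscalA a b Q : qscal a (qscal b Q) = qscal (a * b) Q.
Proof. by rewrite /qscal /= !mulrA. Qed.

Lemma qscal1 Q : qscal 1 Q = Q.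
Proof. by case: Q => *; rewrite /qscal /= !mul1r. Qed.

Lemma bil_nondegenerate (G : qf k) x : qdet G != 0 -> x <> 0 -> exists y, bil G x y != 0.
Proof.
move=> dG x0; apply: contrapT => hn; have z y : bil G x y = 0.
  by apply/eqP/negPn/negP => h; apply: hn; exists y.
have g1 : qa G * x.1.1 + qb G * x.1.2 + qc G * x.2 = 0.
  by rewrite -[RHS](z (1, 0, 0)) /bil /=; ring.
have g2 : qb G * x.1.1 + qd G * x.1.2 + qe G * x.2 = 0.
  by rewrite -[RHS](z (0, 1, 0)) /bil /=; ring.
have g3 : qc G * x.1.1 + qe G * x.1.2 + qff G * x.2 = 0.
  by rewrite -[RHS](z (0, 0, 1)) /bil /=; ring.
apply: x0; apply: (scal_eq0 dG); apply: vecP; rewrite /scal /qdet /=.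
- transitivity ((qd G * qff G - qe G * qe G) * (qa G * x.1.1 + qb G * x.1.2 + qc G * x.2)
    - (qb G * qff G - qc G * qe G) * (qb G * x.1.1 + qd G * x.1.2 + qe G * x.2)
    + (qb G * qe G - qc G * qd G) * (qc G * x.1.1 + qe G * x.1.2 + qff G * x.2)); first by ring.
  by rewrite g1 g2 g3; ring.
- transitivity (- (qb G * qff G - qe G * qc G) * (qa G * x.1.1 + qb G * x.1.2 + qc G * x.2)
    + (qa G * qff G - qc G * qc G) * (qb G * x.1.1 + qd G * x.1.2 + qe G * x.2)
    - (qa G * qe G - qc G * qb G) * (qc G * x.1.1 + qe G * x.1.2 + qff G * x.2)); first by ring.
  by rewrite g1 g2 g3; ring.
- transitivity ((qb G * qe G - qd G * qc G) * (qa G * x.1.1 + qb G * x.1.2 + qc G * x.2)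
    - (qa G * qe G - qb G * qc G) * (qb G * x.1.1 + qd G * x.1.2 + qe G * x.2)
    + (qa G * qd G - qb G * qb G) * (qc G * x.1.1 + qe G * x.1.2 + qff G * x.2)); first by ring.
  by rewrite g1 g2 g3; ring.
Qed.

(* The middle vector is the cross product of [G f1] and [G f3]. *)
Lemma isotropic_normal_form (h2 : 2%:R != 0 :> k) (G : qf k) : qdet G != 0 ->
  (exists2 x, x <> 0 & ev G x = 0) ->
  exists2 F : lin k, ldet F != 0 & pull G F = qscal (qdet G)^-1 Q0.
Proof.
move=> dG [f1 f10 ef1].
pose gr (x : vec k) : vec k := (qa G * x.1.1 + qb G * x.1.2 + qc G * x.2,
  qb G * x.1.1 + qd G * x.1.2 + qe G * x.2, qc G * x.1.1 + qe G * x.1.2 + qff G * x.2).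
have grE (x y : vec k) : bil G x y = (gr x).1.1 * y.1.1 + (gr x).1.2 * y.1.2 + (gr x).2 * y.2.
  by rewrite /bil /gr /=; ring.
have [e be] := bil_nondegenerate dG f10.
have bilD x y z : bil G x (y - z) = bil G x y - bil G x z.
  by rewrite subvE /bil /=; ring.
have bilC x y : bil G x y = bil G y x by rewrite /bil; ring.
have bilZ a x y : bil G x (scal a y) = a * bil G x y by rewrite /bil /=; ring.
pose b := bil G f1 e; pose al := (qdet G * b)^-1.
pose f3 := scal al (e - scal (ev G e / (2%:R * b)) f1).
have b13 : bil G f1 f3 = (qdet G)^-1.
  by rewrite /f3 bilZ bilD bilZ -[bil G f1 f1]/(ev G f1) ef1 mulr0 subr0 -/b /al; field; rewrite dG be.
have ef3 : bil G f3 f3 = 0.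
  rewrite /f3 bilZ [bil G (scal _ _) _]bilC bilZ bilD bilZ !(bilC (_ - _)) !bilD !bilZ.
  rewrite -[bil G f1 f1]/(ev G f1) ef1 (bilC e f1) -/b -[bil G e e]/(ev G e).
  have id (a s c : k) : c != 0 ->
      a * (a * (s - s / (2%:R * c) * c - s / (2%:R * c) * (c - s / (2%:R * c) * 0))) = 0.
    by move=> c0; field; rewrite c0 h2.
  exact: id.
clearbody f3; pose u := gr f1; pose v := gr f3.
pose f2 : vec k := (u.1.2 * v.2 - u.2 * v.1.2, u.2 * v.1.1 - u.1.1 * v.2, u.1.1 * v.1.2 - u.1.2 * v.1.1).
have b12 : bil G f1 f2 = 0 by rewrite grE -/u /f2 /=; ring.
have b23 : bil G f2 f3 = 0 by rewrite bilC grE -/v /f2 /=; ring.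
have b22 : bil G f2 f2 = - (qdet G)^-1.
  have -> : bil G f2 f2 = qdet G * (bil G f1 f1 * bil G f3 f3 - bil G f1 f3 ^+ 2).
    by rewrite /f2 /u /v /bil /gr /qdet /=; ring.
  by rewrite -[bil G f1 f1]/(ev G f1) ef1 b13 mul0r; field.
exists (f1, f2, f3).
  have /eqP : qdet (pull G (f1, f2, f3)) = (qdet G)^-1 ^+ 3.
    by rewrite /pull /qdet /= b12 b13 b22 b23 ef3 -[bil G f1 f1]/(ev G f1) ef1; ring.
  rewrite qdet_pull; apply: contraTneq => ->; rewrite expr2 !mul0r eq_sym expf_eq0 /= invr_eq0.
  by [].
rewrite /pull /= b12 b13 b22 b23 ef3 -[bil G f1 f1]/(ev G f1) ef1 /qscal /=.
by congr Qf; ring.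
Qed.

End FormScaling.

Section TernaryScalars.
Context (K k : fieldType) (iota : {rmorphism K -> k}).

Definition vmap (x : vec K) : vec k := (iota x.1.1, iota x.1.2, iota x.2).
Definition lmap (g : lin K) : lin k := (vmap g.1.1, vmap g.1.2, vmap g.2).
Definition qmap (B : qf K) : qf k :=
  Qf (iota (qa B)) (iota (qb B)) (iota (qc B)) (iota (qd B)) (iota (qe B)) (iota (qff B)).

Lemma bil_map B x y : bil (qmap B) (vmap x) (vmap y) = iota (bil B x y).
Proof. by rewrite /bil /= !rmorphD /= !rmorphM /= !rmorphD /= !rmorphM. Qed.

Lemma pull_map B g : pull (qmap B) (lmap g) = qmap (pull B g).
Proof. by rewrite /pull /= !bil_map. Qed.

(** [B] arises by applying a [K]-linear functional to the coefficients of [G]; linear identities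
    over [K], such as invariance under a matrix over [K], carry over. The first clause expresses
    that [B] is nonzero. *)
Lemma qf_functional (G : qf k) : qdet G != 0 -> exists2 B : qf K,
  qscal 0 (qmap B) <> qmap B & forall g : lin K, pull G (lmap g) = G -> pull B g = B.
Proof.
move=> dG; pose gs := [:: qa G; qb G; qc G; qd G; qe G; qff G]; pose g (j : 'I_6) := gs`_j.
have sum6 (R : ringType) (f : nat -> R) :
    \sum_(j < 6) f j = f 0%N + f 1%N + f 2%N + f 3%N + f 4%N + f 5%N.
  by rewrite !big_ord_recr big_ord0 /= add0r.
have [m gm] : exists m, g m != 0.
  apply: contrapT => hn; have z j : g j = 0.
    by apply/eqP/negPn/negP => h; apply: hn; exists j.
  have zi i (h : (i < 6)%N) : gs`_i = 0 by have := z (Ordinal h).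
  case/eqP: dG; rewrite /qdet (zi 0%N isT : qa G = 0) (zi 1%N isT : qb G = 0) (zi 2%N isT : qc G = 0).
  by ring.
have [b bm hb] := relation_dual iota gm.
pose B := Qf (b (inord 0)) (b (inord 1)) (b (inord 2)) (b (inord 3)) (b (inord 4)) (b (inord 5)).
pose bs (i : nat) := b (inord i).
have bE (x y : vec K) (l : vec K * vec K) :
    bil G (vmap x) (vmap y) = bil G (vmap l.1) (vmap l.2) -> bil B x y = bil B l.1 l.2.
  case: l => u v /= h.
  pose c (x y : vec K) (i : nat) : K := [:: x.1.1 * y.1.1; x.1.1 * y.1.2 + x.1.2 * y.1.1;
    x.1.1 * y.2 + x.2 * y.1.1; x.1.2 * y.1.2; x.1.2 * y.2 + x.2 * y.1.2; x.2 * y.2]`_i.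
  have h1 : \sum_(j < 6) iota (c x y j - c u v j) * g j = 0.
    rewrite /g (sum6 _ (fun i => iota (c x y i - c u v i) * gs`_i)) /c /gs /=.
    transitivity (bil G (vmap x) (vmap y) - bil G (vmap u) (vmap v)); last by rewrite h subrr.
    by rewrite /bil /= !rmorphB /= !rmorphD /= !rmorphM /=; ring.
  have := hb _ h1.
  have -> : \sum_(j < 6) (c x y j - c u v j) * b j = \sum_(j < 6) (c x y j - c u v j) * bs j.
    by apply: eq_bigr => j _; rewrite /bs inord_val.
  rewrite (sum6 _ (fun i => (c x y i - c u v i) * bs i)) /c /= => e.
  apply/eqP; rewrite -subr_eq0; apply/eqP; rewrite -[RHS]e /bil /= /bs; ring.
exists B.
  move=> [/esym e0 /esym e1 /esym e2 /esym e3 /esym e4 /esym e5].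
  have hz i : (i < 6)%N -> iota (bs i) = 0.
    by move: i => [|[|[|[|[|[|i]]]]]] // _; [exact: etrans e0 (mul0r _)|exact: etrans e1 (mul0r _)
      |exact: etrans e2 (mul0r _)|exact: etrans e3 (mul0r _)|exact: etrans e4 (mul0r _)
      |exact: etrans e5 (mul0r _)].
  have := hz m (ltn_ord m); rewrite /bs inord_val => /eqP; rewrite fmorph_eq0.
  by rewrite (negbTE bm).
move=> h e; pose E1 : vec K := (1, 0, 0); pose E2 : vec K := (0, 1, 0); pose E3 : vec K := (0, 0, 1).
have [p1 p2 p3 p4 p5] : [/\ bil G (vmap E1) (vmap E1) = qa G, bil G (vmap E1) (vmap E2) = qb G,
   bil G (vmap E1) (vmap E3) = qc G, bil G (vmap E2) (vmap E2) = qd G &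
   bil G (vmap E2) (vmap E3) = qe G /\ bil G (vmap E3) (vmap E3) = qff G].
  by split; [..|split]; rewrite /bil /vmap /= !rmorph0 !rmorph1; ring.
have [b1 b2 b3 b4 [b5 b6]] : [/\ bil B E1 E1 = qa B, bil B E1 E2 = qb B,
   bil B E1 E3 = qc B, bil B E2 E2 = qd B & bil B E2 E3 = qe B /\ bil B E3 E3 = qff B].
  by split; [..|split]; rewrite /bil /=; ring.
rewrite /pull -[RHS]/(Qf (qa B) (qb B) (qc B) (qd B) (qe B) (qff B)) -b1 -b2 -b3 -b4 -b5 -b6.
congr Qf.
- by apply: (bE _ _ (E1, E1)); rewrite /= p1; exact: (congr1 (@qa _) e).
- by apply: (bE _ _ (E1, E2)); rewrite /= p2; exact: (congr1 (@qb _) e).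
- by apply: (bE _ _ (E1, E3)); rewrite /= p3; exact: (congr1 (@qc _) e).
- by apply: (bE _ _ (E2, E2)); rewrite /= p4; exact: (congr1 (@qd _) e).
- by apply: (bE _ _ (E2, E3)); case: p5 => /= -> _; exact: (congr1 (@qe _) e).
- by apply: (bE _ _ (E3, E3)); case: p5 => /= _ ->; exact: (congr1 (@qff _) e).
Qed.

End TernaryScalars.

(** * Ternary forms bounded below on integral vectors *)

Section Ternary.
Context (k : fieldType) (w : k -> int) (hw : dvaluation w).
Context (hcomp : complete_val w) (q : nat) (res : seq k)
  (hres : residue_system w q res).
Context (h2 : 2%:R != 0 :> k) (w2 : w 2%:R = 0) (p : nat) (hp : p \in [pchar k]).
Context (O : k -> Prop) (O1 : O 1) (OB : forall a b, O a -> O b -> O (a - b))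
  (OM : forall a b, O a -> O b -> O (a * b)).
Context (rO : int) (Odisc : forall a, O a -> vge w rO a -> a = 0).
Context (th : k) (Oth : O th) (th0 : th != 0) (wth : w th < 0).
Context (K : fieldType) (iota : {rmorphism K -> k}) (OK : forall a, O a -> exists x, a = iota x).
Context (R : int) (cover : forall x, exists2 a, O a & vge w R (x - a)).

Let O3 (x : vec k) := [/\ O x.1.1, O x.1.2 & O x.2].

(** The lattice is the preimage of [O^3] under [F]: cocompactness of [O] bounds its index, and its
    determinants are those of [O^3] divided by [ldet F]. *)
Lemma lattice_pullback (G : qf k) (E : int) (F : lin k) c : ldet F != 0 -> c != 0 ->
  pull G F = qscal c Q0 -> (forall x, O3 x -> x <> 0 -> ~~ vge w (E + 1) (ev G x)) ->
  exists M, lattice w O (ldet F)^-1 (E - w c) M (fun x => O3 (app F x)).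
Proof.
move=> F0 c0 eF gG; set r := disc_radius (E - w c).
have O0 : O 0 by rewrite -(subrr 1); apply: OB.
have OD a b : O a -> O b -> O (a + b).
  by move=> Oa Ob; rewrite -(opprK b) -(sub0r b); apply: OB => //; apply: OB.
have [C hC] := bvec_app hw w2 wth (linv F).
have [T [T3 [_ _ _ _ cov]]] := ball_reps3 hw hres R `|(r - C - R)%R|%N.
exists (size T3); split.
- by rewrite app0; split.
- by move=> x y [? ? ?] [? ? ?]; rewrite appB subvE; split; apply: OB.
- by move=> a x Oa [? ? ?]; rewrite app_scal; split; apply: OM.
- move=> x Ox x0; have fx0 : app F x <> 0.
    by move=> e; apply: x0; rewrite -(linvK F0 x) e app0.
  have := gG _ Ox fx0; rewrite -ev_pull eF /ev bil_qscal; apply: contra.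
  rewrite vgeMl // => h; apply: (vge_le _ h).
  by clear; lia.
- move=> x y z [x1 x2 x3] [y1 y2 y3] [z1 z2 z3].
  exists (ldet F * det3 x y z); last by rewrite mulKf.
  rewrite -det3_app /det3.
  have OBM a b c' d : O a -> O b -> O c' -> O d -> O (a * b - c' * d).
    by move=> *; apply: OB; apply: OM.
  by apply: OD; [apply: OB|]; apply: OM => //; apply: OBM.
- move=> f.
  have step i : exists ad : vec k * vec k, [/\ O3 ad.1, ad.2 \in T3 &
      bvec w (r - C) (app F (f i) - ad.1 - ad.2)].
    have [a1 Oa1 h1] := cover (app F (f i)).1.1; have [a2 Oa2 h3] := cover (app F (f i)).1.2.
    have [a3 Oa3 h4] := cover (app F (f i)).2.
    have [|t Tt bt] := cov (app F (f i) - (a1, a2, a3)).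
      by rewrite subvE; apply/and3P.
    exists ((a1, a2, a3), t); split=> //=; apply: (bvec_le _ bt).
    by clear; lia.
  have [ad had] := choice step.
  have [|||i [j [_ _ ij e]]] := @pigeonhole _ _ (fun i => (ad i).2) (enum 'I_(size T3).+1) T3.
  - exact: enum_uniq.
  - by move=> i _; case: (had i).
  - by rewrite size_enum_ord.
  exists i, j; split; first exact/eqP.
  have [[x1 x2 x3] _ bi] := had i; have [[y1 y2 y3] _ bj] := had j.
  exists (app (linv F) ((ad i).1 - (ad j).1)).
    by rewrite linvKr // subvE; split; apply: OB.
  have := hC _ _ (bvecB hw bi bj); rewrite subrK.
  congr bvec; rewrite -{2}(linvK F0 (f i)) -{2}(linvK F0 (f j)) -!appB; congr app.
  rewrite e !subvE /=; apply: vecP => /=; ring.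
Qed.

(** Conjugated by [F], a rational isometry of [Q0] becomes a matrix over [K] preserving [G], hence
    also [B]. So [rational_form] applies to [B] and makes it a multiple of [G]. *)
Theorem ternary_form (G : qf k) (E : int) : qdet G != 0 ->
  (exists2 x, x <> 0 & ev G x = 0) ->
  (forall x, O3 x -> x <> 0 -> ~~ vge w (E + 1) (ev G x)) ->
  exists c (B : qf K), G = qscal c (qmap iota B).
Proof.
move=> dG iso gG; have [F F0 eF] := isotropic_normal_form h2 dG iso.
set c := (qdet G)^-1 in eF; have c0 : c != 0 by rewrite invr_eq0.
have [M hL] := lattice_pullback F0 c0 eF gG.
have [B Bn hB] := qf_functional iota dG.
have kap0 : (ldet F)^-1 != 0 by rewrite invr_eq0.
have O0 : O 0 by rewrite -(subrr 1); apply: OB.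
have [|c' e'] := rational_form hw hcomp hres h2 w2 O1 OB OM Odisc Oth th0 wth kap0 hp
  (q' := pull (qmap iota B) F) hL.
  move=> g dg eg rg; pose g' := lcomp (lcomp F g) (linv F).
  have eg' : pull G g' = G.
    rewrite /g' -!pull_comp eF pull_qscal eg -eF pull_comp comp_linv // pull_id.
    by [].
  have rat (e : vec k) : O3 e -> exists x, app g' e = vmap iota x.
    move=> Oe; have [|a [Oa a0]] := rg (app (linv F) e); first by rewrite linvKr.
    rewrite app_scal -!app_comp -/g' => -[h1 h3 h4].
    have [ak eak] := OK Oa.
    have [x1 e1] := OK h1; have [x2 e2] := OK h3; have [x3 e3] := OK h4.
    exists (x1 / ak, x2 / ak, x3 / ak).
    move: (app g' e) e1 e2 e3 => u e1 e2 e3.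
    apply: vecP; rewrite /= fmorph_div /= -eak.
    - by rewrite -e1 /= [a * _]mulrC mulfK.
    - by rewrite -e2 /= [a * _]mulrC mulfK.
    - by rewrite -e3 /= [a * _]mulrC mulfK.
  have [x1 e1] := rat (1, 0, 0) (And3 O1 O0 O0).
  have [x2 e2] := rat (0, 1, 0) (And3 O0 O1 O0).
  have [x3 e3] := rat (0, 0, 1) (And3 O0 O0 O1).
  have eg'' : g' = lmap iota (x1, x2, x3).
    by rewrite /lmap /= -e1 -e2 -e3 -[g' in LHS]lcomp1.
  have iB : pull (qmap iota B) g' = qmap iota B.
    by rewrite eg'' pull_map hB // -eg''.
  by rewrite -[in RHS]iB /g' !pull_comp lcompA comp_linvl // lcomp1.
have eB : qmap iota B = qscal (c' / c) G.
  have h : pull (qmap iota B) F = pull (qscal (c' / c) G) F.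
    by rewrite e' pull_qscal eF qscalA divfK // /qscal /=; congr Qf; ring.
  by have := congr1 (fun X => pull X (linv F)) h; rewrite !pull_comp comp_linv // !pull_id.
have c'0 : c' != 0.
  by apply/eqP => z; apply: Bn; rewrite eB z mul0r qscalA mul0r.
exists (c / c'), B; rewrite eB qscalA -[LHS]qscal1; congr qscal.
by field; rewrite c0 c'0.
Qed.

End Ternary.

(** * Function fields *)

Lemma prime_field_embedding (K : fieldType) p (hp : p \in [pchar K]) :
  exists fp : {rmorphism 'F_p -> K}, True.
Proof.
by exists (GRing.in_alg (pPrimeCharType hp) : {rmorphism 'F_p -> pPrimeCharType hp}).
Qed.

Section FunctionField.
Context (K : fieldType) (p : nat) (hp : p \in [pchar K]) (fp : {rmorphism 'F_p -> K}).

Definition pev (x : K) (P : {poly 'F_p}) : K := (map_poly fp P).[x].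

Lemma pev0 x : pev x 0 = 0.
Proof. by rewrite /pev rmorph0 horner0. Qed.

Lemma pev1 x : pev x 1 = 1.
Proof. by rewrite /pev rmorph1 hornerC. Qed.

Lemma pevD x P Q : pev x (P + Q) = pev x P + pev x Q.
Proof. by rewrite /pev rmorphD hornerD. Qed.

Lemma pevB x P Q : pev x (P - Q) = pev x P - pev x Q.
Proof. by rewrite /pev rmorphB /= hornerD hornerN. Qed.

Lemma pevM x P Q : pev x (P * Q) = pev x P * pev x Q.
Proof. by rewrite /pev rmorphM hornerM. Qed.

Lemma pevX x : pev x 'X = x.
Proof. by rewrite /pev map_polyX hornerX. Qed.

Lemma pevC x a : pev x a%:P = fp a.
Proof. by rewrite /pev map_polyC hornerC. Qed.

Lemma pev_exp x P n : pev x (P ^+ n) = pev x P ^+ n.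
Proof. by elim: n => [|n IH]; rewrite ?pev1 // !exprS pevM IH. Qed.

Lemma pev_sum x (I : Type) (r : seq I) (Q : pred I) (F : I -> {poly 'F_p}) :
  pev x (\sum_(i <- r | Q i) F i) = \sum_(i <- r | Q i) pev x (F i).
Proof. by apply: (big_morph _ (pevD x)); apply: pev0. Qed.

Lemma pev_poly x n (a : nat -> 'F_p) :
  pev x (\poly_(l < n) a l) = \sum_(l < n) fp (a l) * x ^+ l.
Proof.
rewrite /pev poly_def rmorph_sum /= horner_sum; apply: eq_bigr => l _.
by rewrite map_polyZ hornerZ map_polyXn hornerXn.
Qed.

Lemma pevE x (P : {poly 'F_p}) n : (size P <= n)%N -> pev x P = \sum_(l < n) fp P`_l * x ^+ l.
Proof.
move=> sP; rewrite -pev_poly; congr pev; apply/polyP => i; rewrite coef_poly.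
by case: ltnP => // h; rewrite nth_default // (leq_trans sP).
Qed.

Lemma prime_coeff_polyP P : prime_coeff_poly P -> exists P' : {poly 'F_p}, P = map_poly fp P'.
Proof.
move=> hP; have [a ha] := choice hP.
exists (\poly_(i < size P) (a i)%:R); apply/polyP => i.
rewrite coef_map coef_poly /=; case: ltnP => h; first by rewrite rmorph_nat ha.
by rewrite rmorph0 nth_default.
Qed.

Lemma vge_fp (w : K -> int) (hw : dvaluation w) a : vge w 0 (fp a).
Proof. by rewrite -(natr_Zp a) rmorph_nat; apply: (vge_nat hw). Qed.

Lemma vge_pev (w : K -> int) (hw : dvaluation w) x P : vge w 0 x -> vge w 0 (pev x P).
Proof.
move=> hx; rewrite (pevE x (leqnn _)); apply: (vge_sum hw) => i _.
rewrite -(addr0 0); apply: (vgeM hw); first exact: vge_fp.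
by have := vgeX hw i hx; rewrite mul0rn.
Qed.

Definition indep (T : K) r (e : 'I_r -> K) := forall c : 'I_r -> {poly 'F_p},
  \sum_i pev T (c i) * e i = 0 -> forall i, c i = 0.

Lemma pcharfp : prime p. Proof. exact: pcharf_prime hp. Qed.

Lemma card_fp (J : finType) : #|{ffun J -> 'F_p}| = (p ^ #|J|)%N.
Proof. by rewrite card_ffun card_Fp ?pcharfp. Qed.

(* Multiplying by a common denominator embeds the [T]-combinations of degree [< n]
   into [t]-polynomials of degree [O(n)]; compare cardinalities as [n] grows. *)
Lemma indep_bounded (t : K) (b : seq K) (f g : {poly 'F_p}) (T : K) :
  (forall P, pev t P = 0 -> P = 0) ->
  (forall x, exists D (c : nat -> {poly 'F_p}), D != 0 /\
     x * pev t D = \sum_(j < size b) pev t (c j) * b`_j) ->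
  g != 0 -> T * pev t g = pev t f ->
  exists m, forall r (e : 'I_r -> K), indep T e -> (r <= m)%N.
Proof.
move=> ht hb g0 eT; set B := size b; pose d := (size f + size g)%N.
exists (B * d)%N => r e ie.
have [D hD] := choice (fun i => hb (e i)); have [c hc] := choice hD.
have g0t P : P != 0 -> pev t P != 0 by move=> P0; apply: contra_neq P0; apply: ht.
pose D' i := \prod_(i' < r | i' != i) D i'; pose DD := \prod_(i < r) D i.
pose c' i j := c i j * D' i.
have DD0 : DD != 0 by apply/prodf_neq0 => i _; case: (hc i).
have hc' i : e i * pev t DD = \sum_(j < B) pev t (c' i j) * b`_j.
  have [_ h] := hc i; rewrite /DD (bigD1 i) //= -/(D' i) pevM mulrA h mulr_suml.
  by apply: eq_bigr => j _; rewrite /c' pevM mulrAC.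
pose de := (\sum_(i < r) \sum_(j < B) size (c' i j))%N.
have le_de i j : (j < B)%N -> (size (c' i j) <= de)%N.
  move=> jB; rewrite /de (bigD1 i) //= (bigD1 (Ordinal jB)) //= -addnA; exact: leq_addr.
(* Large enough that one more independent element, worth [n] coefficients, outweighs the overhead
   [B * de.+1]. *)
pose n := (B * de.+1).+1; pose N := (n * d + de.+1)%N.
pose xa (a : {ffun 'I_r * 'I_n -> 'F_p}) :=
  \sum_i pev T (\poly_(l < n) (if insub l is Some l' then a (i, l') else 0)) * e i.
have xa_inj : injective xa.
  move=> a a' eq; apply/ffunP => -[i l].
  have h0 : \sum_i pev T ((\poly_(l < n) (if insub l is Some l' then a (i, l') else 0)) -
      \poly_(l < n) (if insub l is Some l' then a' (i, l') else 0)) * e i = 0.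
    transitivity (xa a - xa a'); last by rewrite eq subrr.
    by rewrite /xa -sumrB; apply: eq_bigr => j _; rewrite pevB mulrBl.
  have /(congr1 (fun P : {poly 'F_p} => P`_l)) := ie _ h0 i.
  rewrite coefB !coef_poly ltn_ord coef0 valK /= => /eqP; rewrite subr_eq0 => /eqP.
  by [].
pose u := pev t g ^+ n * pev t DD.
have u0 : u != 0 by rewrite mulf_neq0 ?expf_neq0 ?g0t.
pose V (A : {ffun 'I_B * 'I_N -> 'F_p}) :=
  \sum_(j < B) pev t (\poly_(l < N) (if insub l is Some l' then A (j, l') else 0)) * b`_j.
have inV a : exists A, xa a * u = V A.
  pose Pj (j : nat) : {poly 'F_p} := \sum_(i < r) \sum_(l < n)
    (a (i, l))%:P * f ^+ l * g ^+ (n - l) * c' i j.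
  have szP j : (j < B)%N -> (size (Pj j) <= N)%N.
    move=> jB; apply: (leq_trans (size_sum _ _ _)); apply/bigmax_leqP => i _.
    apply: (leq_trans (size_sum _ _ _)); apply/bigmax_leqP => l _.
    have s1 := size_polyMleq ((a (i, l))%:P * f ^+ l * g ^+ (n - l)) (c' i j).
    have s2 := size_polyMleq ((a (i, l))%:P * f ^+ l) (g ^+ (n - l)).
    have s3 := size_polyMleq (a (i, l))%:P (f ^+ l).
    have s4 := size_poly_exp_leq f l; have s5 := size_poly_exp_leq g (n - l).
    have s6 := le_de i j jB; have s7 := size_polyC_leq1 (a (i, l)).
    have s8 : ((size f).-1 * l <= size f * l)%N by rewrite leq_mul2r leq_pred orbT.
    have s9 : ((size g).-1 * (n - l) <= size g * (n - l))%N by rewrite leq_mul2r leq_pred orbT.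
    have s10 : (size f * l + size g * (n - l) <= n * d)%N.
      have ln : (l <= n)%N by apply: ltnW.
      rewrite /d mulnDr; apply: leq_add; rewrite mulnC leq_mul2r ?ln ?leq_subr orbT //.
    rewrite /N; move: s1 s2 s3 s4 s5 s6 s7 s8 s9 s10; clear.
    move: (n - l)%N (n * d)%N => nl nd.
    move: (size ((a (i, l))%:P * f ^+ l * g ^+ nl * c' i j)) (size ((a (i, l))%:P * f ^+ l * g ^+ nl)).
    move: (size ((a (i, l))%:P * f ^+ l)) (size (a (i, l))%:P) (size (c' i j)).
    move: (size (f ^+ l)) (size (g ^+ nl)) => *; lia.
  exists [ffun jl : 'I_B * 'I_N => (Pj jl.1)`_jl.2]; rewrite /V.
  transitivity (\sum_(j < B) pev t (Pj j) * b`_j); last first.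
    apply: eq_bigr => j _; congr (pev t _ * _); apply/polyP => l; rewrite coef_poly.
    case: ltnP => h; last by rewrite nth_default // (leq_trans (szP _ (ltn_ord j))).
    by rewrite insubT /= ffunE.
  rewrite /xa mulr_suml.
  transitivity (\sum_(i < r) \sum_(j < B) pev t (\sum_(l < n)
      (a (i, l))%:P * f ^+ l * g ^+ (n - l) * c' i j) * b`_j).
    apply: eq_bigr => i _; rewrite /u mulrACA hc' mulr_sumr; apply: eq_bigr => j _.
    rewrite mulrA; congr (_ * _); rewrite pev_poly mulr_suml mulr_suml pev_sum.
    apply: eq_bigr => l _; rewrite valK !pevM pevC !pev_exp; congr (_ * _).
    have -> : pev t g ^+ n = pev t g ^+ l * pev t g ^+ (n - l).
      by rewrite -exprD subnKC // ltnW.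
    by rewrite -eT exprMn !mulrA.
  rewrite exchange_big /=; apply: eq_bigr => j _.
  by rewrite -mulr_suml -pev_sum.
have [A hA] := choice inV.
have A_inj : injective A.
  by move=> a a' eq; apply: xa_inj; apply: (mulIf u0); rewrite !hA eq.
have := leq_card _ A_inj; rewrite !card_fp !card_prod !card_ord.
rewrite leq_exp2l ?prime_gt1 ?pcharfp // /N => le.
rewrite leqNgt; apply/negP => lt.
have : (r * n <= B * d * n + B * de.+1)%N by rewrite -mulnA (mulnC d) -mulnDr.
have : ((B * d).+1 * n <= r * n)%N by rewrite leq_mul2r lt orbT.
rewrite /n mulSn; clear; lia.
Qed.

(** * Residues at the poles of an element *)

Section Poles.
Context (T : K) (m : nat) (hm : forall r (e : 'I_r -> K), indep T e -> (r <= m)%N).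

(** The powers of [x] up to [m] are dependent over [F_p[T]]; multiplying by the leading coefficient
    [a] of a relation makes [x] integral. *)
Lemma integral_multiple x : exists a, a != 0 /\
  forall w, dvaluation w -> vge w 0 T -> vge w 0 (pev T a * x).
Proof.
have : ~ indep T (fun i : 'I_m.+1 => x ^+ i) by move=> /hm; rewrite ltnn.
move=> /existsNP[c /not_implyP[e /existsNP[i0 /eqP ci0]]].
have [J cJ Jmax] : exists2 J : 'I_m.+1, c J != 0 & forall i, c i != 0 -> (i <= J)%N.
  by case: (@arg_maxnP _ i0 (fun i => c i != 0) (fun i : 'I_m.+1 => i : nat) ci0) => J cJ h; exists J.
exists (c J); split=> // w hw wT; set a := pev T (c J); set y := a * x.
have wa i : vge w 0 (pev T (c i)) by apply: (vge_pev hw).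
apply/negPn/negP => hy.
have y0 : y != 0 by apply: contraNneq hy => ->; rewrite vge0.
have wy : w y < 0 by move: hy; rewrite vgeE // -ltNge.
have a0 : a != 0 by apply: contraNneq y0; rewrite /y => ->; rewrite mul0r.
have e2 : \sum_(i < m.+1) pev T (c i) * a ^+ J * x ^+ i = 0.
  by apply: (etrans _ (etrans (congr1 ( *%R (a ^+ J)) e) (mulr0 _))); rewrite mulr_sumr;
    apply: eq_bigr => i _; rewrite mulrA [a ^+ J * _]mulrC.
have ey : a * y ^+ J = - \sum_(i < m.+1 | i != J) pev T (c i) * a ^+ J * x ^+ i.
  apply/eqP; rewrite -addr_eq0; move: e2; rewrite (bigD1 J) //= => e2.
  by apply/eqP; rewrite -[RHS]e2; congr (_ + _); rewrite /y exprMn mulrA.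
(* At a pole of [a x] the leading term would strictly dominate all others. *)
have : vge w (w a + w y *+ J + 1) (a * y ^+ J).
  rewrite ey (vgeN hw); apply: (vge_sum hw) => i iJ.
  have [ci|ci] := eqVneq (c i) 0; first by rewrite ci pev0 !mul0r vge0.
  have ltJ : (i < J)%N by rewrite ltn_neqAle iJ Jmax.
  have -> : pev T (c i) * a ^+ J * x ^+ i = pev T (c i) * (a ^+ (J - i).-1 * (a * y ^+ i)).
    rewrite -mulrA; congr (_ * _); rewrite /y exprMn !mulrA -exprSr prednK ?subn_gt0 //.
    by rewrite -exprD subnK // ltnW.
  rewrite -[X in vge w X]add0r; apply: (vgeM hw) => //.
  rewrite -[X in vge w X]add0r; apply: (vgeM hw).
    by have := vgeX hw (J - i).-1 (wa J); rewrite mul0rn.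
  rewrite vgeE ?mulf_neq0 ?expf_neq0 // (val_mul hw) ?expf_neq0 // (val_exp hw) // -addrA lerD2l.
  have -> : (w y *+ J = w y *+ i + w y *+ (J - i))%R by rewrite -mulrnDr subnKC // ltnW.
  rewrite -addrA gerDl -(subnSK ltJ) mulrS -addrA (addrC _ 1) addrA.
  have h : w y + 1 <= 0 by move: wy; clear; lia.
  have h' : w y *+ (J - i.+1) <= 0 by rewrite mulrn_wle0 // ltW.
  by rewrite (le_trans (lerD h h')) // addr0.
rewrite vgeE ?mulf_neq0 ?expf_neq0 // (val_mul hw) ?expf_neq0 // (val_exp hw) //.
by clear; lia.
Qed.

Lemma integral_family r (e : 'I_r -> K) : indep T e ->
  exists2 e' : 'I_r -> K, indep T e' &
    forall w, dvaluation w -> vge w 0 T -> forall i, vge w 0 (e' i).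
Proof.
move=> ie; have [a ha] := choice (fun i => integral_multiple (e i)).
exists (fun i => pev T (a i) * e i); last by move=> w hw wT i; case: (ha i) => _; apply.
move=> c h i; have h' : \sum_i pev T (c i * a i) * e i = 0.
  by rewrite -[RHS]h; apply: eq_bigr => j _; rewrite pevM mulrA.
have /eqP := ie _ h' i; rewrite mulf_eq0 => /orP[/eqP //|].
by case: (ha i) => /negbTE ->.
Qed.

Context (W : (K -> int) -> Prop) (hW : forall w, W w -> dvaluation w /\ (T != 0 /\ w T < 0)).

(** Independence over [F_p] in the ring of elements integral at [W], modulo the ideal generated by
    [T^-1]. *)
Definition indep_mod r (a : 'I_r -> K) := (forall i w, W w -> vge w 0 (a i)) /\
  forall c : 'I_r -> 'F_p, (forall w, W w -> vge w (- w T) (\sum_i fp (c i) * a i)) ->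
    forall i, c i = 0.

(** Dividing a relation over [F_p[T]] by the top power of [T] leaves only leading coefficients
    modulo [T^-1]. Thus the residue ring has dimension at most [m]. *)
Lemma indep_mod_indep r (a : 'I_r -> K) : (exists w, W w) -> indep_mod a -> indep T a.
Proof.
move=> [w0 Ww0] [aO ia] c e; have [_ [T0 _]] := hW Ww0.
apply: contrapT => /existsNP[i0 /eqP ci0].
pose d := (\max_(i < r) size (c i))%N.
have d_ge i : (size (c i) <= d)%N by apply: (leq_bigmax i).
have d0 : (0 < d)%N by apply: leq_trans (d_ge i0); rewrite size_poly_gt0.
have e2 : \sum_i pev T (c i) * a i * T ^- d.-1 = 0 by rewrite -mulr_suml e mul0r.
have split i : pev T (c i) * a i * T ^- d.-1 =
    fp (c i)`_d.-1 * a i + \sum_(l < d.-1) fp (c i)`_l * (T ^+ l * T ^- d.-1 * a i).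
  have sz : (size (c i) <= d.-1.+1)%N by rewrite prednK.
  rewrite (pevE T sz) big_ord_recr /= mulrDl mulrDl addrC; congr (_ + _).
    by rewrite mulrAC mulfK ?expf_neq0.
  by rewrite !mulr_suml; apply: eq_bigr => l _; ring.
have h i : (c i)`_d.-1 = 0.
  apply: (ia (fun i => (c i)`_d.-1)) => w Ww.
  have [hw [_ wT]] := hW Ww.
  have -> : \sum_i fp (c i)`_d.-1 * a i =
      - \sum_i \sum_(l < d.-1) fp (c i)`_l * (T ^+ l * T ^- d.-1 * a i).
    by apply/eqP; rewrite -addr_eq0 -big_split /= -[X in _ == X]e2; apply/eqP;
      apply: eq_bigr => j _; rewrite split.
  rewrite (vgeN hw); apply: (vge_sum hw) => j _; apply: (vge_sum hw) => l _.
  rewrite -[X in vge w X]add0r; apply: (vgeM hw); first exact: vge_fp.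
  rewrite -[X in vge w X]addr0; apply: (vgeM hw); last exact: aO.
  rewrite vgeE ?mulf_neq0 ?invr_eq0 ?expf_neq0 // (val_mul hw) ?invr_eq0 ?expf_neq0 //.
  rewrite (val_inv hw) ?expf_neq0 // !(val_exp hw) //.
  have gen (l' D : nat) (z : int) : (l' < D)%N -> z < 0 -> - z <= z *+ l' - z *+ D.
    move=> lD z0; have -> : z *+ D = z *+ l' + z + z *+ (D - l'.+1).
      by rewrite -mulrSr -mulrnDr subnKC.
    have h : z *+ (D - l'.+1) <= 0 by rewrite mulrn_wle0 // ltW.
    by move: (z *+ l') (z *+ (D - l'.+1)) h; clear; lia.
  exact: gen.
have [j ej] : exists j, size (c j) = d.
  case: (@arg_maxnP _ i0 xpredT (fun i => size (c i)) isT) => j _ jmax; exists j.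
  by apply/eqP; rewrite eqn_leq d_ge; apply/bigmax_leqP => i _; apply: jmax.
have := h j; rewrite -ej -/(lead_coef _) => /eqP; rewrite lead_coef_eq0 -size_poly_eq0 ej.
by rewrite -leqn0 leqNgt d0.
Qed.

Lemma residue_reps : (exists w, W w) -> exists2 s : seq K, (size s <= p ^ m)%N &
  forall x, (forall w, W w -> vge w 0 x) ->
    exists2 y, y \in s & forall w, W w -> vge w (- w T) (x - y).
Proof.
move=> exW; pose P r := `[< exists a : 'I_r -> K, indep_mod a >].
have exP : exists r, P r.
  by exists 0%N; apply/asboolP; exists (fun=> 0); split=> [[]|c _ []].
have ubP r : P r -> (r <= m)%N by move=> /asboolP[a /(indep_mod_indep exW)/hm].
case: (ex_maxnP exP ubP) => r Pr rmax; have rm := ubP _ Pr.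
case/asboolP: Pr => a [aO ia].
exists [seq \sum_i fp (c i) * a i | c : {ffun 'I_r -> 'F_p}].
  rewrite size_map -cardE card_fp card_ord leq_exp2l //; apply: prime_gt1; exact: pcharfp.
move=> x xO.
have /not_andP[hn|] : ~ indep_mod (fun i : 'I_r.+1 => if unlift ord0 i is Some j then a j else x).
- move=> h; have /rmax : P r.+1 by apply/asboolP; exists (fun i => if unlift ord0 i is Some j then a j else x).
  by rewrite ltnn.
- by case: hn => i w Ww; case: unliftP => [j _|_]; [exact: aO|exact: xO].
move=> /existsNP[c /not_implyP[hc /existsNP[i0 /eqP ci0]]].
have sumE : \sum_i fp (c i) * (if unlift ord0 i is Some j then a j else x) =
    fp (c ord0) * x + \sum_j fp (c (lift ord0 j)) * a j.
  rewrite big_ord_recl unlift_none; congr (_ + _); apply: eq_bigr => j _; by rewrite liftK.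
have c0 : c ord0 != 0.
  apply/eqP => c0; case/eqP: ci0; case: (unliftP ord0 i0) => [j ->|-> //].
  apply: (ia (fun j => c (lift ord0 j))) => w Ww.
  by have := hc w Ww; rewrite sumE c0 rmorph0 mul0r add0r.
pose c' := [ffun j => - (c ord0)^-1 * c (lift ord0 j)].
exists (\sum_i fp (c' i) * a i); first by apply/mapP; exists c'; rewrite // mem_enum.
move=> w Ww; have [hw _] := hW Ww.
have -> : x - \sum_i fp (c' i) * a i = fp (c ord0)^-1 * (\sum_i fp (c i) *
    (if unlift ord0 i is Some j then a j else x)).
  rewrite sumE mulrDr mulrA -rmorphM mulVf // rmorph1 mul1r; congr (_ + _).
  rewrite mulr_sumr -sumrN; apply: eq_bigr => j _.
  by rewrite ffunE mulNr rmorphN rmorphM mulNr opprK mulrA.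
rewrite -[X in vge w X]add0r; apply: (vgeM hw); [exact: vge_fp|exact: hc].
Qed.

(** One power of [T] is peeled off at a time, with at most [p ^ m] choices each. *)
Lemma pole_reps n : (exists w, W w) -> exists2 s : seq K, (size s <= p ^ (m * n))%N &
  forall x, (forall w, W w -> vge w (w T *+ n) x) ->
    exists2 y, y \in s & forall w, W w -> vge w 0 (x - y).
Proof.
move=> exW; have [s1 sz1 h1] := residue_reps exW.
elim: n => [|n [s sz hs]].
  exists [:: 0]; first by rewrite muln0.
  by move=> x hx; exists 0; rewrite ?mem_head // => w /hx; rewrite mulr0n subr0.
exists [seq T ^+ n.+1 * u + y | u <- s1, y <- s].
  by rewrite size_allpairs mulnS expnD leq_mul.
move=> x hx; have [w0 Ww0] := exW; have [_ [T0 _]] := hW Ww0.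
have [|u us hu] := h1 (x / T ^+ n.+1).
  move=> w Ww; have [hw _] := hW Ww; rewrite (vgeMr hw) ?invr_eq0 ?expf_neq0 //.
  rewrite (val_inv hw) ?expf_neq0 // (val_exp hw) // add0r opprK; exact: hx.
have [|y ys hy] := hs (x - T ^+ n.+1 * u).
  move=> w Ww; have [hw _] := hW Ww.
  have -> : x - T ^+ n.+1 * u = T ^+ n.+1 * (x / T ^+ n.+1 - u).
    by rewrite mulrBr mulrCA divff ?expf_neq0 // mulr1.
  rewrite (vgeMl hw) ?expf_neq0 // (val_exp hw) // mulrS opprD addrCA subrr addr0.
  exact: hu.
exists (T ^+ n.+1 * u + y); first by apply/allpairsP; exists (u, y).
by move=> w /hy; rewrite opprD addrA.
Qed.

End Poles.

End FunctionField.

(** * Weak approximation *)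

Section WeakApproximation.
Context (K : fieldType).

Definition vdiff (w w' : K -> int) := exists y, y != 0 /\ w y != w' y.

Lemma vdiff_sym w w' : vdiff w w' -> vdiff w' w.
Proof. by move=> [y [y0 h]]; exists y; split=> //; rewrite eq_sym. Qed.

(** If integrality at [w] implied integrality at [w'], units would go to units and [w'] would be a
    multiple of [w]; as both are onto the integers, they would agree. *)
Lemma vdiff_sep w w' : dvaluation w -> dvaluation w' -> vdiff w w' ->
  exists2 x, x != 0 & 0 <= w x /\ w' x < 0.
Proof.
move=> hw hw' [y [y0 ne]]; apply: contrapT => hn.
have h x : x != 0 -> 0 <= w x -> 0 <= w' x.
  by move=> x0 wx; rewrite leNgt; apply/negP => lt; apply: hn; exists x.
have [pi pi0 wpi] := val_ex hw 1.
have unit u : u != 0 -> w u = 0 -> w' u = 0.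
  move=> u0 wu; have h1 := h u u0; have h3 := h u^-1; rewrite invr_eq0 u0 in h3.
  rewrite (val_inv hw) // (val_inv hw') // in h3.
  rewrite wu in h1; rewrite wu oppr0 in h3.
  by move: (h1 (lexx _)) (h3 isT (lexx _)); clear; lia.
have prop x : x != 0 -> w' x = w x * w' pi.
  move=> x0; case e : (w x) => [n|n].
    have := unit (x / pi ^+ n); rewrite mulf_neq0 ?invr_eq0 ?expf_neq0 //.
    rewrite (val_mul hw) ?(val_mul hw') ?invr_eq0 ?expf_neq0 // (val_inv hw) ?(val_inv hw') ?expf_neq0 //.
    rewrite (val_exp hw) // (val_exp hw') // wpi e => /(_ isT); rewrite -mulr_natl mulr1 natz subrr.
    by move=> /(_ erefl) /eqP; rewrite subr_eq0 => /eqP ->; rewrite -mulr_natl natz.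
  have := unit (x * pi ^+ n.+1); rewrite mulf_neq0 ?expf_neq0 //.
  rewrite (val_mul hw) ?(val_mul hw') ?expf_neq0 // (val_exp hw) // (val_exp hw') // wpi e.
  rewrite -mulr_natl mulr1 natz => /(_ isT); have -> : Negz n + n.+1%:Z = 0 by clear; lia.
  move=> /(_ erefl) /eqP; rewrite addr_eq0 => /eqP ->; rewrite -mulr_natl natz NegzE.
  by clear; lia.
have [x x0 wx] := val_ex hw' 1; have := prop _ x0; rewrite wx => e1.
have wp : 0 <= w' pi by apply: h; rewrite ?wpi.
have e2 : w' pi = 1.
  move: (w x) (w' pi) e1 wp => a b; clear => e1 wp.
  have [ha|ha] : a <= 0 \/ 1 <= a by lia.
    by nia.
  by nia.
by case/eqP: ne; rewrite prop // e2 mulr1.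
Qed.

Lemma vdiff_opp w w' : dvaluation w -> dvaluation w' -> vdiff w w' ->
  exists2 z, z != 0 & w z < 0 /\ 0 < w' z.
Proof.
move=> hw hw' d; have [x x0 [h1 h3]] := vdiff_sep hw hw' d.
have [y y0 [h4 h5]] := vdiff_sep hw' hw (vdiff_sym d).
exists (y / x); first by rewrite mulf_neq0 ?invr_eq0.
rewrite (val_mul hw) ?(val_mul hw') ?invr_eq0 // (val_inv hw) // (val_inv hw') //.
by move: h1 h3 h4 h5; clear; lia.
Qed.

Lemma val_frac_pole (w : K -> int) z r : dvaluation w -> z != 0 -> w z < 0 -> (0 < r)%N ->
  1 + z ^+ r != 0 /\ w (1 + z ^+ r) = w z *+ r.
Proof.
move=> hw z0 wz r0; rewrite -(val_exp hw) //; apply: (val_dom hw); first exact: expf_neq0.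
rewrite addrK vgeE ?oner_neq0 // (val_one hw) (val_exp hw) //.
case: r r0 => // r _; rewrite mulrS; have h : w z *+ r <= 0 by rewrite mulrn_wle0 // ltW.
by move: (w z *+ r) h wz; clear; lia.
Qed.

Lemma val_frac_zero (w : K -> int) z r : dvaluation w -> z != 0 -> 0 < w z -> (0 < r)%N ->
  1 + z ^+ r != 0 /\ w (1 + z ^+ r) = 0.
Proof.
move=> hw z0 wz r0; rewrite -(val_one hw); apply: (val_dom hw); first exact: oner_neq0.
rewrite (val_one hw) add0r addrAC subrr add0r vgeE ?expf_neq0 // (val_exp hw) //.
case: r r0 => // r _; rewrite mulrS; have h : 0 <= w z *+ r by rewrite mulrn_wge0 // ltW.
by move: (w z *+ r) h wz; clear; lia.
Qed.

Section Approx.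
Context (v : K -> int) (hv : dvaluation v) (ws : nat -> K -> int) (P : pred nat) (s : nat).
Context (hws : forall j, (j < s)%N -> P j -> dvaluation (ws j) /\ vdiff v (ws j)).

(** Induction on the places. The factor [z^r / (1 + z^r)] is near [1] where [z] has a pole and small
    where [z] vanishes, and a large [r] outweighs [y] at the earlier places. *)
Lemma approx_pole : exists2 z, z != 0 &
  v z < 0 /\ forall j, (j < s)%N -> P j -> 0 < ws j z.
Proof.
elim: s hws => [|n IH] h.
  by have [z z0 wz] := val_ex hv (-1); exists z; rewrite ?wz.
have [z z0 [vz hz]] := IH (fun j hj => h j (ltnW hj)).
have [Pn|Pn] := boolP (P n); last first.
  exists z => //; split=> // j; rewrite ltnS leq_eqVlt => /orP[/eqP ->|]; last exact: hz.
  by rewrite (negbTE Pn).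
have [hn dn] := h n (ltnSn n) Pn.
have [y y0 [vy wy]] := vdiff_opp hv hn dn.
pose r := (\sum_(j < n) `|ws j y|)%N.+1.
have r_ge j : (j < n)%N -> (`|ws j y| < r)%N.
  by move=> jn; rewrite /r ltnS (bigD1 (Ordinal jn)) //= leq_addr.
have big j : (j < n)%N -> P j -> 0 < ws j z *+ r + ws j y.
  move=> jn Pj; have := hz j jn Pj; have := r_ge j jn; rewrite -mulr_natr natz.
  by move: (ws j z) (ws j y) (r) => a b c; clear; nia.
case: (ltgtP (ws n z) 0) => wz.
- have fr j : (j < n)%N -> P j -> 1 + z ^+ r != 0 /\ ws j (1 + z ^+ r) = 0.
    by move=> jn Pj; apply: val_frac_zero => //; [case: (h j (ltnW jn) Pj)|exact: hz].
  have [u0 vu] := val_frac_pole hv z0 vz (ltn0Sn _ : (0 < r)%N).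
  have [_ nu] := val_frac_pole hn z0 wz (ltn0Sn _ : (0 < r)%N).
  exists (z ^+ r / (1 + z ^+ r) * y).
    by rewrite !mulf_neq0 ?invr_eq0 ?expf_neq0.
  have E w : dvaluation w -> w (z ^+ r / (1 + z ^+ r) * y) = w z *+ r - w (1 + z ^+ r) + w y.
    move=> hw; rewrite !(val_mul hw) ?mulf_neq0 ?invr_eq0 ?expf_neq0 // (val_inv hw) //.
    by rewrite (val_exp hw).
  split; first by rewrite E // vu subrr add0r.
  move=> j; rewrite ltnS leq_eqVlt => /orP[/eqP -> _|jn Pj].
    by rewrite E // nu subrr add0r.
  have [hj _] := h j (ltnW jn) Pj; rewrite E // (proj2 (fr j jn Pj)) subr0; exact: big.
- exists z => //; split=> // j; rewrite ltnS leq_eqVlt => /orP[/eqP -> //|]; exact: hz.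
- exists (z ^+ r * y); first by rewrite mulf_neq0 ?expf_neq0.
  have E w : dvaluation w -> w (z ^+ r * y) = w z *+ r + w y.
    by move=> hw; rewrite (val_mul hw) ?expf_neq0 // (val_exp hw).
  split.
    rewrite E //; have h' : v z *+ r <= 0 by rewrite mulrn_wle0 // ltW.
    by move: (v z *+ r) h' vy; clear; lia.
  move=> j; rewrite ltnS leq_eqVlt => /orP[/eqP -> _|jn Pj]; first by rewrite E // wz mul0rn add0r.
  by have [hj _] := h j (ltnW jn) Pj; rewrite E //; apply: big.
Qed.

Lemma approx (A : nat) : exists xi, vge v A (1 - xi) /\
  forall j, (j < s)%N -> P j -> vge (ws j) A xi.
Proof.
have [z z0 [vz hz]] := approx_pole.
have [u0 vu] := val_frac_pole hv z0 vz (ltn0Sn A).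
exists (z ^+ A.+1 / (1 + z ^+ A.+1)).
have -> : 1 - z ^+ A.+1 / (1 + z ^+ A.+1) = (1 + z ^+ A.+1)^-1.
  by rewrite -{1}(divff u0) -mulrBl addrK mul1r.
split.
  rewrite vgeE ?invr_eq0 // (val_inv hv) // vu -mulr_natr natz.
  by move: (v z) vz; clear; nia.
move=> j js Pj; have [hj _] := hws js Pj; have wz := hz j js Pj.
have [_ ju] := val_frac_zero hj z0 wz (ltn0Sn A).
rewrite vgeE ?mulf_neq0 ?invr_eq0 ?expf_neq0 // (val_mul hj) ?invr_eq0 ?expf_neq0 //.
rewrite (val_inv hj) // ju subr0 (val_exp hj) // -mulr_natr natz.
by move: (ws j z) wz; clear; nia.
Qed.

End Approx.
End WeakApproximation.

Lemma residue_cardP (K : fieldType) (v : K -> int) q : residue_card v q ->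
  exists r, residue_system v q r.
Proof.
move=> [r [sz r0 sep cov]]; exists r.
have vgeP (N : int) x : vge v N x <-> x = 0 \/ N <= v x.
  by rewrite /vge; split=> [/orP[/eqP|]|[->|->]]; rewrite ?eqxx ?orbT; [left|right|..].
have ix a b : a \in r -> b \in r -> index a r <> index b r -> ~ vge v 1 (a - b).
  move=> ar br ne; have := sep (index a r) (index b r).
  rewrite -sz !index_mem ar br !nth_index // => /(_ isT isT ne)[d0 le].
  by rewrite vgeE // => h; have := le_trans h le.
split=> //.
- apply/(uniqP 0) => i j; rewrite !inE => ir jr e; apply: contrapT => ne.
  by rewrite sz in ir jr; have [] := sep i j ir jr ne; rewrite e subrr eqxx.
- by move=> a /r0 h; apply/vgeP.
- move=> a b ar br h; apply: contrapT => ne; apply: (ix a b ar br) h => e.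
  by apply: ne; rewrite -(nth_index 0 ar) e nth_index.
- by move=> a /vgeP/cov[b br h]; exists b => //; apply/vgeP.
Qed.

Lemma finite_pole_bound (K : fieldType) (v : K -> int) (ws : nat -> K -> int) s (l : seq K) :
  exists A : nat, forall x, x \in l -> vge v (- A%:Z) x /\ forall j, (j < s)%N -> vge (ws j) (- A%:Z) x.
Proof.
exists (\sum_(x <- l) (`|v x| + \sum_(j < s) `|ws j x|))%N => x xl.
have le : (`|v x| + \sum_(j < s) `|ws j x| <= \sum_(x <- l) (`|v x| + \sum_(j < s) `|ws j x|))%N.
  by rewrite (big_rem x) //= leq_addr.
split=> [|j js]; apply/orP; right.
  by move: le; clear; lia.
have le2 : (`|ws j x| <= \sum_(j < s) `|ws j x|)%N by rewrite (bigD1 (Ordinal js)) //= leq_addr.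
by move: le le2; clear; lia.
Qed.

(** * Counting integers, and cocompactness *)

Section Cocompact.
Context (K : fieldType) (p : nat) (hp : p \in [pchar K]) (fp : {rmorphism 'F_p -> K}).
Context (T : K) (T0 : T != 0).
Context (m : nat) (hm : forall r (e : 'I_r -> K), indep fp T e -> (r <= m)%N).
Context (e0 : 'I_m -> K) (ie0 : indep fp T e0).

Definition poles s (ws : nat -> K -> int) := forall j, (j < s)%N -> dvaluation (ws j) /\ ws j T < 0.
Definition pairwise_vdiff s (ws : nat -> K -> int) :=
  forall i j, (i < s)%N -> (j < s)%N -> i != j -> vdiff (ws i) (ws j).

(** Approximate idempotents at distinct poles of [T] are independent modulo [T^-1]. *)
Lemma poles_bounded s ws : poles s ws -> pairwise_vdiff s ws -> (s <= m)%N.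
Proof.
move=> hp' hd; case: s hp' hd => // s hp' hd; set S := s.+1 in hp' hd *.
pose W w := exists2 j, (j < S)%N & w = ws j.
have hW w : W w -> dvaluation w /\ (T != 0 /\ w T < 0).
  by move=> [j js ->]; have [] := hp' j js.
have step (i : 'I_S) : exists xi, vge (ws i) 1%N (1 - xi) /\
    forall j, (j < S)%N -> j != i -> vge (ws j) 1%N xi.
  apply: (@approx K (ws i) _ ws (fun j => j != i) S _ 1%N); first by case: (hp' i (ltn_ord i)).
  by move=> j js ji; split; [case: (hp' j js)|apply: hd => //; rewrite eq_sym].
have [xi hxi] := choice step.
apply: (hm (e := xi)); apply: (indep_mod_indep hW); first by exists (ws 0%N), 0%N.
split.
  move=> i w [j js ->]; have [hw _] := hp' j js.
  have [->|ji] := eqVneq j i; last by apply: vge_le (proj2 (hxi i) j js ji).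
  have [hi _] := hp' i (ltn_ord i).
  have -> : xi i = 1 - (1 - xi i) by rewrite subKr.
  by apply: (vgeB hi); [exact: vge1|apply: vge_le (proj1 (hxi i))].
move=> c hc i; have [hi wT] := hp' i (ltn_ord i); apply/eqP/negPn/negP => ci.
have h1 : vge (ws i) 1 (\sum_j fp (c j) * xi j).
  have Wi : W (ws i) by exists (i : nat).
  by have le : 1 <= - ws i T; [move: wT; clear; lia|exact: (vge_le le (hc _ Wi))].
have f0 : fp (c i) != 0 by rewrite fmorph_eq0.
have h3 : vge (ws i) 1 (fp (c i)).
  have -> : fp (c i) = (\sum_j fp (c j) * xi j) + fp (c i) * (1 - xi i)
      - \sum_(j | j != i) fp (c j) * xi j.
    by rewrite (bigD1 i) //=; ring.
  apply: (vgeB hi); first apply: (vgeD hi) => //.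
    by rewrite -(add0r 1); apply: (vgeM hi); [exact: vge_fp|case: (hxi i)].
  apply: (vge_sum hi) => j ji; rewrite -(add0r 1); apply: (vgeM hi); first exact: vge_fp.
  by apply: (proj2 (hxi j)) => //; rewrite eq_sym.
have h4 : vge (ws i) 0 (fp (c i)^-1) by apply: vge_fp.
move: h3 h4; rewrite fmorphV; move: (fp (c i)) f0 => u u0.
by rewrite !vgeE ?invr_eq0 // (val_inv hi) //; clear; lia.
Qed.

Context (v : K -> int) (hv : dvaluation v) (vT : v T < 0).

(** By the bound [m] there is a maximal family of pairwise different poles; [~ vdiff w (ws j)] means
    agreement on nonzero elements. *)
Lemma pole_list : exists s ws, [/\ poles s ws, (forall j, (j < s)%N -> vdiff v (ws j)) &
  forall w, dvaluation w -> w T < 0 -> vdiff v w -> exists2 j, (j < s)%N & ~ vdiff w (ws j)].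
Proof.
pose P s := `[< exists ws, [/\ poles s ws, pairwise_vdiff s ws &
  forall j, (j < s)%N -> vdiff v (ws j)] >].
have exP : exists s, P s by exists 0%N; apply/asboolP; exists (fun=> v); split.
have ubP s : P s -> (s <= m)%N by move=> /asboolP[ws [h1 h3 _]]; apply: poles_bounded h1 h3.
case: (ex_maxnP exP ubP) => s /asboolP[ws [h1 h3 h4]] smax.
exists s, ws; split=> // w hw wT dw; apply: contrapT => hn.
have hn' j : (j < s)%N -> vdiff w (ws j).
  by move=> js; apply: contrapT => h; apply: hn; exists j.
suff /smax : P s.+1 by rewrite ltnn.
apply/asboolP; exists (fun j => if j == s then w else ws j); split.
- move=> j; rewrite ltnS leq_eqVlt => /orP[->//|js]; rewrite (ltn_eqF js); exact: h1.
- have lts j : (j < s.+1)%N -> j != s -> (j < s)%N by rewrite ltnS ltn_neqAle => -> ->.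
  move=> i j hi hj ij; have [ei|ni] := eqVneq i s; have [ej|nj] := eqVneq j s.
  + by rewrite ei ej eqxx in ij.
  + exact/hn'/lts.
  + exact/vdiff_sym/hn'/lts.
  + by apply: h3 => //; apply: lts.
- by move=> j; rewrite ltnS leq_eqVlt => /orP[->//|js]; rewrite (ltn_eqF js); exact: h4.
Qed.

Context (q : nat) (res : seq K) (hres : residue_system v q res).

(** Polynomials in [T] of degree below [n - c0] over an integral family give [p ^ (m (n - c0))]
    elements with poles only at those of [T]. Sorted by polar parts away from [v], they have a large
    class, and differences within it are integral outside [v]. The constant absorbs [c0], the pole
    order of the family. *)
Lemma many_integers : exists C : nat, forall n, exists l : seq K,
  [/\ uniq l, (forall x, x \in l -> nu_integer v x), (forall x, x \in l -> vge v (v T *+ n) x) &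
      (q ^ (`|v T| * n) <= C * size l)%N].
Proof.
have [e ie eO] := integral_family hm ie0.
have [s [ws [hws dws cover]]] := pole_list.
pose W w := w = v \/ exists2 j, (j < s)%N & w = ws j.
have hW w : W w -> dvaluation w /\ (T != 0 /\ w T < 0).
  by move=> [->|[j js ->]]; [|have [] := hws j js].
have exW : exists w, W w by exists v; left.
have [c0 hc0] := finite_pole_bound v ws s [seq e i | i : 'I_m].
have ec0 w i : W w -> vge w (w T *+ c0) (e i).
  move=> Ww; have [_ [_ wT]] := hW w Ww.
  have le : w T *+ c0 <= - c0%:Z by rewrite -mulr_natr natz; move: (w T) wT; clear; nia.
  have [h1 h3] := hc0 (e i) (map_f _ (mem_enum _ i)).
  by apply: (vge_le le); case: Ww => [->//|[j js ->]]; apply: h3.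
exists (p ^ (m * c0))%N => n; pose N := (n - c0)%N.
pose co (a : {ffun 'I_m * 'I_N -> 'F_p}) i : {poly 'F_p} :=
  \poly_(l < N) (if insub l is Some l' then a (i, l') else 0).
pose X a := \sum_i pev fp T (co a i) * e i.
have X_inj : injective X.
  move=> a a' eq; apply/ffunP => -[i l].
  have h0 : \sum_i pev fp T (co a i - co a' i) * e i = 0.
    transitivity (X a - X a'); last by rewrite eq subrr.
    by rewrite /X -sumrB; apply: eq_bigr => j _; rewrite pevB mulrBl.
  have /(congr1 (fun P : {poly 'F_p} => P`_l)) := ie _ h0 i.
  rewrite coefB !coef_poly ltn_ord coef0 valK /= => /eqP; rewrite subr_eq0 => /eqP.
  by [].
have XU a w : W w -> vge w (w T *+ n) (X a).
  move=> Ww; have [hw [_ wT]] := hW w Ww; apply: (vge_sum hw) => i _.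
  rewrite (pevE fp T (size_poly _ _)) mulr_suml; apply: (vge_sum hw) => l _.
  have le : w T *+ n <= 0 + w T *+ l + w T *+ c0.
    rewrite add0r -mulrnDr; have ln : (l + c0 <= n)%N by have := ltn_ord l; rewrite /N; lia.
    have -> : w T *+ n = w T *+ (l + c0) + w T *+ (n - (l + c0)) by rewrite -mulrnDr subnKC.
    by rewrite gerDl mulrn_wle0 // ltW.
  apply: (vge_le le); apply: (vgeM hw) (ec0 w i Ww); apply: (vgeM hw); first exact: vge_fp.
  by rewrite vgeE ?expf_neq0 // (val_exp hw).
have XO a w : dvaluation w -> 0 <= w T -> vge w 0 (X a).
  move=> hw wT; have wT' : vge w 0 T by rewrite vgeE.
  apply: (vge_sum hw) => i _; rewrite -(addr0 0); apply: (vgeM hw); last exact: eO.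
  exact: vge_pev.
pose L0 := [seq X a | a : {ffun 'I_m * 'I_N -> 'F_p}].
have szL0 : size L0 = (p ^ (m * N))%N.
  by rewrite size_map -cardE (card_fp hp) card_prod !card_ord.
have uL0 : uniq L0 by rewrite map_inj_uniq ?enum_uniq.
pose Q := (q ^ (`|v T| * n))%N.
have q1 : (1 < q)%N := residue_card_gt1 hv hres.
have Q0 : (0 < Q)%N by rewrite expn_gt0 (ltnW q1).
(* At most [M] polar parts away from [v] occur: weak approximation combines each of them with any of
   the [Q] polar parts at [v], and [pole_reps] bounds the number of combinations. *)
pose M := (p ^ (m * n) %/ Q)%N.
pose R x y := forall j, (j < s)%N -> vge (ws j) 0 (x - y).
have [Y [szY uY Yb Ysep _]] := ball_reps hv hres (- (`|v T| * n)%N%:Z) (`|v T| * n)%N.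
have [|||f hf|sub [ssub Rsub lesub]] := @big_class K R M L0.
- by move=> x j js; rewrite subrr vge0.
- by move=> x y h j js; have [hj _] := hws j js; rewrite (vgeBC hj); apply: h.
- by move=> x y z h1 h3 j js; have [hj _] := hws j js; apply: (vge_trans hj (h1 j js) (h3 j js)).
- have [A hA] := finite_pole_bound v ws s ([seq f i | i : 'I_M.+1] ++ Y).
  have fA i := hA (f i); have yA y := hA y.
  have [|xi [xiv xiw]] := @approx K v hv ws xpredT s _ A.
    by move=> j js _; split; [case: (hws j js)|apply: dws].
  have fA' i : f i \in [seq f i | i : 'I_M.+1] ++ Y by rewrite mem_cat map_f ?mem_enum.
  have yA' y : y \in Y -> y \in [seq f i | i : 'I_M.+1] ++ Y by move=> h; rewrite mem_cat h orbT.
  have cancel (w : K -> int) a x : dvaluation w -> vge w A%:Z a -> vge w (- A%:Z) x -> vge w 0 (a * x).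
    by move=> hw ha hx; have := vgeM hw ha hx; rewrite subrr.
  have vf i : vge v 0 ((1 - xi) * f i) by apply: cancel => //; case: (fA i (fA' i)).
  have vy y : y \in Y -> vge v 0 ((1 - xi) * y) by move=> h; apply: cancel => //; case: (yA y (yA' y h)).
  have jf i j : (j < s)%N -> vge (ws j) 0 (xi * f i).
    by move=> js; apply: cancel; [case: (hws j js)|exact: xiw|case: (fA i (fA' i)) => _; apply].
  have jy y j : y \in Y -> (j < s)%N -> vge (ws j) 0 (xi * y).
    by move=> h js; apply: cancel; [case: (hws j js)|exact: xiw|case: (yA y (yA' y h)) => _; apply].
  (* Up to integral elements [z] equals [y] at [v] and [f] at the other poles. *)
  pose z (iy : 'I_M.+1 * K) := (1 - xi) * f iy.1 + xi * iy.2.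
  have fX i : exists a, f i = X a by have /mapP[a _ ->] := hf i; exists a.
  have nT : - (`|v T| * n)%N%:Z = v T *+ n by rewrite -mulr_natr natz; move: (v T) (n) vT; clear; nia.
  have zU iy w : iy.2 \in Y -> W w -> vge w (w T *+ n) (z iy).
    case: iy => i y /= yY Ww; have [hw [_ wT]] := hW w Ww.
    have le0 : w T *+ n <= 0 by rewrite mulrn_wle0 // ltW.
    have [a ea] := fX i; case: Ww => [e1|[j js e1]]; rewrite e1 in hw wT le0 *.
      have -> : z (i, y) = (1 - xi) * f i + (y - (1 - xi) * y) by rewrite /z /=; ring.
      apply: (vgeD hw); first by apply: (vge_le le0).
      by apply: (vgeB hw); [rewrite -nT; apply: Yb|apply: (vge_le le0); apply: vy].
    have -> : z (i, y) = f i - xi * f i + xi * y by rewrite /z /=; ring.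
    apply: (vgeD hw); last by apply: (vge_le le0); apply: jy.
    apply: (vgeB hw); last by apply: (vge_le le0); apply: jf.
    by rewrite ea; apply: XU; right; exists j.
  have [s' szs' hs'] := pole_reps hp hm hW n exW.
  have step iy : exists y, iy.2 \in Y -> y \in s' /\ forall w, W w -> vge w 0 (z iy - y).
    have [h|h] := boolP (iy.2 \in Y); last by exists 0.
    by have [|y ys hy] := hs' (z iy); [move=> w; apply: zU|exists y].
  have [rep hrep] := choice step.
  have inD iy : iy \in [seq (i, y) | i <- enum 'I_M.+1, y <- Y] -> iy.2 \in Y.
    by move=> /allpairsP[[i y] [_ h ->]].
  have [|||[i y] [[i' y'] [/inD /= yY /inD /= yY' ne er]]] :=
    @pigeonhole _ _ rep [seq (i, y) | i <- enum 'I_M.+1, y <- Y] s'.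
  + by apply: allpairs_uniq => //; [exact: enum_uniq|move=> [? ?] [? ?] _ _ /= [-> ->]].
  + by move=> iy /inD /hrep[].
  + rewrite size_allpairs size_enum_ord szY; apply: (leq_ltn_trans szs'); rewrite -/Q.
    exact: ltn_ceil.
  have zz w : W w -> vge w 0 (z (i, y) - z (i', y')).
    move=> Ww; have [hw _] := hW w Ww.
    have h1 := proj2 (hrep (i, y) yY) w Ww; have h3 := proj2 (hrep (i', y') yY') w Ww.
    rewrite -er in h3; rewrite (vgeBC hw) in h3; exact: (vge_trans hw h1 h3).
  have ey : y = y'.
    apply: Ysep => //; rewrite addNr.
    have -> : y - y' = (z (i, y) - z (i', y')) - (1 - xi) * f i + (1 - xi) * f i'
        + (1 - xi) * y - (1 - xi) * y' by rewrite /z /=; ring.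
    apply: (vgeB hv); last exact: vy.
    apply: (vgeD hv); last exact: vy.
    apply: (vgeD hv); last exact: vf.
    by apply: (vgeB hv); [apply: zz; left|exact: vf].
  exists i, i'; split; first by apply: contra_notN ne => /eqP ->; rewrite ey.
  move=> j js; have [hj _] := hws j js.
  have -> : f i - f i' = (z (i, y) - z (i', y')) + xi * f i - xi * f i'.
    by rewrite /z /= ey; ring.
  apply: (vgeB hj); last exact: jf.
  by apply: (vgeD hj); [apply: zz; right; exists j|exact: jf].
have subX x : x \in sub -> exists a, x = X a.
  by move=> /(mem_subseq ssub)/mapP[a _ ->]; exists a.
case: sub ssub Rsub lesub subX => [|x0 sub'] ssub Rsub lesub subX.
  move: lesub; rewrite muln0 leqn0 szL0 -leqn0 leqNgt expn_gt0.
  by rewrite prime_gt0 // (pcharfp hp).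
have x0s : x0 \in x0 :: sub' by rewrite mem_head.
exists [seq x - x0 | x <- x0 :: sub']; split.
- by rewrite map_inj_uniq; [exact: subseq_uniq ssub uL0|exact: addIr].
- move=> _ /mapP[x xs ->]; have [d0|d0] := eqVneq (x - x0) 0; [by left|right].
  move=> w hw dw; rewrite -(vgeE w _ d0).
  have [a ea] := subX x xs; have [b eb] := subX x0 x0s.
  have [wT|wT] := leP 0 (w T).
    by apply: (vgeB hw); rewrite ?ea ?eb; apply: XO.
  have [j js nd] := cover w hw wT (vdiff_sym dw).
  have ew : w (x - x0) = ws j (x - x0).
    by apply: contrapT => /eqP ne; apply: nd; exists (x - x0).
  by have := Rsub x x0 xs x0s j js; rewrite !vgeE // ew.
- move=> _ /mapP[x xs ->]; have [a ea] := subX x xs; have [b eb] := subX x0 x0s.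
  by apply: (vgeB hv); rewrite ?ea ?eb; apply: XU; left.
rewrite size_map -/Q; move: lesub; rewrite szL0; set S := size _ => le.
have pN : (0 < p ^ (m * N))%N by rewrite expn_gt0 prime_gt0 // (pcharfp hp).
rewrite -(leq_pmul2r pN).
have h1 : (Q * p ^ (m * N) <= Q * (M * S))%N by rewrite leq_mul2l le orbT.
have h3 : (Q * (M * S) <= p ^ (m * n) * S)%N.
  by rewrite mulnA leq_mul2r (mulnC Q) leq_divM orbT.
apply: (leq_trans h1); apply: (leq_trans h3).
rewrite mulnAC -expnD -mulnDr leq_mul2r leq_exp2l ?prime_gt1 ?(pcharfp hp) //.
by rewrite leq_mul2l /N; apply/orP; right; apply/orP; right; clear; lia.
Qed.

Context (k : fieldType) (iota : {rmorphism K -> k}) (vk : k -> int) (hvk : dvaluation vk)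
  (ext : forall x, x != 0 -> vk (iota x) = v x).
Context (resk : seq k) (hresk : residue_system vk q resk).
Context (r : int) (disc : forall x, nu_integer v x -> vge v r x -> x = 0).
Context (intB : forall x y, nu_integer v x -> nu_integer v y -> nu_integer v (x - y)).

Lemma vge_iota N x : vge vk N (iota x) = vge v N x.
Proof.
by rewrite /vge fmorph_eq0; have [//|x0] := eqVneq x 0; rewrite ext.
Qed.

(** Translates of the test elements by many integers collide modulo a small ball, but by
    discreteness two translates of the same element do not. So the quotient by integers and a ball
    is finite. *)
Lemma integers_cocompact : exists R : int, forall y : k, exists2 a, nu_integer v a &
  vge vk R (y - iota a).
Proof.
have [C hC] := many_integers.
pose r' := `|r|%N; have rr : r <= r'%:Z by rewrite /r'; clear; lia.
pose M := (C * q ^ r')%N.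
pose cong x y := exists2 a, nu_integer v a & vge vk r'%:Z (x - y - iota a).
have index (f : 'I_M.+1 -> k) : exists i j, i != j /\ cong (f i) (f j).
  have [n hn] : exists n : nat, forall i, vge vk (v T *+ n) (f i).
    exists (\sum_(i < M.+1) `|vk (f i)|)%N => i; apply/orP; right.
    have : (`|vk (f i)| <= \sum_(i < M.+1) `|vk (f i)|)%N by rewrite (bigD1 i) //= leq_addr.
    by rewrite -mulr_natr natz; move: (v T) (vk (f i)) (\sum_(i < _) _)%N vT; clear; nia.
  have [l [ul lO lb sz]] := hC n.
  have nT : v T *+ n = - (`|v T| * n)%N%:Z by rewrite -mulr_natr natz; move: (v T) (n) vT; clear; nia.
  have [Y [szY uY Yb Ysep Ycov]] := ball_reps hvk hresk (v T *+ n) (`|v T| * n + r')%N.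
  have step (ix : 'I_M.+1 * K) : exists y, ix.2 \in l -> y \in Y /\ vge vk r'%:Z (f ix.1 + iota ix.2 - y).
    have [h|h] := boolP (ix.2 \in l); last by exists 0.
    have [|y yY hy] := Ycov (f ix.1 + iota ix.2).
      by apply: (vgeD hvk) => //; rewrite vge_iota; apply: lb.
    exists y => _; split=> //; apply: vge_le hy; rewrite nT; clear; lia.
  have [rep hrep] := choice step.
  have inD ix : ix \in [seq (i, x) | i <- enum 'I_M.+1, x <- l] -> ix.2 \in l.
    by move=> /allpairsP[[i x] [_ h ->]].
  have [|||[i x] [[i' x'] [/inD /= xl /inD /= xl' ne er]]] :=
    @pigeonhole _ _ rep [seq (i, x) | i <- enum 'I_M.+1, x <- l] Y.
  - by apply: allpairs_uniq => //; [exact: enum_uniq|move=> [? ?] [? ?] _ _ /= [-> ->]].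
  - by move=> ix /inD /hrep[].
  - rewrite size_allpairs size_enum_ord szY expnD.
    have q1 : (0 < q)%N := ltnW (residue_card_gt1 hv hres).
    have : (0 < q ^ (`|v T| * n))%N by rewrite expn_gt0 q1.
    have : (0 < q ^ r')%N by rewrite expn_gt0 q1.
    move: sz; rewrite /M; move: (q ^ (_ * _))%N (q ^ r')%N (size l) => a b c; clear => le b0 a0.
    have c0 : (0 < c)%N by rewrite lt0n; apply: contraTneq le => ->; rewrite muln0 -ltnNge.
    rewrite mulSn addnC; apply: (@leq_ltn_trans (C * b * c)%N).
      by rewrite mulnAC leq_mul2r le orbT.
    by rewrite -[X in (X < _)%N]addn0 ltn_add2l.
  have h1 := proj2 (hrep (i, x) xl); have h3 := proj2 (hrep (i', x') xl'); rewrite /= -er in h1 h3.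
  rewrite (vgeBC hvk) in h3; have h4 := vge_trans hvk h1 h3.
  exists i, i'; split.
    apply: contra_notN ne => /eqP ei; rewrite ei in h4 *.
    have h5 : x - x' = 0.
      apply: disc; first by apply: intB; apply: lO.
      apply: (vge_le rr); rewrite -vge_iota; move: h4; congr vge; rewrite rmorphB; ring.
    by rewrite (subr0_eq h5).
  exists (x' - x); first by apply: intB; apply: lO.
  by move: h4; congr vge; rewrite rmorphB; ring.
pose P N := `[< exists f : 'I_N -> k, forall i j, i != j -> ~ cong (f i) (f j) >].
have exP : exists N, P N by exists 0%N; apply/asboolP; exists (fun=> 0) => -[].
have ubP N : P N -> (N <= M)%N.
  move=> /asboolP[f hf]; rewrite leqNgt; apply/negP => lt.
  have [i [j [ij cij]]] := index (fun i => f (widen_ord lt i)).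
  apply: hf cij; apply: contra_neq ij => e; apply: val_inj; by have /(congr1 val) := e.
case: (ex_maxnP exP ubP) => N /asboolP[f hf] Nmax.
have O0 : nu_integer v 0 by left.
have congS x y : cong x y -> cong y x.
  move=> [a Oa h]; exists (0 - a); first exact: intB.
  rewrite (vgeBC hvk) in h; move: h; congr vge; rewrite sub0r rmorphN; ring.
have cov y : exists i, cong y (f i).
  apply: contrapT => hn; suff /Nmax : P N.+1 by rewrite ltnn.
  apply/asboolP; exists (fun i => if unlift ord0 i is Some j then f j else y) => i j.
  case: unliftP => [i' ->|->]; case: unliftP => [j' ->|->]; rewrite ?eqxx //.
  - by rewrite (inj_eq (@lift_inj _ _)); apply: hf.
  - by move=> _ /congS h; apply: hn; exists i'.
  - by move=> _ h; apply: hn; exists j'.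
exists (- (\sum_(i < N) `|vk (f i)|)%N%:Z - r'%:Z) => y.
have [i [a Oa h]] := cov y; exists a => //.
have -> : y - iota a = (y - f i - iota a) + f i by ring.
apply: (vgeD hvk); first by apply: vge_le h; clear; lia.
apply/orP; right.
have : (`|vk (f i)| <= \sum_(i < N) `|vk (f i)|)%N by rewrite (bigD1 i) //= leq_addr.
by clear; lia.
Qed.

End Cocompact.

(** * Reduction to three variables *)

Section Bilinear.
Context (k : fieldType) (n : nat) (A : 'M[k]_n) (hsym : A^T = A).

Definition bform (u v : 'rV[k]_n) : k := (u *m A *m v^T) 0 0.
Local Notation bf := bform.

Lemma bfC u v : bf u v = bf v u.
Proof.
have -> : bf v u = ((u *m A *m v^T)^T) 0 0 by rewrite /bform !trmx_mul trmxK hsym mulmxA.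
by rewrite mxE.
Qed.

Lemma bfDl u u' v : bf (u + u') v = bf u v + bf u' v.
Proof. by rewrite /bform !mulmxDl mxE. Qed.

Lemma bfZl a u v : bf (a *: u) v = a * bf u v.
Proof. by rewrite /bform -!scalemxAl mxE. Qed.

Lemma bfDr u v v' : bf u (v + v') = bf u v + bf u v'.
Proof. by rewrite !(bfC u) bfDl. Qed.

Lemma bfZr a u v : bf u (a *: v) = a * bf u v.
Proof. by rewrite !(bfC u) bfZl. Qed.

Lemma bf_delta i j : bf (delta_mx 0 i) (delta_mx 0 j) = A i j.
Proof. by rewrite /bform -rowE trmx_delta -colE !mxE. Qed.

Lemma bfE u v : bf u v = \sum_j \sum_i u 0 i * A i j * v 0 j.
Proof. by rewrite /bform mxE; apply: eq_bigr => j _; rewrite !mxE mulr_suml. Qed.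

Definition gram (x y z : 'rV[k]_n) : qf k :=
  Qf (bf x x) (bf x y) (bf x z) (bf y y) (bf y z) (bf z z).

Lemma bil_gram x y z u v : bil (gram x y z) u v =
  bf (u.1.1 *: x + u.1.2 *: y + u.2 *: z) (v.1.1 *: x + v.1.2 *: y + v.2 *: z).
Proof.
rewrite !(bfDl, bfDr) !(bfZl, bfZr) (bfC y x) (bfC z x) (bfC z y) /bil /=; ring.
Qed.

Lemma qdet_gram x y z : qdet (gram x y z) = (bf x x * bf y y - bf x y ^+ 2) * bf z z
  - (bf y y * bf x z ^+ 2 - 2%:R * bf x y * bf x z * bf y z + bf x x * bf y z ^+ 2).
Proof. by rewrite /qdet /=; ring. Qed.

(* Otherwise [A] would be a sum of two matrices of rank one. *)
Lemma gram_nondegenerate x y : 2%:R != 0 :> k -> (3 <= n)%N -> \det A != 0 ->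
  bf x x * bf y y - bf x y ^+ 2 != 0 ->
  exists2 z, qdet (gram x y z) != 0 &
    exists i j, z = delta_mx 0 i \/ z = delta_mx 0 i + delta_mx 0 j.
Proof.
move=> h2 hn dA; set a := bf x x; set b := bf x y; set c := bf y y; set D := a * c - b ^+ 2 => D0.
apply: contrapT => hno.
pose X i := bf x (delta_mx 0 i); pose Y i := bf y (delta_mx 0 i).
have q0 z : (exists i j, z = delta_mx 0 i \/ z = delta_mx 0 i + delta_mx 0 j) ->
    D * bf z z = c * bf x z ^+ 2 - 2%:R * b * bf x z * bf y z + a * bf y z ^+ 2.
  move=> hz; apply/eqP; rewrite -subr_eq0 -/a -/b -/c -qdet_gram; apply/negPn/negP => h.
  by apply: hno; exists z.
have hii i : D * A i i = c * X i ^+ 2 - 2%:R * b * X i * Y i + a * Y i ^+ 2.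
  by rewrite -bf_delta; apply: q0; exists i, i; left.
have hij i j : D * A i j = c * (X i * X j) - b * (X i * Y j + Y i * X j) + a * (Y i * Y j).
  have := q0 (delta_mx 0 i + delta_mx 0 j); rewrite !(bfDl, bfDr) !bf_delta -/(X i) -/(X j) -/(Y i) -/(Y j).
  have -> : A j i = A i j by rewrite -[in LHS]hsym mxE.
  move=> /(_ (ex_intro _ i (ex_intro _ j (or_intror erefl)))) e.
  apply: (mulfI h2); apply/eqP; rewrite -subr_eq0; apply/eqP.
  transitivity ((D * (A i i + A j i + (A i j + A j j)) - (c * (X i + X j) ^+ 2
     - 2%:R * b * (X i + X j) * (Y i + Y j) + a * (Y i + Y j) ^+ 2))
     - (D * A i i - (c * X i ^+ 2 - 2%:R * b * X i * Y i + a * Y i ^+ 2))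
     - (D * A j j - (c * X j ^+ 2 - 2%:R * b * X j * Y j + a * Y j ^+ 2))).
    have -> : A j i = A i j by rewrite -[in LHS]hsym mxE.
    by ring.
  rewrite !hii !subrr !subr0; have -> : A j i = A i j by rewrite -[in LHS]hsym mxE.
  by rewrite e subrr.
have eA : A = (\row_i X i)^T *m (\row_j ((c * X j - b * Y j) / D))
            + (\row_i Y i)^T *m (\row_j ((a * Y j - b * X j) / D)).
  apply/matrixP => i j; rewrite !mxE !big_ord1 !mxE; apply: (mulfI D0); rewrite hij.
  by field.
have := mxrank_add ((\row_i X i)^T *m (\row_j ((c * X j - b * Y j) / D)))
  ((\row_i Y i)^T *m (\row_j ((a * Y j - b * X j) / D))).
rewrite -eA mxrank_unit ?unitmxE ?unitfE // => le.
have r1 (U : 'cV[k]_n) (V : 'rV[k]_n) : (\rank (U *m V) <= 1)%N.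
  by apply: leq_trans (mxrankM_maxl _ _) (rank_leq_col _).
have := leq_trans le (leq_add (r1 _ _) (r1 _ _)).
by rewrite addn1 leqNgt hn.
Qed.

End Bilinear.

(** * From [n] variables to three *)

Section Reduction.
Context (k : fieldType) (w : k -> int) (hw : dvaluation w).
Context (hcomp : complete_val w) (q : nat) (res : seq k)
  (hres : residue_system w q res).
Context (h2 : 2%:R != 0 :> k) (w2 : w 2%:R = 0) (p : nat) (hp : p \in [pchar k]).
Context (O : k -> Prop) (O1 : O 1) (OB : forall a b, O a -> O b -> O (a - b))
  (OM : forall a b, O a -> O b -> O (a * b)).
Context (rO : int) (Odisc : forall a, O a -> vge w rO a -> a = 0).
Context (th : k) (Oth : O th) (th0 : th != 0) (wth : w th < 0).
Context (K : fieldType) (iota : {rmorphism K -> k}) (OK : forall a, O a -> exists x, a = iota x).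
Context (R : int) (cover : forall x, exists2 a, O a & vge w R (x - a)).
Context (n : nat) (hn : (3 <= n)%N) (A : 'M[k]_n) (hsym : A^T = A) (dA : \det A != 0).
Context (E : int) (good : forall u : 'rV[k]_n, (forall i, O (u 0 i)) -> u != 0 ->
  ~~ vge w (E + 1) (bform A u u)).
Local Notation bf := (bform A).
Local Notation rV := 'rV[k]_n.

Lemma bf_bound : exists C : nat, forall (u v : rV) N N', (forall i, vge w N (u 0 i)) ->
  (forall i, vge w N' (v 0 i)) -> vge w (N + N' - C%:Z) (bf u v).
Proof.
exists (\sum_i \sum_j `|w (A i j)|)%N => u v N N' hu hv; rewrite bfE.
apply: (vge_sum hw) => j _; apply: (vge_sum hw) => i _.
have le : (`|w (A i j)| <= \sum_i \sum_j `|w (A i j)|)%N.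
  by rewrite (bigD1 i) //= (bigD1 j) //= -addnA leq_addr.
have -> : N + N' - (\sum_i \sum_j `|w (A i j)|)%N%:Z =
   N + - (\sum_i \sum_j `|w (A i j)|)%N%:Z + N' by ring.
apply: (vgeM hw) => //; apply: (vgeM hw) => //; apply/orP; right.
by move: le; clear; lia.
Qed.

Lemma hyperbolic_pair : (exists x : rV, x != 0 /\ bf x x = 0) ->
  exists xi ze : rV, [/\ bf xi xi = 0, bf xi ze = 1 & bf ze ze = 0].
Proof.
move=> [xi [xi0 exi]]; have [j hj] : exists j, bf xi (delta_mx 0 j) != 0.
  apply: contrapT => hno; case/eqP: xi0.
  have uA : A \in unitmx by rewrite unitmxE unitfE.
  rewrite -(mulmxK uA xi); suff -> : xi *m A = 0 by rewrite mul0mx.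
  apply/rowP => j; rewrite [RHS]mxE; apply/eqP/negPn/negP => h; apply: hno; exists j.
  by rewrite /bform trmx_delta -colE mxE.
pose z1 : rV := (bf xi (delta_mx 0 j))^-1 *: delta_mx 0 j.
have e1 : bf xi z1 = 1 by rewrite (bfZr hsym) mulVf.
clearbody z1.
exists xi, (z1 + (- (bf z1 z1 / 2%:R)) *: xi); split=> //.
  by rewrite (bfDr hsym) (bfZr hsym) e1 exi mulr0 addr0.
rewrite !(bfDl, bfDr hsym) !(bfZl, bfZr hsym) e1 exi (bfC hsym z1 xi) e1.
by field.
Qed.

Definition ratl (b u : k) := exists x, u = b * iota x.

Lemma ratlB b u v : ratl b u -> ratl b v -> ratl b (u - v).
Proof. by move=> [x ->] [y ->]; exists (x - y); rewrite rmorphB mulrBr. Qed.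

Lemma ratlV b u a : O a -> ratl b u -> ratl b (u / a).
Proof.
by move=> /OK[y ->] [x ->]; exists (x / y); rewrite fmorph_div mulrA.
Qed.

Lemma near_integral (mu : k) (u : rV) : exists x : rV,
  (forall i, O (x 0 i)) /\ forall i, vge w R ((x - mu *: u) 0 i).
Proof.
have step i : exists a, O a /\ vge w R (mu * u 0 i - a) by have [a] := cover (mu * u 0 i); exists a.
have [a ha] := choice step; exists (\row_i a i); split=> i; rewrite !mxE; first by case: (ha i).
by rewrite (vgeBC hw); case: (ha i).
Qed.

(** A hyperbolic pair is multiplied by a large [mu] and rounded to integral vectors. The
    discriminant divided by [mu^4] is near [1], hence a square by Hensel's lemma, so the plane
    remains isotropic. *)
Lemma integral_hyperbolic_plane : (exists x : rV, x != 0 /\ bf x x = 0) ->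
  exists x y : rV, [/\ (forall i, O (x 0 i)), (forall i, O (y 0 i)), bf x y != 0 &
    exists2 s, s != 0 & bf x y ^+ 2 - bf x x * bf y y = s ^+ 2].
Proof.
move=> /hyperbolic_pair[xi [ze [exx exz ezz]]].
have [C hC] := bf_bound.
have [Nb [hx hz]] : exists Nb : nat, (forall i, vge w (- Nb%:Z) (xi 0 i)) /\
    forall i, vge w (- Nb%:Z) (ze 0 i).
  exists (\sum_i (`|w (xi 0%R i)| + `|w (ze 0%R i)|))%N; split=> i; apply/orP; right;
    have : (`|w (xi 0%R i)| + `|w (ze 0%R i)| <= \sum_i (`|w (xi 0%R i)| + `|w (ze 0%R i)|))%N;
    by [rewrite (bigD1 i) //= leq_addr|clear; lia].
have [|N0 hN0] := hensel hw hcomp hres (P := 'X ^+ 2) (a := 1) 1.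
  by rewrite derivXn hornerMn hornerXn expr1n.
(* [mu] outweighs the rounding error [R], the size [Nb] of the pair and the loss [C] in [bf_bound],
   leaving the precision [N] for Hensel's lemma. *)
pose N := `|N0|%N.+1; pose m := (N + Nb + 2 * `|R| + C)%N.
have [mu mu0 wmu] := val_ex hw (- m%:Z).
have mu20 : mu ^+ 2 != 0 by rewrite expf_neq0.
have approx (u u' x x' : rV) : (forall i, vge w (- Nb%:Z) (u 0 i)) ->
    (forall i, vge w (- Nb%:Z) (u' 0 i)) -> (forall i, vge w R ((x - mu *: u) 0 i)) ->
    (forall i, vge w R ((x' - mu *: u') 0 i)) -> vge w N%:Z (bf x x' / mu ^+ 2 - bf u u').
  move=> hu hu' hd hd'; set d := x - mu *: u in hd; set d' := x' - mu *: u' in hd'.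
  have -> : bf x x' / mu ^+ 2 - bf u u' = (mu * bf u d' + mu * bf d u' + bf d d') / mu ^+ 2.
    have ex : x = mu *: u + d by rewrite /d addrC subrK.
    have ex' : x' = mu *: u' + d' by rewrite /d' addrC subrK.
    rewrite {1}ex {1}ex' !(bfDl, bfDr hsym) !(bfZl, bfZr hsym).
    by field.
  rewrite (vgeMr hw) ?invr_eq0 // (val_inv hw) // (val_exp hw) // opprK.
  apply: (vgeD hw); first apply: (vgeD hw).
  - rewrite (vgeMl hw) // wmu; apply: vge_le (hC _ _ _ _ hu hd').
    by rewrite ?wmu mulr2n /m; clear; lia.
  - rewrite (vgeMl hw) // wmu; apply: vge_le (hC _ _ _ _ hd hu').
    by rewrite ?wmu mulr2n /m; clear; lia.
  - by apply: vge_le (hC _ _ _ _ hd hd'); rewrite ?wmu mulr2n /m; clear; lia.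
have [x [Ox dx]] := near_integral mu xi; have [y [Oy dy]] := near_integral mu ze.
exists x, y.
pose a := bf x x / mu ^+ 2; pose b := bf x y / mu ^+ 2; pose c := bf y y / mu ^+ 2.
have va : vge w N%:Z a by have := approx _ _ _ _ hx hx dx dx; rewrite exx subr0.
have vb : vge w N%:Z (b - 1) by have := approx _ _ _ _ hx hz dx dy; rewrite exz.
have vc : vge w N%:Z c by have := approx _ _ _ _ hz hz dy dy; rewrite ezz subr0.
have b0 : b != 0.
  have [] := val_dom hw (oner_neq0 k) (y := b); last by [].
  by rewrite (val_one hw); apply: vge_le vb; rewrite /N; clear; lia.
have [|s s1 es] := hN0 (b ^+ 2 - a * c - 1).
  have -> : b ^+ 2 - a * c - 1 = (b - 1) * (b - 1 + 2%:R) - a * c by ring.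
  have le : N0 <= N%:Z + 0 by rewrite /N; clear; lia.
  apply: (vge_le le); apply: (vgeB hw); apply: (vgeM hw) => //.
    apply: (vgeD hw); last exact: (vge_nat hw).
    by apply: vge_le vb; rewrite /N; clear; lia.
  by apply: vge_le vc; rewrite /N; clear; lia.
have s0 : s != 0.
  by have [] := val_dom hw (oner_neq0 k) (y := s); rewrite ?(val_one hw).
split=> //.
  by apply: contra_neq b0; rewrite /b => ->; rewrite mul0r.
exists (mu ^+ 2 * s); first exact: mulf_neq0.
move: es; rewrite !hornerXn expr1n => es; rewrite exprMn es /a /b /c.
by field.
Qed.

(** The form on the span of [x, y, z] is isotropic because its restriction to the plane is, and it
    inherits the lower bound; [ternary_form] puts the ratios of its entries in [K]. *)
Lemma gram_rational (x y z : rV) : (forall i, O (x 0 i)) -> (forall i, O (y 0 i)) ->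
  bf x y != 0 -> (exists2 s, s != 0 & bf x y ^+ 2 - bf x x * bf y y = s ^+ 2) ->
  (forall i, O (z 0 i)) -> qdet (gram A x y z) != 0 -> ratl (bf x y) (bf z z).
Proof.
move=> Ox Oy b0 [s s0 es] Oz dG.
have iso : exists2 u, u <> 0 & ev (gram A x y z) u = 0.
  have [a0|a0] := eqVneq (bf x x) 0.
    exists (1, 0, 0); first by move=> [] /eqP; rewrite oner_eq0.
    by rewrite /ev /bil /= a0; ring.
  exists (s - bf x y, bf x x, 0); first by move=> [_ /eqP]; rewrite (negbTE a0).
  rewrite /ev /bil /=.
  transitivity (bf x x * (s ^+ 2 - (bf x y ^+ 2 - bf x x * bf y y))); first by ring.
  by rewrite es subrr mulr0.
have [|c [B eG]] := ternary_form hw hcomp hres h2 w2 hp O1 OB OM Odisc Oth th0 wth OK cover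
  (E := E) dG iso.
  move=> u [o1 o2 o3] u0.
  have OD a b : O a -> O b -> O (a + b).
    move=> Oa Ob; rewrite -(opprK b) -(sub0r b); apply: OB => //; apply: OB => //.
    by rewrite -(subrr 1); apply: OB.
  rewrite /ev bil_gram //; apply: good.
    by move=> i; rewrite !mxE; repeat first [apply OD | apply OM | done].
  have [t] := bil_nondegenerate dG u0; rewrite bil_gram //; apply: contra_neq => ->.
  by rewrite -[0 in LHS](scale0r x) bfZl mul0r.
have eb : bf x y = c * iota (qb B) by rewrite -[LHS]/(qb (gram A x y z)) eG.
have ez : bf z z = c * iota (qff B) by rewrite -[LHS]/(qff (gram A x y z)) eG.
exists (qff B / qb B); rewrite fmorph_div ez eb.
move: b0; rewrite eb mulf_eq0 negb_or => /andP[c0 B0].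
by rewrite mulrA -[X in _ = X]mulrA mulrC; field.
Qed.

(** An integral [u] may be degenerate with [x] and [y], so it is replaced by [z0 + al u],
    nondegenerate for all but finitely many [al]. A second divided difference at [0, al, be]
    recovers the value at [u], and polarization the entries. *)
Theorem rational_multiple : (exists x : rV, x != 0 /\ bf x x = 0) ->
  exists (c : k) (B : 'M[K]_n), A = c *: map_mx iota B.
Proof.
move=> /integral_hyperbolic_plane[x [y [Ox Oy b0 hs]]].
have [s s0 es] := hs; set b := bf x y in b0 es.
have O0 : O 0 by rewrite -(subrr 1); apply: OB.
have OD a a' : O a -> O a' -> O (a + a').
  by move=> Oa Ob; rewrite -(opprK a') -(sub0r a'); apply: OB => //; apply: OB.
have Od i j : O ((delta_mx 0 i : rV) 0 j) by rewrite mxE; case: (_ && _).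
have [|z0 dz0 hz0] := gram_nondegenerate hsym h2 hn dA (x := x) (y := y).
  have -> : bf x x * bf y y - bf x y ^+ 2 = - (s ^+ 2) by rewrite -es -/b; ring.
  by rewrite oppr_eq0 expf_neq0.
have Oz0 i : O (z0 0 i).
  by move: hz0 => [i' [j' [->|->]]]; [|rewrite mxE; apply: OD]; apply: Od.
have main (u : rV) : (forall i, O (u 0 i)) -> ratl b (bf u u).
  move=> Ou.
  pose px : {poly k} := (bf x z0)%:P + bf x u *: 'X.
  pose py : {poly k} := (bf y z0)%:P + bf y u *: 'X.
  pose pz : {poly k} := (bf z0 z0)%:P + (2%:R * bf z0 u) *: 'X + bf u u *: 'X ^+ 2.
  pose P : {poly k} := (bf x x * bf y y - bf x y ^+ 2)%:P * pz
    - ((bf y y)%:P * px ^+ 2 - (2%:R * bf x y)%:P * px * py + (bf x x)%:P * py ^+ 2).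
  have PE al : P.[al] = qdet (gram A x y (z0 + al *: u)).
    have ex : px.[al] = bf x z0 + bf x u * al by rewrite hornerD hornerC hornerZ hornerX.
    have ey : py.[al] = bf y z0 + bf y u * al by rewrite hornerD hornerC hornerZ hornerX.
    have ez : pz.[al] = bf z0 z0 + 2%:R * bf z0 u * al + bf u u * al ^+ 2.
      by rewrite !hornerD hornerC !hornerZ hornerX hornerXn.
    clearbody px py pz; rewrite /P !(hornerD, hornerN, hornerM, horner_exp) !hornerC ex ey ez.
    rewrite qdet_gram !(bfDl, bfDr hsym) !(bfZl, bfZr hsym) (bfC hsym u z0).
    by ring.
  have P0 : P != 0.
    by apply: contra_neq dz0 => e; have := PE 0; rewrite e horner0 scale0r addr0.
  have Oal i : O (th ^+ i) by elim: i => [//|i IH]; rewrite exprS; apply: OM.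
  have [i hi] := poly_nonroot hw th0 wth P0; set al := th ^+ i in hi.
  have al0 : al != 0 by rewrite expf_neq0.
  have X0 : 'X - al%:P != 0 by rewrite polyXsubC_eq0.
  have [j] := poly_nonroot hw th0 wth (mulf_neq0 P0 X0).
  set be := th ^+ j; rewrite hornerM hornerXsubC mulf_eq0 negb_or => /andP[hj ab].
  have be0 : be != 0 by rewrite expf_neq0.
  have rz g : O g -> P.[g] != 0 -> ratl b (bf (z0 + g *: u) (z0 + g *: u)).
    move=> Og hg; apply: gram_rational => //; last by rewrite -PE.
    by move=> i'; rewrite !mxE; apply: OD => //; apply: OM.
  have rz0 : ratl b (bf z0 z0) by apply: gram_rational.
  have := ratlV (OB (Oal j) (Oal i)) (ratlB (ratlV (Oal j) (ratlB (rz _ (Oal j) hj) rz0))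
    (ratlV (Oal i) (ratlB (rz _ (Oal i) hi) rz0))).
  rewrite -/al -/be !(bfDl, bfDr hsym) !(bfZl, bfZr hsym) (bfC hsym u z0).
  congr ratl; field; by rewrite al0 be0 ab.
have entry i j : ratl b (A i j).
  have O2 : O 2%:R by rewrite (natrD _ 1 1); apply: OD.
  have Oij : forall l, O ((delta_mx 0 i + delta_mx 0 j : rV) 0 l) by move=> l; rewrite mxE; apply: OD; apply: Od.
  have := ratlV O2 (ratlB (ratlB (main _ Oij) (main _ (Od i))) (main _ (Od j))).
  rewrite !(bfDl, bfDr hsym) !bf_delta; congr ratl.
  have -> : A j i = A i j by rewrite -[in LHS]hsym mxE.
  by field.
have [B hB] := choice (fun ij : 'I_n * 'I_n => entry ij.1 ij.2).
exists b, (\matrix_(i, j) B (i, j)); apply/matrixP => i j; rewrite !mxE.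
exact: (hB (i, j)).
Qed.

End Reduction.

Lemma absv_small (k : fieldType) (w : k -> int) q eps : (1 < q)%N -> 0 < eps ->
  exists N : int, forall y, vge w N y -> absv w q y < eps.
Proof.
move=> q1 eps0; pose m := Num.bound eps^-1; exists m%:Z => y.
rewrite /absv /vge; have [//|y0] := eqVneq y 0.
rewrite /=; case: (w y) => // l; rewrite lez_nat => ml.
rewrite -invr_expz -exprnP -[eps]invrK ltf_pV2 ?posrE ?invr_gt0 //; last first.
  by rewrite exprn_gt0 // -pmulrn ltr0n ltnW.
have e0 : 0 <= eps^-1 by rewrite invr_ge0 ltW.
apply: (lt_le_trans (archi_boundP e0)); rewrite -/m -pmulrn -natrX ler_nat.
by apply: leq_trans ml _; apply: ltnW; apply: ltn_expl.
Qed.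

(** * The ring of integers and the conclusion *)

Section Integers.
Context (K : fieldType) (v : K -> int).

Lemma nu_integerP x : nu_integer v x <->
  forall w, dvaluation w -> vdiff w v -> vge w 0 x.
Proof.
split=> [[-> w _ _|h w hw d]|h]; [exact: vge0|by apply/orP; right; apply: h|].
have [->|x0] := eqVneq x 0; [by left|right=> w hw d].
by have := h w hw d; rewrite vgeE.
Qed.

Lemma nu_integer1 : nu_integer v 1.
Proof. by apply/nu_integerP => w hw _; apply: vge1. Qed.

Lemma nu_integerB x y : nu_integer v x -> nu_integer v y -> nu_integer v (x - y).
Proof.
move=> /nu_integerP hx /nu_integerP hy; apply/nu_integerP => w hw d.
by apply: (vgeB hw); [exact: hx|exact: hy].
Qed.

Lemma nu_integerM x y : nu_integer v x -> nu_integer v y -> nu_integer v (x * y).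
Proof.
move=> /nu_integerP hx /nu_integerP hy; apply/nu_integerP => w hw d.
by rewrite -(addr0 0); apply: (vgeM hw); [exact: hx|exact: hy].
Qed.

End Integers.

(** If [t] is a unit at [v], two of its powers have the same residue, and the inverse of their
    difference has a pole. *)
Lemma pole_element (K : fieldType) p (fp : {rmorphism 'F_p -> K}) (t : K) (v : K -> int) q res :
  dvaluation v -> residue_system v q res -> (forall P, pev fp t P = 0 -> P = 0) ->
  exists T f g, [/\ T != 0, v T < 0, g != 0 & T * pev fp t g = pev fp t f].
Proof.
move=> hv [szr _ _ _ cov] tr.
have tr0 P : P != 0 -> pev fp t P != 0 by move=> P0; apply: contra_neq P0; apply: tr.
have t0 : t != 0 by rewrite -(pevX fp t) tr0 // polyX_eq0.
have inv g : g != 0 -> 0 < v (pev fp t g) ->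
    exists T f g, [/\ T != 0, v T < 0, g != 0 & T * pev fp t g = pev fp t f].
  move=> g0 vg; exists (pev fp t g)^-1, 1, g; rewrite invr_eq0 tr0 // mulVf ?tr0 // pev1.
  by rewrite (val_inv hv) ?tr0 // oppr_lt0.
have [vt|vt|vt] := ltgtP (v t) 0.
- by exists t, 'X, 1; rewrite t0 vt oner_neq0 pev1 mulr1 pevX.
- by apply: (inv 'X); rewrite ?polyX_eq0 // pevX.
have step (i : nat) : exists a, a \in res /\ vge v 1 (t ^+ i - a).
  have [|a ar ha] := cov (t ^+ i); last by exists a.
  by rewrite vgeE ?expf_neq0 // (val_exp hv) // vt mul0rn.
have [a ha] := choice step.
have [|||i [j [_ _ ij e]]] := @pigeonhole _ _ a (seq.iota 0 q.+1) res.
- exact: iota_uniq.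
- by move=> i _; case: (ha i).
- by rewrite size_iota szr.
have g0 : 'X^i - 'X^j != 0 :> {poly 'F_p}.
  rewrite subr_eq0; apply/eqP => /(congr1 (fun P : {poly 'F_p} => size P)); rewrite !size_polyXn => -[].
  exact: ij.
apply: (inv _ g0); have h1 : vge v 1 (pev fp t ('X^i - 'X^j)).
  rewrite pevB !pev_exp pevX; have [_ h1] := ha i; have [_ h3] := ha j.
  by rewrite e in h1; rewrite (vgeBC hv) in h3; apply: (vge_trans hv h1 h3).
by rewrite vgeE ?tr0 // in h1; move: h1; clear; lia.
Qed.

Theorem theorem1p1
  (K Kv : fieldType) (p : nat) (iota : {rmorphism K -> Kv})
  (v : K -> int) (vKv : Kv -> int) (q : nat)
  (hK : global_function_field K p) (hp2 : p != 2%N)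
  (hv : dvaluation v) (hcompl : is_completion iota v vKv)
  (hq : residue_card v q)
  (n : nat) (hn : (3 <= n)%N) (A : 'M[Kv]_n)
  (hsym : A^T = A) (hnondeg : \det A != 0)
  (hiso : exists x : 'rV[Kv]_n, x != 0 /\ qform A x = 0)
  (hirr : ~ exists (c : Kv) (B : 'M[K]_n), A = c *: map_mx iota B) :
  forall eps : rat, 0 < eps ->
    exists x : 'rV[K]_n,
      [/\ x != 0, (forall i, nu_integer v (x 0 i)) &
          absv vKv q (qform A (map_mx iota x)) < eps].
Proof.
move=> eps eps0; apply: contrapT => hno.
have [hp [t [tr [b hb]]]] := hK; have [fp _] := prime_field_embedding hp.
have [hw ext compl dens] := hcompl.
have vgeP (N : int) x : vge vKv N x <-> x = 0 \/ N <= vKv x.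
  by rewrite /vge; split=> [/orP[/eqP|]|[->|->]]; rewrite ?eqxx ?orbT; [left|right|..].
have vgeP' (N : int) x y : vge vKv N (x - y) <-> x = y \/ N <= vKv (x - y).
  rewrite vgeP; split=> -[h|]; [left; exact: subr0_eq|by right|left; rewrite h subrr|by right].
  by [].
have hcomp : complete_val vKv.
  move=> s hs; have [|l hl] := compl s.
    by move=> N; have [M hM] := hs N; exists M => m l hm hl; apply/vgeP'/hM.
  by exists l => N; have [M hM] := hl N; exists M => m hm; apply/vgeP'/hM.
have vgei N x : vge vKv N (iota x) = vge v N x by apply: vge_iota.
have [res hres] := residue_cardP hq.
have hresk : residue_system vKv q (map iota res).
  have [sz ur r0 sep cov] := hres; split.
  - by rewrite size_map.
  - by rewrite map_inj_uniq //; apply: fmorph_inj.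
  - by move=> _ /mapP[a ar ->]; rewrite vgei; apply: r0.
  - move=> _ _ /mapP[a ar ->] /mapP[a' ar' ->]; rewrite -rmorphB vgei => h.
    by rewrite (sep _ _ ar ar' h).
  - move=> y hy; have [x hx] := dens y 1.
    have {}hx : vge vKv 1 (iota x - y) by apply/vgeP'.
    have vx : vge v 0 x.
      rewrite -vgei -(subrK y (iota x)); apply: (vgeD hw) => //.
      by apply: vge_le hx.
    have [a ar ha] := cov x vx; exists (iota a); first exact: map_f.
    rewrite (vgeBC hw) in hx; apply: (vge_trans hw hx).
    by rewrite -rmorphB vgei.
have q1 := residue_card_gt1 hv hres.
have hpk : p \in [pchar Kv] := rmorph_pchar iota hp.
have h2 : 2%:R != 0 :> Kv.
  rewrite -(dvdn_pcharf hpk) dvdn_prime2 ?(pcharf_prime hp) //.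
have w2 : vKv 2%:R = 0 := val_nat hw hpk h2.
have tr' P : pev fp t P = 0 -> P = 0.
  move=> h; have : map_poly fp P = 0.
    apply: tr h => i; exists (nat_of_ord (P`_i)%R); rewrite coef_map /=; move: (P`_i) => a.
    exact: etrans (congr1 fp (esym (natr_Zp a))) (rmorph_nat fp a).
  by move/eqP; rewrite map_poly_eq0 => /eqP.
have hb' x : exists D (c : nat -> {poly 'F_p}), D != 0 /\
    x * pev fp t D = \sum_(j < size b) pev fp t (c j) * b`_j.
  have [D [c [pD D0 szc pc e]]] := hb x.
  have [D' eD] := prime_coeff_polyP fp pD.
  have step (j : nat) : exists P, nth 0 c j = map_poly fp P.
    have [jc|jc] := ltnP j (size c); first by apply: prime_coeff_polyP; apply: pc; apply: mem_nth.
    by exists 0; rewrite nth_default // rmorph0.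
  have [c' hc'] := choice step; exists D', c'; split.
    by apply: contra_neq D0 => D0; rewrite eD D0 rmorph0 horner0.
  by rewrite /pev -eD e; apply: eq_bigr => j _; rewrite hc'.
have [T [f [g [T0 vT g0 eT]]]] := pole_element hv hres tr'.
have [m0 hm0] := indep_bounded hp tr' hb' g0 eT.
(* The maximal size of an independent family is the degree of [K] over [F_p(T)]; counting needs it
   both as a bound and as attained. *)
have [m [e0 ie0] hm] : exists2 m, exists e : 'I_m -> K, indep fp T e &
    forall r (e : 'I_r -> K), indep fp T e -> (r <= m)%N.
  pose P r := `[< exists e : 'I_r -> K, indep fp T e >].
  have exP : exists r, P r by exists 0%N; apply/asboolP; exists (fun=> 0) => c _ [].
  have ubP r : P r -> (r <= m0)%N by move=> /asboolP[e /hm0].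
  case: (ex_maxnP exP ubP) => m /asboolP he hmax; exists m => // r e ie.
  by apply: hmax; apply/asboolP; exists e.
have [N hN] := absv_small vKv q1 eps0.
have good (x : 'rV[K]_n) : (forall i, nu_integer v (x 0 i)) -> x != 0 ->
    ~~ vge vKv (N - 1 + 1) (bform A (map_mx iota x) (map_mx iota x)).
  move=> Ox x0; rewrite subrK; apply/negP => h; apply: hno; exists x; split=> //.
  exact: hN.
(* Discreteness comes from the assumed lower bound on multiples of a basis vector; a zero diagonal
   entry only makes the contradiction immediate. *)
have [r disc] : exists r : int, forall x, nu_integer v x -> vge v r x -> x = 0.
  pose i0 : 'I_n := Ordinal (ltnW (ltnW hn)).
  exists (`|N| + `|vKv (A i0 i0)|) => x Ox vx; apply: contrapT => /eqP x0.
  have x0' : x *: delta_mx 0 i0 != 0 :> 'rV[K]_n.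
    apply/eqP => /rowP/(_ i0); rewrite !mxE !eqxx mulr1 => /eqP; exact/negP.
  have Ox' i : nu_integer v ((x *: delta_mx 0 i0 : 'rV[K]_n) 0 i).
    rewrite !mxE; apply: nu_integerM => //.
    by case: (_ && _); [exact: nu_integer1|left].
  have := good _ Ox' x0'; rewrite map_mxZ map_delta_mx bfZl (bfZr hsym) bf_delta subrK => /negP.
  apply; have h : vge vKv (`|N| + `|vKv (A i0 i0)|) (iota x) by rewrite vgei.
  apply: vge_le (vgeM hw h (vgeM hw h (vge_val vKv (A i0 i0)))).
  by clear; lia.
have [R cov] := integers_cocompact hp T0 hm ie0 hv vT hres hw ext hresk disc (@nu_integerB _ _).
pose O a := exists2 x, nu_integer v x & a = iota x.
have cover x : exists2 a, O a & vge vKv R (x - a).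
  by have [a Oa h] := cov x; exists (iota a) => //; exists a.
(* An integer close to an element of large absolute value. *)
have [th [Oth th0 wth]] : exists th, [/\ O th, th != 0 & vKv th < 0].
  have [y y0 wy] := val_ex hw (- `|R| - 1); have [a Oa h] := cover y.
  have [|a0 wa] := val_dom hw y0 (y := a).
    by rewrite (vgeBC hw); apply: vge_le h; rewrite wy; clear; lia.
  by exists a; split=> //; rewrite wa wy; clear; lia.
apply: hirr.
have O1 : O 1 by exists 1; [exact: nu_integer1|rewrite rmorph1].
have OB a a' : O a -> O a' -> O (a - a').
  by move=> [x Ox ->] [y Oy ->]; exists (x - y); [exact: nu_integerB|rewrite rmorphB].
have OM a a' : O a -> O a' -> O (a * a').
  by move=> [x Ox ->] [y Oy ->]; exists (x * y); [exact: nu_integerM|rewrite rmorphM].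
have Odisc a : O a -> vge vKv r a -> a = 0.
  by move=> [x Ox ->]; rewrite vgei => /(disc _ Ox) ->; rewrite rmorph0.
have OK a : O a -> exists x, a = iota x by move=> [x _ ->]; exists x.
have goodk (u : 'rV[Kv]_n) : (forall i, O (u 0 i)) -> u != 0 ->
    ~~ vge vKv (N - 1 + 1) (bform A u u).
  move=> Ou u0; have step i : exists x, nu_integer v x /\ u 0 i = iota x.
    by have [x Ox ex] := Ou i; exists x.
  have [x hx] := choice step.
  have eu : u = map_mx iota (\row_i x i).
    by apply/rowP => i; rewrite !mxE; case: (hx i).
  rewrite eu; apply: good; first by move=> i; rewrite mxE; case: (hx i).
  by apply: contra_neq u0 => e; rewrite eu e map_mx0.
exact: (rational_multiple hw hcomp hresk h2 w2 hpk O1 OB OM Odisc Oth th0 wth OK cover hn hsym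
  hnondeg goodk hiso).
Qed.
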